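(* Let $N$ be a lattice and let $X$ be any toric variety, with fan $\Sigma$ in $N$. Let $\Psi$ be a rigid complement map. For any non-singular subdivision $\Sigma'$ of $\Sigma$ such that $\Psi$ is a complement map for $\Sigma'$ (i.e. every cone of $\Sigma'$ lies in the domain of $\Psi$), let $X'$ be the toric variety with fan $\Sigma'$ and $\pi:X'\to X$ the induced proper birational toric map. Then the cycle Todd class $t_\Psi^{X'}(X)=\pi_*(t_\Psi(X'))\in Z_*(X)_{\mathbb Q}$ does not depend on the choice of $X'$ (that is, on the choice of $\Sigma'$).
   Context: $N$ is a lattice of rank $n$, $M=\operatorname{Hom}(N,\mathbb Z)$; a subscript $\mathbb Q$ means tensoring with $\mathbb Q$. ''Cone'' means strictly convex rational polyhedral cone in $N_{\mathbb Q}$; $\tau\prec\sigma$ means $\tau$ is a face of $\sigma$. For a fan $\Sigma$ with toric variety $X$ (over $\mathbb C$), $V(\sigma)$ is the torus-orbit closure of $\sigma\in\Sigma$ and $Z_*(X)_{\mathbb Q}$ is the $\mathbb Q$-vector space with basis the cycles $[V(\sigma)]$, $\sigma\in\Sigma$. Complement maps. A complement map is a map $\Psi$ from a set of cones in $N$ (its domain) to subspaces of $N_{\mathbb Q}$ such that (i) $\Psi(\sigma)$ is complementary to $\operatorname{span}(\sigma)$ in $N_{\mathbb Q}$; (ii) if $\tau\prec\sigma$ and $\sigma$ is in the domain, then $\tau$ is in the domain and $\Psi(\sigma)\subset\Psi(\tau)$. It is rigid if whenever $\sigma,\tau$ are cones with the same linear span and $\Psi(\sigma)$ is defined, then $\Psi(\tau)$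 is defined and equals $\Psi(\sigma)$. (For example, an inner product on $N_{\mathbb Q}$ gives the rigid complement map sending $\sigma$ to the orthogonal complement of its span.) $\Psi$ is a complement map for $\Sigma$ (or for $X$) if all cones of $\Sigma$ are in its domain. Ring structure. Let $\Sigma$ be simplicial and $\Psi$ a complement map for $\Sigma$. A torus-invariant $\mathbb Q$-Cartier divisor $D$ on $X$ has local equations $m_\sigma\in M_{\mathbb Q}$ for $\sigma$ a maximal cone of $\Sigma$: the coefficient of $V(\rho)$ in $D$, for a ray $\rho$ of $\sigma$ with first lattice point $v_\rho$, is $\langle m_\sigma,v_\rho\rangle$. For $\tau\in\Sigma$, let $\pi_\tau:M_{\mathbb Q}=\tau^\perp\oplus\Psi(\tau)^\perp\to\tau^\perp$ be the projection. $V(\tau)$ is the toric variety whose fan in $N_{\mathbb Q}/\operatorname{span}(\tau)$ consists of the cones $(\sigma+\operatorname{span}\tau)/\operatorname{span}\tau$, $\sigma\succ\tau$; let $D_\tau$ be the $\mathbb Q$-Cartier divisor on $V(\tau)$ with local equations $\pi_\tau(m_\sigma)$, and define $D\cdot[V(\tau)]=[D_\tau]\in Z_*(X)_{\mathbb Q}$. It is known that this extends to a well-defined commutative ring structure on $Z_*(X)_{\mathbb Q}$ with unit $[V(\{0\})]=[X]$, for which the product of the class of $D$ with $[V(\tau)]$ is $D\cdot[V(\tau)]$. Cycle Todd classes. A cone is non-singular if the first lattice points along its extreme rays form a basis of the lattice $N\cap\operatorname{span}$ of the cone; a fan is non-singular if all its cones are. If $\Sigma$ is non-singular, with rays $\rho_1,\dots,\rho_r$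 and $D_i$ the divisor $V(\rho_i)$, and $\Psi$ is a complement map for $\Sigma$, then $t_\Psi(X)=\prod_{i=1}^r\frac{D_i}{1-\exp(-D_i)}$, evaluated in $Z_*(X)_{\mathbb Q}$. If $\Sigma'$ is a subdivision of $\Sigma$ and $\pi:X'\to X$ the induced map, the push-forward $\pi_*:Z_*(X')_{\mathbb Q}\to Z_*(X)_{\mathbb Q}$ sends $[V(\sigma')]$ to $[V(\sigma)]$ if the smallest cone $\sigma$ of $\Sigma$ containing $\sigma'$ has the same dimension as $\sigma'$, and to $0$ otherwise. *)

(* Defs.v *)
From HB Require Import structures.
From mathcomp Require Import all_boot all_order all_algebra finmap.
From mathcomp Require Import boolp classical_sets.

Set Implicit Arguments.
Unset Strict Implicit.
Unset Printing Implicit Defensive.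

Import GRing.Theory Num.Theory.

Local Open Scope classical_set_scope.
Local Open Scope ring_scope.

(* Throughout, V is N_Q, a finite-dimensional rational vector space containing
   the lattice N as a subset, and 'Hom(V, rat^o) is M_Q. *)

Section Cones.
Variable V : vectType rat.
Implicit Types (N sigma tau rho : set V) (U W : {vspace V}).

Definition zspan (s : seq V) : set V :=
  [set v | exists z : 'I_(size s) -> int, v = \sum_(i < size s) s`_i *~ z i].

Definition zbasis N (s : seq V) : Prop := free s /\ N = zspan s.

Definition is_lattice N : Prop := exists s, zbasis N s /\ basis_of fullv s.

Definition cone_gen (s : seq V) : set V :=
  [set v | exists c : 'I_(size s) -> rat,
     (forall i, 0 <= c i) /\ v = \sum_(i < size s) c i *: s`_i].

(* Rationality is automatic, V being a vector space over rat. *)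
Definition is_cone sigma : Prop :=
  (exists s, sigma = cone_gen s) /\
  (forall v, sigma v -> sigma (- v) -> v = 0).

Definition is_span sigma U : Prop :=
  (forall v, sigma v -> v \in U) /\
  (forall W, (forall v, sigma v -> v \in W) -> (U <= W)%VS).

Definition cspan sigma : {vspace V} := xget fullv [set U | is_span sigma U].

Lemma cspanP sigma : is_span sigma (cspan sigma).
Proof.
apply: xgetPex.
pose P k := `[< exists s, (forall v, v \in s -> sigma v) /\ \dim <<s>>%VS = k >].
have exP : exists k, P k.
  by exists 0%N; apply/asboolP; exists [::]; split; rewrite ?span_nil ?dimv0.
have ubP k : P k -> (k <= \dim (@fullv _ V))%N.
  by move=> /asboolP[s [_ <-]]; apply/dimvS/subvf.
case: (ex_maxnP exP ubP) => k /asboolP[s [s_in s_dim]] k_max.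
exists <<s>>%VS; split=> [v sv|W sW]; last first.
  by apply/span_subvP => v /s_in /sW.
have sub : (<<s>> <= <<v :: s>>)%VS by rewrite span_cons addvSr.
suff -> : <<s>>%VS = <<v :: s>>%VS by rewrite memv_span ?mem_head.
apply/eqP; rewrite eqEdim sub s_dim; apply: k_max.
apply/asboolP; exists (v :: s); split=> // w.
by rewrite inE => /orP[/eqP->|/s_in].
Qed.

Definition cdim sigma : nat := \dim (cspan sigma).

Definition face tau sigma : Prop :=
  exists u : 'Hom(V, rat^o), (forall v, sigma v -> 0 <= u v :> rat) /\
    tau = [set v | sigma v /\ u v = 0].

(* v represents the first lattice point of the ray (sigma + U) / U of V / U,
   for the lattice image of N in V / U; it is determined modulo U.
   For U = 0 it is the first lattice point of the ray sigma. *)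
Definition first_point N U sigma (v : V) : Prop :=
  let L := N `&` [set x + u | x in sigma & u in [set` U]] `\` [set` U] in
  L v /\ forall w, L w -> exists2 c : rat, 1 <= c & w - c *: v \in U.

Definition nonsingular_cone N sigma : Prop :=
  exists s : seq V,
    (forall v, v \in s <->
       exists rho, [/\ face rho sigma, cdim rho = 1%N & first_point N 0 rho v])
    /\ zbasis (N `&` [set` cspan sigma]) s.

(* The values of cm_val outside cm_dom are irrelevant. *)
Record complement_map := ComplementMap {
  cm_dom : set (set V);
  cm_val :> set V -> {vspace V};
  cm_cone : forall sigma, cm_dom sigma -> is_cone sigma;
  cm_compl : forall sigma, cm_dom sigma ->
    (cspan sigma + cm_val sigma = fullv)%VS /\
    (cspan sigma :&: cm_val sigma = 0)%VS;
  cm_face : forall sigma tau, cm_dom sigma -> face tau sigma ->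
    cm_dom tau /\ (cm_val sigma <= cm_val tau)%VS
}.

Definition rigid (Psi : complement_map) : Prop :=
  forall sigma tau, is_cone sigma -> is_cone tau -> cspan sigma = cspan tau ->
    cm_dom Psi sigma -> cm_dom Psi tau /\ Psi tau = Psi sigma.

Definition annihilator U : {vspace 'Hom(V, rat^o)} :=
  (\bigcap_(v <- vbasis U) lker (linfun (fun m : 'Hom(V, rat^o) => m v)))%VS.

Lemma annihilatorP U (m : 'Hom(V, rat^o)) :
  m \in annihilator U <-> (forall v, v \in U -> m v = 0).
Proof.
have evE v (m' : 'Hom(V, rat^o)) :
    linfun (fun m : 'Hom(V, rat^o) => m v) m' = m' v.
  have lin : linear (fun m : 'Hom(V, rat^o) => m v).
    by move=> a m1 m2; rewrite add_lfunE scale_lfunE.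
  pose ev := HB.pack_for {linear 'Hom(V, rat^o) -> rat^o}
    (fun m : 'Hom(V, rat^o) => m v)
    (GRing.isLinear.Build rat _ _ *:%R (fun m : 'Hom(V, rat^o) => m v) lin).
  exact: (lfunE ev).
have -> : m \in annihilator U = all (fun v => m v == 0) (vbasis U).
  rewrite /annihilator; elim: (tval (vbasis U)) => [|v s IHs] /=.
    by rewrite big_nil memvf.
  by rewrite big_cons memv_cap IHs memv_ker evE.
split=> [/allP m0 v /coord_vbasis ->|m0].
  rewrite linear_sum big1 // => i _; rewrite linearZ /=.
  by rewrite (eqP (m0 _ (mem_nth _ _))) ?scaler0 // size_tuple.
by apply/allP => v /vbasis_mem /m0 ->.
Qed.

(* pi_tau : M_Q = tau^perp (+) Psi(tau)^perp -> tau^perp *)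
Definition perp_proj (Psi : complement_map) tau : 'End('Hom(V, rat^o)) :=
  daddv_pi (annihilator (cspan tau)) (annihilator (Psi tau)).

End Cones.

Section Fans.
Variable V : vectType rat.
Implicit Types (N sigma tau rho gamma : set V) (Sigma : {fset (set V)}).

Definition is_fan Sigma : Prop :=
  [/\ Sigma != fset0,
      forall sigma, sigma \in Sigma -> is_cone sigma,
      forall sigma tau, sigma \in Sigma -> face tau sigma -> tau \in Sigma
    & forall sigma tau, sigma \in Sigma -> tau \in Sigma ->
        face (sigma `&` tau) sigma /\ face (sigma `&` tau) tau].

Definition nonsingular_fan N Sigma : Prop :=
  forall sigma, sigma \in Sigma -> nonsingular_cone N sigma.

Definition complement_for (Psi : complement_map V) Sigma : Prop :=
  forall sigma, sigma \in Sigma -> cm_dom Psi sigma.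

Definition fan_support Sigma : set V :=
  [set v | exists2 sigma, sigma \in Sigma & sigma v].

Definition subdivision (Sigma' Sigma : {fset (set V)}) : Prop :=
  (forall sigma', sigma' \in Sigma' ->
     exists2 sigma, sigma \in Sigma & (sigma' `<=` sigma)) /\
  fan_support Sigma' = fan_support Sigma.

Definition maximal Sigma sigma : Prop :=
  sigma \in Sigma /\
  forall tau, tau \in Sigma -> (sigma `<=` tau) -> tau = sigma.

(* Z_*(X)_Q; the function with value a_sigma at sigma is the cycle
   \sum_sigma a_sigma [V(sigma)]. *)
Definition cycles Sigma := {ffun Sigma -> rat^o}.

Definition orbit_closure Sigma sigma : cycles Sigma :=
  [ffun tau : Sigma => (val tau == sigma)%:R].

Definition is_divisor Sigma (D : cycles Sigma) : Prop :=
  forall sigma : Sigma, cdim (val sigma) <> 1%N -> D sigma = 0.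

(* Only the values of m at maximal cones matter. *)
Definition local_equations N Sigma (D : cycles Sigma)
    (m : set V -> 'Hom(V, rat^o)) : Prop :=
  forall sigma (rho : Sigma) v, maximal Sigma sigma ->
    face (val rho) sigma -> cdim (val rho) = 1%N ->
    first_point N 0 (val rho) v -> m sigma v = D rho.

(* E = [D_tau], where D_tau is the divisor on V(tau) with local equations
   pi_tau(m sigma). The rays of the fan of V(tau) are the images of the cones
   gamma of Sigma having tau as a face of codimension 1. *)
Definition restricted_divisor N Sigma (Psi : complement_map V)
    (m : set V -> 'Hom(V, rat^o)) tau (E : cycles Sigma) : Prop :=
  forall gamma : Sigma,
    let is_ray := face tau (val gamma) /\ cdim (val gamma) = (cdim tau).+1 in
    (is_ray -> forall sigma v, maximal Sigma sigma -> face (val gamma) sigma ->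
       first_point N (cspan tau) (val gamma) v ->
       E gamma = perp_proj Psi tau (m sigma) v) /\
    (~ is_ray -> E gamma = 0).

(* For a non-singular fan the classes of divisors generate Z_*(X)_Q as a ring,
   so the last axiom determines the product. *)
Record cycle_ring N Sigma (Psi : complement_map V) := CycleRing {
  cmul : cycles Sigma -> cycles Sigma -> cycles Sigma;
  cmulA : associative cmul;
  cmulC : commutative cmul;
  cmul1 : left_id (orbit_closure Sigma [set 0]) cmul;
  cmul_linear : forall (a : rat) (x y z : cycles Sigma),
    cmul (a *: x + y) z = a *: cmul x z + cmul y z;
  cmul_divisor : forall (D : cycles Sigma) m (tau : Sigma),
    is_divisor D -> local_equations N D m ->
    restricted_divisor N Psi m (val tau)
      (cmul D (orbit_closure Sigma (val tau)))
}.

(* Coefficients of x / (1 - exp(-x)), obtained by inverting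
   (1 - exp(-x)) / x = \sum_k (-1)^k x^k / (k+1)!. *)
Fixpoint todd_coefs (k : nat) : seq rat :=
  if k is k'.+1 then
    let s := todd_coefs k' in
    rcons s (- \sum_(i < k) s`_i * ((-1) ^+ (k - i) / ((k - i).+1)`!%:R))
  else [:: 1].

Definition todd_coef (k : nat) : rat := (todd_coefs k)`_k.

Lemma todd_coef_rec (k : nat) :
  \sum_(i < k.+1) todd_coef i * ((-1) ^+ (k - i) / ((k - i).+1)`!%:R)
    = (k == 0%N)%:R.
Proof.
have size_t j : size (todd_coefs j) = j.+1.
  by elim: j => //= j IHj; rewrite size_rcons IHj.
have nth_t j i : (i <= j)%N -> (todd_coefs j)`_i = todd_coef i.
  elim: j => [|j IHj]; first by rewrite leqn0 => /eqP ->.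
  rewrite leq_eqVlt => /orP[/eqP->//|lt_ij].
  by rewrite /= nth_rcons size_t lt_ij IHj.
case: k => [|k]; first by rewrite big_ord1.
have fE : (-1) ^+ 0 / (1`!)%:R = 1 :> rat by rewrite expr0 divr1.
rewrite big_ord_recr /= subnn fE mulr1.
rewrite {2}/todd_coef /= nth_rcons size_t ltnn eqxx.
apply/eqP; rewrite subr_eq0; apply/eqP/eq_bigr => i _.
by rewrite nth_t // -ltnS.
Qed.

Section Todd.
Variables (N : set V) (Sigma : {fset (set V)}) (Psi : complement_map V).
Variable R : cycle_ring N Sigma Psi.

Let one : cycles Sigma := orbit_closure Sigma [set 0].

(* D / (1 - exp(-D)); multiplication by a divisor raises the dimension of
   cones by one, so D^k = 0 for k > \dim V and the series is finite. *)
Definition todd_series (D : cycles Sigma) : cycles Sigma :=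
  \sum_(k < (\dim (@fullv _ V)).+1) todd_coef k *: iter k (cmul R D) one.

Definition todd_class : cycles Sigma :=
  \big[cmul R/one]_(rho : Sigma | cdim (val rho) == 1%N)
    todd_series (orbit_closure Sigma (val rho)).

End Todd.

Definition smallest_cone Sigma sigma' sigma : Prop :=
  [/\ sigma \in Sigma, (sigma' `<=` sigma) &
      forall tau, tau \in Sigma -> (sigma' `<=` tau) ->
        (sigma `<=` tau)].

Definition pushforward (Sigma' Sigma : {fset (set V)}) (z : cycles Sigma') :
    cycles Sigma :=
  \sum_(sigma' : Sigma')
    z sigma' *: [ffun sigma : Sigma =>
      `[< smallest_cone Sigma (val sigma') (val sigma) /\
          cdim (val sigma') = cdim (val sigma) >]%:R].

End Fans.

(* Main.v *)
(* Fix a nonsingular fan S with complement map Psi. For a cone B write x_i for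
   its coordinate functions, and q_A for the projection onto the span of A along
   Psi(A). The multiplication rule of the cycle ring lifts to a decomposition of
   piecewise polynomials: if f represents the cycle z, then on every cone B
     f_B = \sum_(A face of B) (\prod_(i in A) x_i) * (h_A o q_A),
   where h_A(0) is the coefficient of [V(A)] in z (with a formal variable
   recording degrees). For the Todd class f_B = \prod_i x_i / (1 - exp(-x_i)).
   Dividing by \prod_(i in B) x_i and summing over the cones B of the subdivision
   of F of full dimension, the left-hand side is \sum_B \prod_i 1/(1 - exp(-x_i)),
   and the right-hand side is the sum over A of h_A o q_A times a star sum
   \sum_(B containing A) \prod_(i in B \ A) 1/x_i.

   The left-hand side, and likewise every star sum, does not depend on the
   subdivision: putting q = exp(-1) and evaluating at a lattice point w, expanding
   each factor 1/(1 - q^(x_i w)) in nonnegative powers of q yields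
   \sum_m q^(m w) over the lattice functionals m that are nonnegative on F. A star
   sum also vanishes unless A is full-dimensional in the cone G of Sigma whose
   relative interior it meets, since otherwise it is invariant under translations of w
   along G while its terms decay. If A is full-dimensional in G, rigidity shows
   that q_A depends only on G, so by induction on dim F the sums
   \sum_(A in F, dim A = dim F) h_A are the same for both subdivisions; at 0 they
   are the coefficients of the push-forward. *)

Require Import Defs.
From HB Require Import structures.
From mathcomp Require Import all_boot all_order all_algebra finmap.
From mathcomp Require Import boolp classical_sets.
From mathcomp Require Import fintype finset ring lra zify.

Set Implicit Arguments.
Unset Strict Implicit.
Unset Printing Implicit Defensive.

Import Order.TTheory GRing.Theory Num.Theory.

Local Open Scope ring_scope.

(** * Truncated power series *)

(** The sums to be compared run over different sets of cones, and the signs of the x_i w vary from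
    cone to cone. Expanding every factor in nonnegative powers of q, whatever the sign of its
    exponent, puts all series in one ring: each cone counts, with a sign, the lattice functionals of
    a half-open dual cone, and for generic w the overlaps cancel exactly, without corrections from
    lower-dimensional cones. Only finitely many functionals of nonzero weight reach a given power of
    q, so truncated polynomials suffice and the substitution q = exp(- 'X) is formal. The identities
    hold for generic w interior to F, whereas the coefficients of a cycle are values at 0, where
    star sums have poles. This is why the h_A are kept as functions: they are polynomial along
    lines, so an equality far out in an interior direction carries over to every point of the
    span. *)

Section TruncatedSeries.
Implicit Types (p q : {poly rat}) (K n : nat).

Definition eqmod K p q := forall i, (i < K)%N -> p`_i = q`_i.

Lemma eqmod_refl K p : eqmod K p p.
Proof. by []. Qed.

Lemma eqmod_sym K p q : eqmod K p q -> eqmod K q p.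
Proof. by move=> H i /H. Qed.

Lemma eqmod_trans K p q r : eqmod K p q -> eqmod K q r -> eqmod K p r.
Proof. by move=> H1 H2 i ltiK; rewrite H1 // H2. Qed.

Lemma eqmodM K p p' q q' :
  eqmod K p p' -> eqmod K q q' -> eqmod K (p * q) (p' * q').
Proof.
move=> Hp Hq i ltiK; rewrite !coefM; apply: eq_bigr => j _.
by rewrite Hp ?Hq //; [exact: leq_ltn_trans (leq_subr _ _) ltiK
                     |exact: leq_ltn_trans (leq_ord j) ltiK].
Qed.

Lemma eqmodZ K c p q : eqmod K p q -> eqmod K (c *: p) (c *: q).
Proof. by move=> H i /H Hi; rewrite !coefZ Hi. Qed.

Lemma eqmodN K p q : eqmod K p q -> eqmod K (- p) (- q).
Proof. by move=> H i /H Hi; rewrite !coefN Hi. Qed.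

Lemma eqmodD K p p' q q' :
  eqmod K p p' -> eqmod K q q' -> eqmod K (p + q) (p' + q').
Proof. by move=> Hp Hq i ltiK; rewrite !coefD Hp ?Hq. Qed.

Lemma eqmod_sum (I : Type) (r : seq I) (P : pred I) K (F G : I -> {poly rat}) :
  (forall i, P i -> eqmod K (F i) (G i)) ->
  eqmod K (\sum_(i <- r | P i) F i) (\sum_(i <- r | P i) G i).
Proof. by move=> H; elim/big_rec2: _ => // i p q /H; apply: eqmodD. Qed.

Lemma eqmod_prod (I : eqType) (r : seq I) K (F G : I -> {poly rat}) :
  {in r, forall i, eqmod K (F i) (G i)} ->
  eqmod K (\prod_(i <- r) F i) (\prod_(i <- r) G i).
Proof.
move=> H; rewrite !big_seq; elim/big_rec2: _ => // i p q /H; exact: eqmodM.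
Qed.

(** Because q has order exactly 1 at 0, dividing by it costs one order of precision; the
    coefficients of p vanish one after the other, lowest first. *)
Lemma eqmod_cancel K p q :
  q`_0 = 0 -> q`_1 != 0 -> eqmod K.+1 (p * q) 0 -> eqmod K p 0.
Proof.
move=> q0 q1 H i; rewrite coef0; have [m] := ubnP i.
elim: m i => // m IHm i /ltnSE-leim ltiK.
have := H i.+1 ltiK; rewrite coef0 coefM !big_ord_recr /= subnn q0 mulr0 addr0.
rewrite subSnn big1 ?add0r => [/eqP|j _]; last first.
  rewrite IHm ?mul0r //; first exact: leq_trans leim.
  exact: ltn_trans (ltn_ord j) ltiK.
by rewrite mulf_eq0 (negPf q1) orbF => /eqP.
Qed.

Lemma eqmod_cancel_prod (I : eqType) (r : seq I) (F : I -> {poly rat}) K p :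
  {in r, forall i, (F i)`_0 = 0 /\ (F i)`_1 != 0} ->
  eqmod (size r + K) (p * \prod_(i <- r) F i) 0 -> eqmod K p 0.
Proof.
elim: r p => [|a r IHr] p HF; first by rewrite big_nil mulr1.
rewrite big_cons mulrCA mulrC addSn => H.
have [F0 F1] := HF a (mem_head _ _).
apply: IHr (eqmod_cancel F0 F1 H) => i ri; apply: HF.
by rewrite inE ri orbT.
Qed.

(* exp (- x 'X), truncated *)
Definition exp_trunc K (x : rat) : {poly rat} :=
  \poly_(l < K) ((- x) ^+ l / l`!%:R).

Lemma coef_exp K x i :
  (i < K)%N -> (exp_trunc K x)`_i = (- x) ^+ i / i`!%:R.
Proof. by move=> ltiK; rewrite coef_poly ltiK. Qed.

Lemma exp_truncD K x y :
  eqmod K (exp_trunc K x * exp_trunc K y) (exp_trunc K (x + y)).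
Proof.
move=> i ltiK; rewrite coefM coef_exp // opprD addrC exprDn mulr_suml.
apply: eq_bigr => j _.
rewrite !coef_exp ?(leq_ltn_trans (leq_subr _ _) ltiK) //; last first.
  exact: leq_ltn_trans (leq_ord j) ltiK.
have fne (m : nat) : (m`!)%:R != 0 :> rat by rewrite pnatr_eq0 -lt0n fact_gt0.
have := bin_fact (leq_ord j) => /(congr1 (fun m => m%:R : rat)) /=.
rewrite !natrM => <-; rewrite -mulr_natr.
have binne : 'C(i, j)%:R != 0 :> rat.
  by rewrite pnatr_eq0 -lt0n bin_gt0 -ltnS.
by field; rewrite !fne binne.
Qed.

Lemma exp_trunc0 K : eqmod K (exp_trunc K 0) 1.
Proof.
move=> i ltiK; rewrite coef_exp // oppr0 coef1 expr0n.
by case: i ltiK => [|i] _; rewrite ?fact0 ?divr1 ?mul0r.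
Qed.

Lemma exp_truncX K (a : nat) : eqmod K (exp_trunc K 1 ^+ a) (exp_trunc K a%:R).
Proof.
elim: a => [|a IHa]; first by rewrite expr0; apply/eqmod_sym/exp_trunc0.
rewrite exprS -nat1r; apply: eqmod_trans (@exp_truncD K 1 a%:R).
exact: eqmodM.
Qed.

Definition todd_poly n (x : rat) : {poly rat} :=
  \poly_(k < n) (todd_coef k * x ^+ k).

(** The recurrence [todd_coef_rec], scaled by powers of x. The constant coefficient of
    [1 - exp_trunc K x] is 0, so the top term of each convolution drops out. *)
Lemma todd_poly_exp K x :
  eqmod K (todd_poly K x * (1 - exp_trunc K x)) (x *: 'X).
Proof.
move=> [|i] ltiK; rewrite coefM coefZ coefX /=.
  rewrite big_ord1 coefB coef1 coef_exp // expr0 fact0 divr1 subrr !mulr0.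
  by [].
rewrite big_ord_recr /= subnn coefB coef1 coef_exp ?(leq_trans _ ltiK) //.
rewrite expr0 fact0 divr1 subrr mulr0 addr0 eqSS.
rewrite [LHS](eq_bigr (fun j : 'I_i.+1 => x ^+ i.+1 *
   (todd_coef j * ((-1) ^+ (i - j) / ((i - j).+1)`!%:R)))); last first.
  move=> j _; have leji : (j <= i)%N := leq_ord j.
  rewrite coef_poly (leq_trans (leqW (ltn_ord j))) // coefB coef1 coef_exp; last first.
    exact: leq_ltn_trans (leq_subr _ _) ltiK.
  have -> : x ^+ i.+1 = x ^+ j * (x * x ^+ (i - j)).
    by rewrite -exprS -exprD; congr (_ ^+ _); lia.
  rewrite subSn // sub0r exprS [(- x) ^+ (i - j)]exprNn.
  have fne (m : nat) : (m`!)%:R != 0 :> rat by rewrite pnatr_eq0 -lt0n fact_gt0.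
  by field; rewrite fne.
rewrite -!mulr_sumr todd_coef_rec; case: i ltiK => [|i] _ /=; last by rewrite !mulr0.
by rewrite expr1.
Qed.

End TruncatedSeries.

(** * Expansions of 1 / (1 - q^a) *)

Section GeometricSeries.
Implicit Types (a : int) (K n N : nat).

(* The expansion of 1 / (1 - q^a) in nonnegative powers of q, up to q^(|a| N):
   for a < 0 this is - \sum_(c < 0) q^(a c). *)
Definition geom N a : {poly rat} :=
  \sum_(j < N.*2.+1) ((N <= j)%N%:R - (a < 0)%R%:R) *: 'X^((absz a * absz (j%:Z - N%:Z)%R)%N).

(** Numerator of 1 / (1 - q^a) over the denominator 1 - q^|a|: for negative a the fraction equals -
    q^|a| / (1 - q^|a|). *)
Definition geom_num a : {poly rat} := if 0 < a then 1 else - 'X^(absz a).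

Lemma telescope_geom (b : nat) N :
  (\sum_(j < N) ('X^((b * j)%N) : {poly rat})) * (1 - 'X^b) = 1 - 'X^((b * N)%N).
Proof.
elim: N => [|N IHN]; first by rewrite big_ord0 mul0r muln0 expr0 subrr.
rewrite big_ord_recr /= mulrDl IHN mulnS exprD; ring.
Qed.

Lemma geom_pos N a : 0 < a ->
  geom N a = \sum_(j < N.+1) ('X^((absz a * j)%N) : {poly rat}).
Proof.
move=> a_gt0; rewrite /geom ltNge (ltW a_gt0) /=.
rewrite -(big_mkord xpredT (fun j => ((N <= j)%N%:R - 0) *: 'X^((absz a * absz (j%:Z - N%:Z)%R)%N))).
rewrite (big_cat_nat (n := N)) //=; last by lia.
rewrite big_nat big1 ?add0r => [|j /andP[_ ltjN]]; last first.
  by rewrite leqNgt ltjN subr0 scale0r.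
rewrite -{1}[N]add0n big_addn (_ : (N.*2.+1 - N)%N = N.+1); last by lia.
rewrite big_mkord; apply: eq_bigr => j _.
rewrite leq_addl subr0 scale1r; congr ('X^((_ * _)%N)); lia.
Qed.

Lemma geom_neg N a : a < 0 ->
  geom N a = - \sum_(j < N) ('X^((absz a * j.+1)%N) : {poly rat}).
Proof.
move=> a_lt0; rewrite /geom a_lt0 /=.
rewrite -(big_mkord xpredT (fun j => ((N <= j)%N%:R - 1) *: 'X^((absz a * absz (j%:Z - N%:Z)%R)%N))).
rewrite (big_cat_nat (n := N)) //=; last by lia.
rewrite addrC big_nat big1 ?add0r => [|j /andP[leNj _]]; last first.
  by rewrite leNj subrr scale0r.
rewrite big_mkord -sumrN (reindex_inj rev_ord_inj) /=; apply: eq_bigr => j _.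
have ltjN := ltn_ord j.
rewrite leqNgt ltn_subrL ltnS /= (leq_trans _ ltjN) //= sub0r scaleN1r.
congr (- 'X^((_ * _)%N)); lia.
Qed.

(** Telescoping leaves an error of degree |a| * N.+1, beyond the truncation because |a| >= 1. *)
Lemma geomM N a : a != 0 ->
  eqmod N.+1 (geom N a * (1 - 'X^(absz a))) (geom_num a).
Proof.
move=> a_neq0 i ltiN; have abs_gt0 : (0 < absz a)%N by lia.
rewrite /geom_num; have [a_gt0|a_le0] := ltP 0 a.
  rewrite geom_pos // telescope_geom coefB coefXn ltn_eqF ?subr0 //.
  by rewrite (leq_trans ltiN) // leq_pmull.
have a_lt0 : a < 0 by lia.
rewrite geom_neg //.
under eq_bigr => j _ do rewrite mulnS exprD.
rewrite -mulr_sumr mulNr -mulrA telescope_geom mulrBr mulr1 -exprD -mulnS.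
rewrite !coefN coefB [X in _ - X]coefXn ltn_eqF ?subr0 //.
by rewrite (leq_trans ltiN) // leq_pmull.
Qed.

(** Under q = exp(- 'X) both sides are a 'X / (1 - q^a) multiplied by 1 - q^|a|. *)
Lemma todd_poly_geom K (a : int) : a != 0 ->
  eqmod K (todd_poly K a%:~R * (1 - exp_trunc K 1 ^+ (absz a)))
          (a%:~R *: 'X * (geom_num a \Po exp_trunc K 1)).
Proof.
move=> a_neq0; rewrite /geom_num; case: (ltP 0 a) => [a_gt0|a_le0].
  rewrite comp_polyC mulr1.
  have -> : a%:~R = (absz a)%:R :> rat by rewrite -[in LHS](gez0_abs (ltW a_gt0)).
  apply: (eqmod_trans _ (@todd_poly_exp K (absz a)%:R)).
  apply: eqmodM => //; apply: eqmodD => //; apply: eqmodN; exact: exp_truncX.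
have -> : a%:~R = - (absz a)%:R :> rat.
  by rewrite [in LHS](_ : a = - (absz a)%:Z) ?mulrNz //; lia.
set b := absz a; rewrite raddfN /= comp_Xn_poly.
set E := exp_trunc K 1 ^+ b; set E' := exp_trunc K (- b%:R).
have EE' : eqmod K (E * E') 1.
  apply: (@eqmod_trans _ _ (exp_trunc K b%:R * E')).
    by apply: eqmodM => //; apply: exp_truncX.
  by apply: (eqmod_trans (@exp_truncD K _ _)); rewrite subrr; apply: exp_trunc0.
(* E stands for q^b and E' for q^(-b), so 1 - E = (1 - E') * (- E). *)
apply: (@eqmod_trans _ _ (todd_poly K (- b%:R) * (1 - E') * (- E))).
  rewrite -mulrA; apply: eqmodM => //.
  rewrite mulrN mulrBl mul1r opprB; apply: eqmodD => //.
  by rewrite mulrC; apply: eqmod_sym.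
apply: eqmodM => //; exact: todd_poly_exp.
Qed.
End GeometricSeries.

(* Clear denominators, conclude that the resulting polynomial in q is 0, substitute
   q = exp(- 'X), and cancel the denominators, which vanish at 0 to
   finite order. *)
Lemma todd_sum_eq0 (J : finType) (s : J -> rat) (e : J -> seq int) (r n : nat) :
  (forall j, size (e j) = r) ->
  (forall j a, a \in e j -> a != 0) ->
  (forall N, eqmod N.+1 (\sum_j s j *: \prod_(a <- e j) geom N a) 0) ->
  eqmod n (\sum_j s j *: \prod_(a <- e j) ((a%:~R : rat)^-1 *: todd_poly n a%:~R)) 0.
Proof.
move=> size_e e_neq0 geom0.
pose den j : {poly rat} := \prod_(a <- e j) (1 - 'X^(absz a)).
pose num j : {poly rat} := \prod_(a <- e j) geom_num a.
pose rest j : {poly rat} := \prod_(j' | j' != j) den j'.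
have denE j : \prod_j' den j' = den j * rest j by rewrite (bigD1 j).
have P0 : \sum_j s j *: (num j * rest j) = 0.
  apply/polyP => i; rewrite coef0.
  have := eqmodM (geom0 i) (eqmod_refl (\prod_j den j)).
  rewrite mul0r => H.
  suff: eqmod i.+1 (\sum_j s j *: (num j * rest j)) 0.
    by move=> /(_ i (ltnSn i)) ->; rewrite coef0.
  apply: eqmod_trans H; rewrite mulr_suml; apply: eqmod_sum => j _; rewrite -scalerAl; apply: eqmodZ.
  rewrite (denE j) mulrA; apply: eqmodM => //; rewrite -big_split /=.
  apply/eqmod_sym/eqmod_prod => a aej; apply: geomM; exact: e_neq0 aej.
(* Each denominator collected in [es] costs one order of precision, hence the surplus [size es] in
   K. *)
pose es := flatten [seq e j | j <- enum J].
pose K := (size es + n)%N; pose E := exp_trunc K 1.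
(* The case n = 0 is void. Otherwise K is at least 2 whenever [es] is nonempty, so the coefficient
   of 'X in each denominator survives the truncation. *)
case: n @K @E => [|n] K E //.
have EX a : a \in es -> a != 0 ->
    (1 - E ^+ (absz a))`_0 = 0 /\ (1 - E ^+ (absz a))`_1 != 0.
  move=> aes a_neq0; have es_gt0 : (0 < size es)%N by case: (es) aes.
  rewrite !coefB !coef1 /E !(exp_truncX (K := K)) ?coef_exp /K; try (clearbody es; lia).
  by rewrite expr0 divr1 subrr sub0r expr1 divr1 opprK pnatr_eq0 absz_eq0.
have es_neq0 a : a \in es -> a != 0.
  by case/flattenP => _ /mapP[j _ ->] /e_neq0.
have denC : (\prod_j den j) \Po E = \prod_(a <- es) (1 - E ^+ (absz a)).
  rewrite rmorph_prod /= /es big_flatten big_map big_enum /=.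
  apply: eq_bigr => j _; rewrite rmorph_prod; apply: eq_bigr => a _.
  by rewrite /= rmorphB rmorph1 /= comp_Xn_poly.
apply: (@eqmod_trans _ _
  (\sum_j s j *: \prod_(a <- e j) ((a%:~R)^-1 *: todd_poly K a%:~R))).
  apply: eqmod_sum => j _; apply: eqmodZ; apply: eqmod_prod => a _.
  apply: eqmodZ => i lti; rewrite !coef_poly lti ltn_addl //.
apply: (@eqmod_cancel_prod _ es (fun a => 1 - E ^+ (absz a))) => [a aes|].
  by apply: EX => //; apply: es_neq0.
(* Every j has exactly r factors, so the same power 'X^r comes out of all summands and [P0]
   applies. *)
rewrite -denC -/K; apply: (@eqmod_trans _ _
   ('X^r * ((\sum_j s j *: (num j * rest j)) \Po E))); last first.
  by rewrite P0 comp_poly0 mulr0.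
rewrite raddf_sum /= mulr_suml mulr_sumr; apply: eqmod_sum => j _.
rewrite -scalerAl comp_polyZ -scalerAr; apply: eqmodZ.
rewrite (denE j) !comp_polyM !mulrA; apply: eqmodM => //.
rewrite -(size_e j) /den /num !rmorph_prod /= -big_split /=.
have XE (F : int -> {poly rat}) l :
    'X^(size l) * \prod_(a <- l) F a = \prod_(a <- l) ('X * F a).
  elim: l => [|a l IHl]; first by rewrite !big_nil mulr1.
  by rewrite !big_cons -IHl /= exprS; ring.
rewrite XE; apply: eqmod_prod => a /e_neq0 a_neq0.
have a1 : (a%:~R : rat) != 0 by rewrite intr_eq0.
have := eqmodZ (a%:~R)^-1 (@todd_poly_geom K _ a_neq0).
by rewrite rmorphB rmorph1 /= comp_Xn_poly -!scalerAl scalerA mulVf // scale1r.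
Qed.

Lemma eventually_forall (I : finType) (P : I -> nat -> Prop) :
  (forall i, exists n0, forall n, (n0 <= n)%N -> P i n) ->
  exists n0, forall i n, (n0 <= n)%N -> P i n.
Proof.
move=> /fin_all_exists[f fP]; exists (\max_i f i) => i n le_n.
by apply: fP; apply: leq_trans le_n; apply: leq_bigmax.
Qed.

Lemma archi_nat (x y : rat) : 0 < y -> exists n0 : nat, forall n : nat,
  (n0 <= n)%N -> 0 < x + y *+ n.
Proof.
move=> y_gt0; exists (Num.bound `|x / y|) => n le_n.
have lt1 : `|x / y| < (Num.bound `|x / y|)%:R by apply: archi_boundP; rewrite normr_ge0.
have lt2 : `|x / y| < n%:R by rewrite (lt_le_trans lt1) ?ler_nat.
rewrite -mulr_natl; have : 0 < x / y + n%:R.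
  by move: lt2; rewrite ltr_norml => /andP[]; lra.
by rewrite -(pmulr_lgt0 _ y_gt0) mulrDl divfK ?gt_eqF.
Qed.

(** * Subdivided cones *)

Section Coordinates.
Variables (V : vectType rat) (T : finType) (e : T -> V).
Implicit Types (A B : {set T}) (w : V).

Definition pts A := [seq e i | i <- enum A].

(* The coordinate of w at [e i] in the basis [pts A] of [sp A]; it is 0 for i outside A. *)
Definition crd A i w : rat :=
  oapp (fun j => coord (in_tuple (pts A)) j w) 0 (insub (index i (enum A))).

Lemma crd_is_scalar A i : scalar (crd A i).
Proof.
by move=> c u v; rewrite /crd; case: insub => [j|] /=; rewrite ?linearP ?mulr0 ?addr0.
Qed.
HB.instance Definition _ A i :=
  GRing.isLinear.Build rat V rat _ (crd A i) (@crd_is_scalar A i).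

Definition sp A : {vspace V} := <<pts A>>%VS.

Lemma pts_sp A i : i \in A -> e i \in sp A.
Proof. by move=> iA; apply: memv_span; apply: map_f; rewrite mem_enum. Qed.

Lemma sp_subP A (U : {vspace V}) :
  (forall i, i \in A -> e i \in U) <-> (sp A <= U)%VS.
Proof.
split=> [AU|/subvP AU i /pts_sp /AU //].
by apply/span_subvP => v /mapP[i]; rewrite mem_enum => /AU ? ->.
Qed.

Lemma sp_sub A B : A \subset B -> (sp A <= sp B)%VS.
Proof. by move=> /subsetP AB; apply/sp_subP => i /AB /pts_sp. Qed.

Lemma crd_out A i w : i \notin A -> crd A i w = 0.
Proof.
move=> iA; rewrite /crd insubF //.
by rewrite size_map index_mem mem_enum (negPf iA).
Qed.

Lemma sum_ptsE A (c : T -> rat) :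
  \sum_(i in A) c i *: e i = \sum_(j < size (pts A)) (nth 0 [seq c i | i <- enum A] j) *: (pts A)`_j.
Proof.
rewrite -big_enum /= -(big_map (fun i => (c i, e i)) xpredT (fun p => p.1 *: p.2)).
rewrite (big_nth (0, 0)) big_mkord size_map /pts size_map.
apply: eq_bigr => j _; have [t0 _|T0] := pickP T; last first.
  by case: j => j; case: (enum A) => // t; have := T0 t.
by rewrite !(nth_map t0).
Qed.

Lemma crd_sum A w : w \in sp A -> w = \sum_(i in A) crd A i w *: e i.
Proof.
move=> wA; rewrite {1}(@coord_span _ _ _ (in_tuple (pts A)) w wA) sum_ptsE.
apply: eq_bigr => j _; congr (_ *: _).
have [t0 _|T0] := pickP T; last first.
  suff: (j < size (enum A))%N by case: (enum A) => // t; have := T0 t.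
  by rewrite -(size_map e).
have ltj : (j < size (enum A))%N by rewrite -(size_map e).
by rewrite (nth_map t0) // /crd index_uniq ?enum_uniq // valK.
Qed.

Lemma crd_uniq A (c : T -> rat) j : free (pts A) -> j \in A ->
  crd A j (\sum_(i in A) c i *: e i) = c j.
Proof.
move=> freeA jA; rewrite sum_ptsE /crd.
have ltj : (index j (enum A) < size (pts A))%N by rewrite size_map index_mem mem_enum.
rewrite insubT /= (coord_sum_free (X := in_tuple (pts A))) //=.
by rewrite (nth_map j) ?nth_index ?mem_enum //; rewrite index_mem mem_enum.
Qed.

Lemma sum_sp A (c : T -> rat) : \sum_(i in A) c i *: e i \in sp A.
Proof. by apply: memv_suml => i iA; apply: memvZ; apply: pts_sp. Qed.

Lemma crd_sub A B i w : free (pts B) -> A \subset B -> w \in sp A ->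
  crd B i w = crd A i w.
Proof.
move=> freeB sAB wA.
have [iB|iB] := boolP (i \in B); last first.
  by rewrite !crd_out //; apply: contra iB; apply: (subsetP sAB).
rewrite {1}(crd_sum wA).
have -> : \sum_(j in A) crd A j w *: e j = \sum_(j in B) crd A j w *: e j.
  rewrite [RHS](big_setID A) /= (setIidPr sAB) [X in _ = _ + X]big1 ?addr0 // => j.
  by rewrite inE => /andP[jA _]; rewrite crd_out // scale0r.
exact: crd_uniq.
Qed.

Lemma crd_pt A i j : free (pts A) -> j \in A -> crd A i (e j) = (i == j)%:R.
Proof.
move=> freeA jA; have [iA|iA] := boolP (i \in A); last first.
  by rewrite crd_out // (_ : i == j = false) //; apply: contraNF iA => /eqP ->.
rewrite -(@crd_uniq A (fun i => (i == j)%:R) i) //; congr (crd A i _).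
rewrite (bigD1 j) //= eqxx scale1r big1 ?addr0 // => l /andP[_ /negPf ->].
by rewrite scale0r.
Qed.

Lemma dim_sp A : free (pts A) -> \dim (sp A) = #|A|.
Proof. by move=> /eqnP; rewrite size_map -cardE. Qed.

Lemma sp_setD1 A i w : i \in A -> w \in sp A -> crd A i w = 0 -> w \in sp (A :\ i).
Proof.
move=> iA wA c0; rewrite (crd_sum wA) (big_setD1 i) //= c0 scale0r add0r.
exact: sum_sp.
Qed.

Definition in_cone A w := (w \in sp A) && [forall i in A, 0 <= crd A i w].

Lemma in_coneP A w :
  reflect (w \in sp A /\ forall i, i \in A -> 0 <= crd A i w) (in_cone A w).
Proof.
apply: (iffP andP) => -[wA Hw]; split=> //; last by apply/forall_inP.
by move=> i iA; apply: (forall_inP Hw).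
Qed.

(** It serves as a point of the relative interior of the cone A. *)
Definition pt_sum A : V := \sum_(i in A) e i.

Lemma pt_sum_sp A : pt_sum A \in sp A.
Proof. by apply: memv_suml => i; apply: pts_sp. Qed.

Lemma crd_pt_sum A i : free (pts A) -> i \in A -> crd A i (pt_sum A) = 1.
Proof.
move=> fA iA; rewrite -(@crd_uniq A (fun=> 1) i) //; congr (crd A i _).
by apply: eq_bigr => j _; rewrite scale1r.
Qed.

End Coordinates.

Section SubdividedCone.
Variables (V : vectType rat) (T : finType) (e : T -> V) (K : {set {set T}}).
Variables (F : V -> Prop) (U : {vspace V}).
Implicit Types (A B t : {set T}) (u v w x : V) (M N : nat) (W : {vspace V}).

(* K indexes the simplicial cones of a subdivision of the convex cone F with span U. *)
Record subdivided : Prop := Subdivided {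
  sd_free : forall A, A \in K -> free (pts e A);
  sd_sub : forall A B : {set T}, A \in K -> B \subset A -> B \in K;
  sd_cap : forall A B w, A \in K -> B \in K ->
    in_cone e A w -> in_cone e B w -> in_cone e (A :&: B) w;
  sd_pts : forall A i, A \in K -> i \in A -> F (e i);
  sd_cover : forall w, F w -> exists2 A, A \in K & in_cone e A w;
  sd_add : forall u v, F u -> F v -> F (u + v);
  sd_scale : forall c v, 0 <= c -> F v -> F (c *: v);
  sd_span : forall v, F v -> v \in U;
  sd_full : forall W : {vspace V}, (forall v, F v -> v \in W) -> (U <= W)%VS
}.

(** Interior relative to U, expressed without a topology: up to the factor N, the point w is moved
    by x / N and stays in F. *)
Definition interior w := F w /\ forall x, x \in U -> exists N : nat, F (x + w *+ N).

Definition generic (L : seq {vspace V}) w := all (fun X : {vspace V} => w \notin X) L.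

Definition walls : seq {vspace V} :=
  [seq sp e A | A : {set T} <- enum K & (#|A| < \dim U)%N].

Definition top (A : {set T}) := (A \in K) && (#|A| == \dim U).

Hypothesis sdK : subdivided.

Let Kfree := sd_free sdK.

Lemma cone_contains0 w : F w -> F 0.
Proof. by move=> Fw; rewrite -(scale0r w); apply: sd_scale. Qed.

Lemma cone_muln w N : F w -> F (w *+ N).
Proof. by move=> Fw; rewrite -scaler_nat; apply: sd_scale. Qed.

Lemma sp_subU A : A \in K -> (sp e A <= U)%VS.
Proof. by move=> AK; apply/sp_subP => i iA; apply: sd_span (sd_pts _ AK iA). Qed.

Lemma sp_top A : top A -> sp e A = U.
Proof.
case/andP=> AK /eqP cardA; apply/eqP.
by rewrite eqEdim sp_subU // (dim_sp (Kfree AK)) cardA leqnn.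
Qed.

Lemma genericP w : reflect (forall A, A \in K -> (#|A| < \dim U)%N -> w \notin sp e A)
  (generic walls w).
Proof.
apply: (iffP allP) => [H A AK ltA|H X /mapP[A]]; last first.
  by rewrite mem_filter mem_enum => /andP[ltA AK] ->; apply: H.
by apply: H; apply: map_f; rewrite mem_filter ltA mem_enum.
Qed.

Lemma generic_crd w A i : generic walls w -> w \in U -> top A -> i \in A ->
  crd e A i w != 0.
Proof.
move=> /genericP gw wU topA iA; have [AK /eqP cardA] := andP topA.
apply: contraTneq isT => c0; have := gw (A :\ i).
rewrite (sd_sub sdK AK (subsetDl _ _)) -cardA (cardsD1 i A) iA ltnS leqnn.
by rewrite sp_setD1 // ?sp_top // => /(_ isT isT).
Qed.

(* The full-dimensional cone A contains t and all points of t moved slightly along u. *)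
Definition good (t : {set T}) u (A : {set T}) :=
  [&& top A, t \subset A & [forall i in A :\: t, 0 < crd e A i u]].

Lemma crd_ray A t u N i : A \in K -> t \subset A -> i \in A ->
  crd e A i (u + pt_sum e t *+ N) = crd e A i u + (i \in t)%:R *+ N.
Proof.
move=> AK tA iA; rewrite linearD /= linearMn /=; congr (_ + _ *+ _).
rewrite (crd_sub i (Kfree AK) tA) ?pt_sum_sp //.
have [it|it] := boolP (i \in t); last by rewrite crd_out.
by rewrite crd_pt_sum // Kfree // (sd_sub sdK AK).
Qed.

(** Up to the factor N, [u + pt_sum e t *+ N] is an interior point of the cone t moved by u / N. Its
    coordinates in t grow with N, the others are those of u. *)
Lemma good_pos t u A : u \in U -> good t u A -> exists N0 : nat, forall N : nat,
  (N0 <= N)%N -> forall i, i \in A -> 0 < crd e A i (u + pt_sum e t *+ N).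
Proof.
move=> uU /and3P[topA tA /forall_inP pos]; have [AK _] := andP topA.
have /eventually_forall[N0 HN0] : forall i : T, exists N0, forall N, (N0 <= N)%N ->
    i \in A -> 0 < crd e A i (u + pt_sum e t *+ N).
  move=> i; have [it|it] := boolP (i \in t); last first.
    exists 0%N => N _ iA; rewrite crd_ray // (negPf it) mul0rn addr0.
    by apply: pos; rewrite inE it.
  have [N0 HN0] := @archi_nat (crd e A i u) 1 ltr01.
  by exists N0 => N /HN0 lt0 iA; rewrite crd_ray // it.
by exists N0 => N leN i; apply: HN0.
Qed.

Lemma sum_ray_U t u N : t \in K -> u \in U -> u + pt_sum e t *+ N \in U.
Proof.
move=> tK uU; apply: rpredD => //; apply: rpredMn.
by apply: subvP (pt_sum_sp _ _); apply: sp_subU.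
Qed.

(** A common point with all coordinates positive in both A and B lies in the cone [A :&: B], so
    neither set has an element outside the other. *)
Lemma good_uniq t u A B : t \in K -> u \in U -> good t u A -> good t u B -> A = B.
Proof.
move=> tK uU gA gB.
have [NA HA] := good_pos uU gA; have [NB HB] := good_pos uU gB.
pose w := u + pt_sum e t *+ maxn NA NB.
have wU : w \in U by apply: sum_ray_U.
have {}HA i : i \in A -> 0 < crd e A i w by apply: HA; rewrite leq_maxl.
have {}HB i : i \in B -> 0 < crd e B i w by apply: HB; rewrite leq_maxr.
case/and3P: gA => tA _ _; case/and3P: gB => tB _ _.
have [AK _] := andP tA; have [BK _] := andP tB.
have cA : in_cone e A w by apply/in_coneP; rewrite sp_top //; split=> // i /HA/ltW.
have cB : in_cone e B w by apply/in_coneP; rewrite sp_top //; split=> // i /HB/ltW.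
have /in_coneP[wAB _] := sd_cap sdK AK BK cA cB.
apply/setP => i; apply/idP/idP => [iA|iB].
  apply: contraTT (HA i iA) => iB; rewrite (crd_sub i (Kfree AK) (subsetIl A B)) //.
  by rewrite crd_out ?ltxx // inE negb_and iB orbT.
apply: contraTT (HB i iB) => iA; rewrite (crd_sub i (Kfree BK) (subsetIr A B)) //.
by rewrite crd_out ?ltxx // inE negb_and iA.
Qed.

Lemma in_cone_subset A w : F 0 -> A \in K -> in_cone e A w -> F w.
Proof.
move=> F0 AK /in_coneP[wA pos]; rewrite (crd_sum wA).
elim/big_ind: _ => // [u v|i iA]; first exact: sd_add.
by apply: sd_scale => //; [apply: pos|apply: sd_pts AK iA].
Qed.

Lemma cone_pt_sum t : F 0 -> t \in K -> F (pt_sum e t).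
Proof.
move=> F0 tK; rewrite /pt_sum; elim/big_ind: _ => // [u v|i it]; first exact: sd_add.
exact: sd_pts tK it.
Qed.

(** Finitely many cones cover the points [u + pt_sum e t *+ M], so one cone A contains such points
    for arbitrarily large M. Its span contains u, which is generic, so A is full-dimensional. It
    also contains the direction [pt_sum e t], an interior point of t, whence t is a face of A. *)
Lemma good_exists t u (N : nat) : t \in K -> u \in U -> generic walls u ->
  F (u + pt_sum e t *+ N) -> exists A, good t u A.
Proof.
move=> tK uU gu FN; have F00 := cone_contains0 FN.
have FM M : (N <= M)%N -> F (u + pt_sum e t *+ M).
  move=> /subnK <-; rewrite addnC mulrnDr addrA; apply: sd_add => //.
  by apply: cone_muln; apply: cone_pt_sum.
have [A AK io] : exists2 A, A \in K & forall M0, exists2 M, (M0 <= M)%N &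
    in_cone e A (u + pt_sum e t *+ M).
  apply: contrapT => notA.
  have /eventually_forall[M0 HM0] : forall A : {set T}, exists M0, forall M,
      (M0 <= M)%N -> A \in K -> ~~ in_cone e A (u + pt_sum e t *+ M).
    move=> A; apply: contrapT => H; apply: notA.
    have AK : A \in K.
      apply: contrapT => /negP AK; apply: H; exists 0%N => M _.
      by rewrite (negPf AK).
    exists A => // M0; apply: contrapT => H'; apply: H; exists M0 => M leM _.
    by apply/negP => c; apply: H'; exists M.
  have [A AK cA] := sd_cover sdK (FM (maxn N M0) (leq_maxl _ _)).
  by have := HM0 A _ (leq_maxr N M0) AK; rewrite cA.
have [M1 _ /in_coneP[sp1 _]] := io 0%N.
have [M2 lt12 /in_coneP[sp2 _]] := io M1.+1.
have pA : pt_sum e t \in sp e A.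
  have : (u + pt_sum e t *+ M2) - (u + pt_sum e t *+ M1) \in sp e A by apply: rpredB.
  rewrite opprD addrACA subrr add0r -mulrnBr 1?ltnW // -scaler_nat.
  by rewrite rpredZeq pnatr_eq0 subn_eq0 leqNgt lt12.
have uA : u \in sp e A.
  by rewrite -(addrK (pt_sum e t *+ M1) u); apply: rpredB => //; apply: rpredMn.
have ppos i : i \in A -> 0 <= crd e A i (pt_sum e t).
  move=> iA; rewrite leNgt; apply/negP => lt0.
  have [M0 HM0] := @archi_nat (- crd e A i u) (- crd e A i (pt_sum e t)) ltac:(by rewrite oppr_gt0).
  have [M leM /in_coneP[_ /(_ i iA)]] := io M0.
  rewrite linearD /= linearMn /= leNgt => /negP; apply.
  by rewrite -oppr_gt0 opprD -mulNrn; apply: HM0.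
have cAp : in_cone e A (pt_sum e t) by apply/in_coneP.
have ct : in_cone e t (pt_sum e t).
  apply/in_coneP; rewrite pt_sum_sp; split=> // i it.
  by rewrite crd_pt_sum ?ler01 ?Kfree.
have /in_coneP[pAt _] := sd_cap sdK AK tK cAp ct.
have tA : t \subset A.
  apply/subsetP => i it; have := crd_pt_sum (Kfree tK) it.
  rewrite (crd_sub i (Kfree tK) (subsetIr A t)) //.
  apply: contra_eqT => iA; rewrite crd_out; last by rewrite inE negb_and iA.
  by rewrite eq_sym oner_neq0.
have topA : top A.
  rewrite /top AK eqn_leq -(dim_sp (Kfree AK)) dimvS ?sp_subU //=.
  rewrite leqNgt; apply/negP; rewrite (dim_sp (Kfree AK)) => ltA.
  by move/genericP: gu => /(_ A AK ltA); rewrite uA.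
exists A; rewrite /good topA tA; apply/forall_inP => i; rewrite inE => /andP[it iA].
rewrite lt_neqAle eq_sym generic_crd //=.
have [M _ /in_coneP[_ /(_ i iA)]] := io 0%N.
by rewrite crd_ray // (negPf it) mul0rn addr0.
Qed.

(* Moving the relative interior point [pt_sum e t] of the cone t slightly in a
   generic direction u, one either leaves F or enters exactly one full-dimensional
   cone. *)
Lemma local_count t u : t \in K -> u \in U -> generic walls u -> F 0 ->
  \sum_(A | top A && (t \subset A)) \prod_(i in A :\: t) (0 < crd e A i u)%R%:R =
  (`[< exists N : nat, F (u + pt_sum e t *+ N) >])%:R :> rat.
Proof.
move=> tK uU gu F00.
have prodE A : \prod_(i in A :\: t) (0 < crd e A i u)%R%:R =
    [forall i in A :\: t, 0 < crd e A i u]%:R :> rat.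
  have [/forall_inP H|/forall_inPn[i iA H]] := boolP [forall i in A :\: t, 0 < crd e A i u].
    by rewrite big1 // => i /H ->.
  by rewrite (bigD1 i) //= (negPf H) mul0r.
under eq_bigr => A _ do rewrite prodE.
case: asboolP => [[N FN]|noN] /=.
  have [A gA] := good_exists tK uU gu FN; have [topA tA posA] := and3P gA.
  rewrite (bigD1 A) ?topA ?tA //= posA big1 ?addr0 // => B /andP[/andP[topB tB] neB].
  case: (boolP [forall i in B :\: t, 0 < crd e B i u]) => // posB.
  by case/eqP: neB; apply: good_uniq gA; rewrite // /good topB tB.
apply: big1 => A /andP[topA tA].
case: (boolP [forall i in _, _]) => // posA; case: noN.
have gA : good t u A by rewrite /good topA tA.
have [N HN] := good_pos uU gA; exists N.
apply: (@in_cone_subset A) => //; first by case/andP: topA.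
apply/in_coneP; rewrite sp_top // sum_ray_U //; split=> // i iA.
by apply/ltW/HN.
Qed.

End SubdividedCone.

(** The factors are extended to all of T, with f = 1, g = 0 on t and f = 0, g = 1 outside A;
    distributing over all subsets of T then leaves only those between t and A. *)
Lemma prod_addr_sets (R : comNzRingType) (T : finType) (t A : {set T}) (a b : T -> R) :
  t \subset A ->
  \prod_(i in A :\: t) (a i + b i) =
  \sum_(B : {set T} | (t \subset B) && (B \subset A))
     (\prod_(i in B :\: t) a i) * \prod_(i in A :\: B) b i.
Proof.
move=> tA; pose f i := if i \in t then 1 else if i \in A then a i else 0.
pose g i := if i \in t then 0 else if i \in A then b i else 1.
have -> : \prod_(i in A :\: t) (a i + b i) = \prod_i (f i + g i).
  rewrite [LHS]big_mkcond; apply: eq_bigr => i _; rewrite !inE /f /g.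
  by case: ifP => //=; case: (i \in t); case: (i \in A); rewrite ?addr0 ?add0r.
rewrite bigA_distr /= (bigID (fun B : {set T} => (t \subset B) && (B \subset A))) /=.
rewrite [X in _ + X]big1 ?addr0 => [|B]; last first.
  rewrite negb_and => /orP[] /subsetPn[i i1 i2]; rewrite (bigD1 i) //=.
    by rewrite (negPf i2) /g i1 mul0r.
  rewrite i1 /f (negPf i2); case: ifP => [it|_]; last by rewrite mul0r.
  by rewrite (subsetP tA) in i2.
apply: eq_bigr => B /andP[tB BA].
rewrite [in RHS]big_mkcond [X in _ * X]big_mkcond -big_split /=.
apply: eq_bigr => i _; rewrite !inE /f /g.
have [iB|iB] := boolP (i \in B) => /=; rewrite ?(subsetP BA _ iB) ?mulr1 ?mul1r.
  by case: (i \in t).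
rewrite (_ : i \in t = false) /=; last by apply: contraNF iB; apply: (subsetP tB).
by rewrite mul1r.
Qed.

Section Genericity.
Variables (V : vectType rat).
Implicit Types (L : seq {vspace V}) (b x : V).

(** Two points of the ray in the same subspace X would put a multiple of b into X; each X therefore
    excludes at most one s. *)
Lemma generic_far L b x : generic L b ->
  exists s0, forall s, (s0 <= s)%N -> generic L (x + b *+ s).
Proof.
elim: L => [|X L IHL] /=; first by exists 0%N.
case/andP=> bX /IHL[s0 H0].
have [[s1 s1X]|no] := pselect (exists s1 : nat, x + b *+ s1 \in X); last first.
  exists s0 => s /H0 -> ; rewrite andbT; apply/negP => sX; apply: no; by exists s.
exists (maxn s0 s1.+1) => s; rewrite geq_max => /andP[/H0 -> lt1]; rewrite andbT.
apply: contra bX => sX.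
have : (x + b *+ s) - (x + b *+ s1) \in X by apply: rpredB.
rewrite opprD addrACA subrr add0r -mulrnBr 1?ltnW // -scaler_nat.
by rewrite rpredZeq pnatr_eq0 subn_eq0 leqNgt lt1.
Qed.

Lemma generic_near L b x : generic L b ->
  exists s0, forall s, (s0 <= s)%N -> generic L (b + x *+ s).
Proof.
elim: L => [|X L IHL] /=; first by exists 0%N.
case/andP=> bX /IHL[s0 H0].
have [[s1 s1X]|no] := pselect (exists s1 : nat, b + x *+ s1 \in X); last first.
  exists s0 => s /H0 -> ; rewrite andbT; apply/negP => sX; apply: no; by exists s.
exists (maxn s0 s1.+1) => s; rewrite geq_max => /andP[/H0 -> lt1]; rewrite andbT.
apply: contra bX => sX.
have xX : x \in X.
  have : (b + x *+ s) - (b + x *+ s1) \in X by apply: rpredB.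
  rewrite opprD addrACA subrr add0r -mulrnBr 1?ltnW // -scaler_nat.
  by rewrite rpredZeq pnatr_eq0 subn_eq0 leqNgt lt1.
by rewrite -(addrK (x *+ s1) b); apply: rpredB => //; apply: rpredMn.
Qed.

Lemma generic_cat L1 L2 b : generic (L1 ++ L2) b = generic L1 b && generic L2 b.
Proof. exact: all_cat. Qed.

Lemma genericZ L b (c : rat) : c != 0 -> generic L (c *: b) = generic L b.
Proof.
by move=> c0; apply: eq_all => X; rewrite /= rpredZeq (negPf c0).
Qed.

End Genericity.

(** * Signed counts of full-dimensional cones *)

Section PolarizedCount.
Variables (V : vectType rat) (T : finType) (e : T -> V) (K : {set {set T}}).
Variables (F : V -> Prop) (U : {vspace V}).
Implicit Types (A B t : {set T}) (u v w x : V) (M N : nat) (W : {vspace V}).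
Implicit Types (m : 'Hom(V, rat^o)).
Hypothesis sdK : subdivided e K F U.
Local Notation interior := (interior F U).
Local Notation walls := (walls e K U).
Local Notation top := (top K U).

Lemma interiorD x w : F x -> interior w -> interior (x + w).
Proof.
move=> Fx [Fw Hw]; split; first exact: (sd_add sdK).
move=> y /Hw[N FN]; exists N; rewrite mulrnDl addrCA; apply: (sd_add sdK) => //.
exact: (cone_muln sdK).
Qed.

Lemma interior_near w x s : interior w -> F x -> interior (w + x *+ s).
Proof. by move=> iw Fx; rewrite addrC; apply: interiorD => //; apply: (cone_muln sdK). Qed.

Lemma interiorZ c w : 0 < c -> interior w -> interior (c *: w).
Proof.
move=> c0 [Fw Hw]; split; first by apply: (sd_scale sdK) => //; apply: ltW.
move=> x /(memvZ c^-1) /Hw[N FN]; exists N.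
have -> : x + (c *: w) *+ N = c *: (c^-1 *: x + w *+ N).
  by rewrite scalerDr scalerA mulfV ?gt_eqF // scale1r scalerMnr.
by apply: (sd_scale sdK) => //; apply: ltW.
Qed.

Lemma interior_far x w : x \in U -> interior w ->
  exists s0, forall s, (s0 <= s)%N -> interior (x + w *+ s).
Proof.
move=> xU iw; have [_ /(_ x xU)[N FN]] := iw; exists N.+1 => s /subnKC <-.
have -> : x + w *+ (N.+1 + (s - N.+1)) = (x + w *+ N) + (w *+ (s - N.+1) + w).
  by rewrite mulrnDr mulrSr -!addrA (addrC w).
apply: interiorD => //; apply: interiorD => //.
by apply: (cone_muln sdK); case: iw.
Qed.

(** As U is not contained in X, [sd_full] gives a point x of F outside X; adding a large multiple of
    x keeps b interior and moves it out of X. *)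
Lemma exists_generic L b0 : interior b0 ->
  (forall X, X \in L -> ~~ (U <= X)%VS) -> exists2 b, interior b & generic L b.
Proof.
move=> ib0; elim: L => [|X L IHL] HL; first by exists b0.
have [Y YL|b ib gb] := IHL; first by apply: HL; rewrite inE YL orbT.
have [bX|bX] := boolP (b \in X); last by exists b => //=; rewrite bX.
have [x Fx xX] : exists2 x, F x & x \notin X.
  apply: contrapT => no; have /negP[] := HL X (mem_head _ _).
  apply: (sd_full sdK) => v Fv; apply/negPn/negP => vX; apply: no; by exists v.
have [s0 Hs] := generic_near x gb.
exists (b + x *+ s0.+1); first exact: interior_near.
rewrite /= Hs // andbT; apply: contra xX => sX.
have : (b + x *+ s0.+1) - b \in X by apply: rpredB.
by rewrite addrC addKr -scaler_nat rpredZeq pnatr_eq0.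
Qed.

Lemma walls_proper X : X \in walls -> ~~ (U <= X)%VS.
Proof.
case/mapP=> A; rewrite mem_filter mem_enum => /andP[ltA AK] ->.
by apply: contraL ltA => /dimvS; rewrite (dim_sp (sd_free sdK AK)) -leqNgt.
Qed.

(* The coefficient of q^(m w) in the sum over the full-dimensional cones containing t
   of the products of the expansions of 1 / (1 - q^(crd A i w)) for i outside t. *)
Definition pcount t (m : 'Hom(V, rat^o)) w : rat :=
  \sum_(A | top A && (t \subset A))
    \prod_(i in A :\: t) ((0 <= (m (e i) : rat))%R%:R - (crd e A i w < 0)%R%:R).

(* Expanding the product over subsets, the part depending on w only asks, by
   [local_count], which cones are interior to F. *)
Lemma pcount_const t m w w' : t \in K -> interior w -> interior w' ->
  generic walls w -> generic walls w' -> pcount t m w = pcount t m w'.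
Proof.
move=> tK iw iw' gw gw'.
(* B collects t and the indices whose factor is taken from m. The conditions left over, that
   coordinates of u be negative, are those of [local_count] at - u, with a sign depending only on
   the size of B. *)
have pcE u : interior u -> generic walls u -> pcount t m u =
   \sum_(B | (B \in K) && (t \subset B))
     (\prod_(i in B :\: t) (0 <= (m (e i) : rat))%R%:R) *
     ((-1) ^+ (\dim U - #|B|) * `[< exists N, F (- u + pt_sum e B *+ N) >]%:R).
  move=> iu gu; have uU : u \in U by apply: (sd_span sdK); case: iu.
  have F0 : F 0 by apply: (cone_contains0 sdK (w := u)); case: iu.
  rewrite /pcount.
  under eq_bigr => A /andP[_ tA] do rewrite prod_addr_sets //.
  rewrite (exchange_big_dep (fun B => (B \in K) && (t \subset B))) /=; last first.
    by move=> A B /andP[/andP[AK _] _] /andP[-> BA]; rewrite (sd_sub sdK AK BA).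
  apply: eq_bigr => B /andP[BK tB]; rewrite -mulr_sumr; congr (_ * _).
  rewrite -(local_count sdK) ?rpredN //; last first.
    by apply/allP => X XL; rewrite rpredN; apply: (allP gu).
  rewrite mulr_sumr; apply: eq_big => [A|A].
    rewrite tB /=; have [BA|] := boolP (B \subset A); last by rewrite !andbF.
    by rewrite (subset_trans tB BA) !andbT.
  case/and3P=> /andP[topA _] _ BA; have [AK /eqP cardA] := andP topA.
  have -> : (\dim U - #|B| = #|A :\: B|)%N by rewrite cardsD (setIidPr BA) cardA.
  rewrite -prodr_const -big_split /=; apply: eq_bigr => i _.
  by rewrite linearN /= oppr_gt0 mulN1r.
rewrite !pcE //; apply: eq_bigr => B /andP[BK tB]; congr (_ * (_ * (nat_of_bool _)%:R)).
have F0 : F 0 by apply: (cone_contains0 sdK (w := w)); case: iw.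
(* Adding the interior point v to a point of F shows that a multiple of [pt_sum e B] is interior, a
   condition that no longer involves v. *)
have sub v v' : interior v -> interior v' ->
    (exists N, F (- v + pt_sum e B *+ N)) -> exists N, F (- v' + pt_sum e B *+ N).
  move=> iv iv' [N FN].
  have [_ int_p] : interior (pt_sum e B *+ N).
    have -> : pt_sum e B *+ N = (- v + pt_sum e B *+ N) + v.
      by rewrite addrAC addNr add0r.
    exact: interiorD.
  have [|M FM] := int_p (- v'); first by rewrite rpredN; apply: (sd_span sdK); case: iv'.
  by exists (N * M)%N; rewrite mulrnA.
by apply/idP/idP => /asboolP H; apply/asboolP; apply: sub H.
Qed.

(* If m is negative somewhere on F, move w to an interior point where m is negative:
   there every summand has a vanishing factor. *)
Lemma pcountE t m w : t \in K -> interior w -> generic walls w ->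
  (forall i, i \in t -> m (e i) = 0) ->
  pcount t m w = `[< forall x, F x -> 0 <= (m x : rat) >]%:R.
Proof.
move=> tK iw gw m0.
have F0 : F 0 by apply: (cone_contains0 sdK (w := w)); case: iw.
case: asboolP => [m_ge0|/existsNP[x /not_implyP[Fx /negP]]]; last first.
  rewrite -ltNge => mx.
  have [s0 Hs0] := generic_near x gw.
  have [s1 Hs1] := @archi_nat (- m w : rat) (- m x) ltac:(by rewrite oppr_gt0).
  pose s := maxn s0 s1; pose w' := w + x *+ s.
  have iw' : interior w' by apply: interior_near.
  have gw' : generic walls w' by apply: Hs0; rewrite leq_maxl.
  have mw' : (m w' : rat) < 0.
    rewrite linearD linearMn -oppr_gt0 opprD -mulNrn; apply: Hs1.
    by rewrite leq_maxr.
  rewrite (pcount_const _ tK iw iw') //; apply: big1 => A /andP[topA tA].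
  have w'A : w' \in sp e A by rewrite (sp_top sdK topA); apply: (sd_span sdK); case: iw'.
  (* The value of m at w' is the sum of these products over A, and those with i in t are 0. *)
  have /exists_inP[i iA neg] : [exists i in A :\: t, crd e A i w' * (m (e i) : rat) < 0].
    apply: contraTT mw' => /exists_inPn noneg; rewrite -leNgt (crd_sum w'A).
    rewrite linear_sum sumr_ge0 // => i iA; rewrite linearZ /=.
    have [it|it] := boolP (i \in t); first by rewrite m0 // scaler0.
    by rewrite leNgt; apply: noneg; rewrite inE it.
  rewrite (bigD1 i) //=; suff -> : (0 <= (m (e i) : rat))%R = (crd e A i w' < 0)%R.
    by rewrite subrr mul0r.
  move: neg; case: (ltgtP (crd e A i w') 0) => [c|c|->]; rewrite ?mul0r ?ltxx //.
    by rewrite nmulr_rlt0 // => /ltW.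
  by rewrite pmulr_rlt0 // leNgt => ->.
have wU : w \in U by apply: (sd_span sdK); case: iw.
(* All factors now reduce to the indicator of a positive coordinate, and [local_count] applies in
   the direction of w itself. *)
transitivity (`[< exists N, F (w + pt_sum e t *+ N) >]%:R : rat); last first.
  by rewrite asboolT //; exists 0%N; rewrite addr0; case: iw.
rewrite -(local_count sdK) //; apply: eq_bigr => A /andP[topA tA].
apply: eq_bigr => i; rewrite inE => /andP[it iA].
have [AK _] := andP topA.
rewrite (m_ge0 _ (sd_pts sdK AK iA)).
have := generic_crd sdK gw wU topA iA.
by case: (ltgtP (crd e A i w) 0) => //=; rewrite ?subrr ?subr0.
Qed.

End PolarizedCount.

(** * Generating functions of lattice functionals *)

Section LatticeCount.
Variables (V : vectType rat) (T : finType) (e : T -> V) (K : {set {set T}}).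
Variables (F : V -> Prop) (U : {vspace V}) (N : V -> Prop).
Implicit Types (A B t : {set T}) (u v w x : V) (W : {vspace V}).
Implicit Types (m : 'Hom(V, rat^o)).
Hypothesis sdK : subdivided e K F U.
Local Notation interior := (interior F U).
Local Notation walls := (walls e K U).
Local Notation top := (top K U).

Definition unimodular := forall A v, top A -> v \in U ->
  (N v <-> forall i, i \in A -> crd e A i v \is a Num.int).

Hypothesis latK : unimodular.

(* The functionals on U / W that are integral on the image of the lattice,
   extended to V by 0 on a fixed complement of U. *)
Definition dual_lattice W m :=
  [/\ forall x, m x = m (projv U x), forall v, v \in W -> m v = 0
    & forall v, v \in U -> N v -> (m v : rat) \is a Num.int].

Definition dual_map A t (c : T -> rat) : 'Hom(V, rat^o) :=
  linfun (fun v => \sum_(i in A :\: t) c i * crd e A i (projv U v) : rat^o).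

Lemma dual_mapE A t c v :
  dual_map A t c v = \sum_(i in A :\: t) c i * crd e A i (projv U v).
Proof.
have lin : linear (fun v => \sum_(i in A :\: t) c i * crd e A i (projv U v) : rat^o).
  move=> k x y; rewrite scaler_sumr -big_split; apply: eq_bigr => i _ /=.
  by rewrite linearP linearP /= mulrDr mulrCA.
pose f := HB.pack_for {linear V -> rat^o}
  (fun v => \sum_(i in A :\: t) c i * crd e A i (projv U v) : rat^o)
  (GRing.isLinear.Build rat _ _ *:%R _ lin).
exact: (lfunE f).
Qed.

Lemma dual_map_pt A t c i : top A -> i \in A :\: t -> dual_map A t c (e i) = c i.
Proof.
move=> topA iD; have [AK _] := andP topA; move: (iD); rewrite inE => /andP[_ iA].
rewrite dual_mapE projv_id ?(subvP (sp_subU sdK AK)) ?pts_sp //.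
rewrite (bigD1 i) //= big1 ?addr0 => [|j /andP[jD ne_ji]].
  by rewrite crd_pt ?eqxx ?mulr1 // (sd_free sdK).
by rewrite crd_pt ?(negPf ne_ji) ?mulr0 // (sd_free sdK).
Qed.

Lemma dual_map_dual A t c : top A -> t \subset A ->
  (forall i, c i \is a Num.int) -> dual_lattice (sp e t) (dual_map A t c).
Proof.
move=> topA tA c_int; have [AK _] := andP topA; split=> [x|v vt|v vU Nv].
- by rewrite !dual_mapE; apply: eq_bigr => i _; rewrite projv_proj.
- rewrite dual_mapE projv_id; last first.
    by apply: subvP vt; apply: (sp_subU sdK); apply: (sd_sub sdK AK).
  apply: big1 => i; rewrite inE => /andP[it iA].
  by rewrite (crd_sub i (sd_free sdK AK) tA) // crd_out ?mulr0.
rewrite dual_mapE projv_id //; apply: rpred_sum => i; rewrite inE => /andP[_ iA].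
by apply: rpredM => //; apply: (latK topA vU).1.
Qed.

Lemma dual_latticeE A t m v : top A -> t \subset A -> dual_lattice (sp e t) m ->
  m v = \sum_(i in A :\: t) (m (e i) : rat) * crd e A i (projv U v).
Proof.
move=> topA tA [mU mt _]; rewrite mU.
have pA : projv U v \in sp e A by rewrite (sp_top sdK topA) memv_proj.
rewrite {1}(crd_sum pA) linear_sum (big_setID t) /= big1 ?add0r => [|i]; last first.
  by rewrite inE => /andP[_ it]; rewrite linearZ /= mt ?scaler0 ?pts_sp.
by apply: eq_bigr => i _; rewrite linearZ /= mulrC.
Qed.

Section Box.
Variables (A t : {set T}) (n : nat).
Hypotheses (topA : top A) (tA : t \subset A).

(** The shift by n matches the index of [geom], so that choosing one term in each factor of a
    product of [geom] amounts to choosing a functional in [box]. *)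
Definition box_fun (f : {ffun T -> 'I_(n.*2.+1)}) (i : T) : rat := (f i)%:R - n%:R.

Definition box : seq 'Hom(V, rat^o) :=
  [seq dual_map A t (box_fun f) |
    f : {ffun T -> 'I_(n.*2.+1)} <- enum (pffun_on ord0 (mem (A :\: t)) predT)].

Lemma box_uniq : uniq box.
Proof.
rewrite map_inj_in_uniq ?enum_uniq // => f g.
rewrite !mem_enum => /pfamilyP[/supportP f0 _] /pfamilyP[/supportP g0 _] eq_fg.
apply/ffunP => i; have [iD|iD] := boolP (i \in A :\: t); last by rewrite f0 ?g0.
have := congr1 (fun h : 'Hom(V, rat^o) => h (e i) : rat) eq_fg.
rewrite !dual_map_pt // /box_fun => /addIr /eqP; rewrite eqr_nat => /eqP.
exact: val_inj.
Qed.

Lemma mem_box m : m \in box <->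
  dual_lattice (sp e t) m /\ forall i, i \in A :\: t -> `|m (e i) : rat| <= n%:R.
Proof.
split=> [/mapP[f]|[dm small]].
  rewrite mem_enum => _ ->; split.
    apply: dual_map_dual => // i; rewrite /box_fun rpredB ?rpred_nat //.
  move=> i iD; rewrite dual_map_pt // /box_fun.
  have f_le : (f i)%:R <= n%:R + n%:R :> rat.
    by rewrite -natrD ler_nat addnn -ltnS.
  by have := ler0n rat (f i); rewrite ler_norml; lra.
have [mU mt mI] := dm; have [AK _] := andP topA.
have m_int i : i \in A :\: t -> (m (e i) : rat) \is a Num.int.
  rewrite inE => /andP[_ iA]; apply: mI.
    by apply: (subvP (sp_subU sdK AK)); apply: pts_sp.
  apply/(latK topA); first by apply: (subvP (sp_subU sdK AK)); apply: pts_sp.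
  by move=> j jA; rewrite crd_pt ?rpred_nat // (sd_free sdK).
pose f := [ffun i => if i \in A :\: t then
  inord (absz (Num.floor (m (e i) : rat) + n%:Z)) else ord0 : 'I_(n.*2.+1)].
have fE i : i \in A :\: t -> box_fun f i = m (e i).
  move=> iD; rewrite /box_fun ffunE iD.
  have E := floorK (m_int i iD); have := small i iD.
  rewrite -{1 3}E; move: (Num.floor _) => z.
  rewrite -intr_norm -[n%:R]/(n%:Z%:~R) ler_int => le_z.
  rewrite inordK; last by lia.
  by rewrite -[_%:R]/((_%:Z)%:~R) -rmorphB; congr (_%:~R); lia.
apply/mapP; exists f.
  rewrite mem_enum; apply/pfamilyP; split=> //; apply/supportP => i.
  by rewrite ffunE => /negPf ->.
apply/lfunP => v; rewrite (dual_latticeE v topA tA dm) dual_mapE.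
by apply: eq_bigr => i iD; rewrite fE.
Qed.

(** Distributing the product sums over [box]. If the weight of m is nonzero, the values of m and the
    coordinates of w never have opposite signs, so the exponent is m w. A functional of nonzero
    weight outside [box] has m w > n, hence B may be any larger set; this allows one B for all
    cones. *)
Lemma geom_prod_coef w k (B : seq 'Hom(V, rat^o)) : w \in U -> N w ->
  generic walls w -> (k <= n)%N -> uniq B -> {subset box <= B} ->
  (forall m, m \in B -> dual_lattice (sp e t) m) ->
  (\prod_(i in A :\: t) geom n (Num.floor (crd e A i w)))`_k =
  \sum_(m <- B) (m w == k%:R :> rat)%:R *
    \prod_(i in A :\: t) ((0 <= (m (e i) : rat))%R%:R - (crd e A i w < 0)%R%:R) :> rat.
Proof.
move=> wU Nw gw le_kn uB boxB dB.
have w_int i : i \in A -> crd e A i w \is a Num.int by apply: (latK topA wU).1.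
have floorE i : i \in A -> (Num.floor (crd e A i w))%:~R = crd e A i w.
  by move=> iA; apply: floorK; apply: w_int.
have mwE m : dual_lattice (sp e t) m ->
    (m w : rat) = \sum_(i in A :\: t) (m (e i) : rat) * crd e A i w.
  by move=> dm; rewrite (dual_latticeE w topA tA dm) projv_id.
rewrite /geom (big_distr_big ord0) /= coef_sum.
pose eps m i : rat := (0 <= (m (e i) : rat))%R%:R - (crd e A i w < 0)%R%:R.
have eps0 m : dual_lattice (sp e t) m -> \prod_(i in A :\: t) eps m i != 0 ->
    forall i, i \in A :\: t -> `|m (e i) : rat| * `|crd e A i w| = m (e i) * crd e A i w.
  move=> dm /prodf_neq0 ne0 i /ne0; rewrite /eps -normrM.
  case: (leP 0 (m (e i) : rat)) => m0; case: (ltP (crd e A i w) 0) => c0; rewrite ?subrr ?eqxx // => _.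
    by rewrite ger0_norm // mulr_ge0.
  by rewrite ger0_norm // mulr_le0 // ltW.
rewrite -[RHS](@big_rmcond_in _ _ _ _ B (fun m => m \in box)); last first.
  move=> m mB; apply: contraNeq; rewrite mulf_eq0 negb_or => /andP[mw ne0].
  apply/mem_box; split=> [|i iD]; first exact: dB.
  have {}mw : m w = k%:R :> rat by apply/eqP; apply: contraNT mw => /negPf ->.
  apply: le_trans (_ : k%:R <= _); last by rewrite ler_nat.
  rewrite -mw mwE; last exact: dB.
  rewrite (bigD1 i) //=; rewrite -(eps0 m (dB m mB) ne0 i iD).
  apply: le_trans (_ : `|m (e i) : rat| * `|crd e A i w| <= _).
    rewrite ler_peMr //; move: iD; rewrite inE => /andP[_ iA].
    rewrite norm_intr_ge1 ?w_int //; exact: (generic_crd sdK gw wU topA iA).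
  rewrite lerDl; apply: sumr_ge0 => j /andP[jD _].
  by rewrite -(eps0 m (dB m mB) ne0 j jD) mulr_ge0.
have permB : perm_eq [seq m <- B | m \in box] box.
  apply: uniq_perm; rewrite ?filter_uniq ?box_uniq // => m.
  by rewrite mem_filter; case: (boolP (m \in box)) => //= /boxB.
rewrite -big_filter (perm_big _ permB) /= /box big_map big_enum /=.
apply: eq_bigr => f _.
have ptE i : i \in A :\: t -> dual_map A t (box_fun f) (e i) = box_fun f i.
  exact: dual_map_pt.
have dm : dual_lattice (sp e t) (dual_map A t (box_fun f)).
  by apply: dual_map_dual => // i; rewrite rpredB ?rpred_nat.
rewrite scaler_prod -expr_sum coefZ coefXn mulrC.
have -> : \prod_(i in A :\: t) ((n <= f i)%N%:R - (Num.floor (crd e A i w) < 0)%R%:R) =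
   \prod_(i in A :\: t) eps (dual_map A t (box_fun f)) i :> rat.
  by apply: eq_bigr => i iD; rewrite /eps ptE // /box_fun subr_ge0 ler_nat floor_lt0.
have [->|ne0] := eqVneq (\prod_(i in A :\: t) eps (dual_map A t (box_fun f)) i) 0.
  by rewrite !mulr0.
congr (_ * _); congr (nat_of_bool _)%:R.
rewrite eq_sym -(eqr_nat rat) mwE // natr_sum; congr (_ == _).
apply: eq_bigr => i iD; rewrite -(eps0 _ dm ne0 i iD) ptE // natrM mulrC.
have iA : i \in A by move: iD; rewrite inE => /andP[].
by rewrite !natr_absz !intr_norm rmorphB /= floorE.
Qed.

End Box.
(** [pcountE] removes the cones: the right-hand side involves only F, w, k and B, so two
    subdivisions can share it. *)
Lemma geom_sum_coef t w n k (B : seq 'Hom(V, rat^o)) : t \in K ->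
  interior w -> N w -> generic walls w -> (k <= n)%N -> uniq B ->
  (forall A, top A -> t \subset A -> {subset box A t n <= B}) ->
  (forall m, m \in B -> dual_lattice (sp e t) m) ->
  (\sum_(A | top A && (t \subset A))
      \prod_(i in A :\: t) geom n (Num.floor (crd e A i w)))`_k =
  \sum_(m <- B) (m w == k%:R :> rat)%:R *
    `[< forall x, F x -> 0 <= (m x : rat) >]%:R :> rat.
Proof.
move=> tK iw Nw gw le_kn uB boxB dB.
have wU : w \in U by apply: (sd_span sdK); case: iw.
rewrite coef_sum; under eq_bigr => A /andP[topA tA] do
  rewrite (geom_prod_coef topA tA wU Nw gw le_kn uB (boxB A topA tA) dB).
rewrite exchange_big /= !big_seq; apply: eq_bigr => m /dB[_ m0 _].
rewrite -mulr_sumr -(pcountE sdK tK iw gw) // => i it.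
by apply: m0; apply: pts_sp.
Qed.

Definition boxes t n : seq 'Hom(V, rat^o) :=
  flatten [seq box A t n | A : {set T} <- enum {set T} & top A && (t \subset A)].

Lemma boxes_dual t n m : m \in boxes t n -> dual_lattice (sp e t) m.
Proof.
case/flattenP => s /mapP[A]; rewrite mem_filter => /andP[/andP[topA tA] _] ->.
by case/(mem_box n topA tA).
Qed.

Lemma sub_boxes A t n : top A -> t \subset A -> {subset box A t n <= boxes t n}.
Proof.
move=> topA tA m mA; apply/flattenP; exists (box A t n) => //.
by apply: map_f; rewrite mem_filter topA tA mem_enum.
Qed.

End LatticeCount.

(** Each factor is 'X / (1 - exp(- x 'X)) up to 'X^n, where x is the value of a coordinate at w; the
    numerator 'X removes the pole. *)
Definition todd_sum (V : vectType rat) (T : finType) (e : T -> V) (K : {set {set T}})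
    (U : {vspace V}) (t : {set T}) n (w : V) : {poly rat} :=
  \sum_(A : {set T} | top K U A && (t \subset A))
    \prod_(i in A :\: t) ((crd e A i w)^-1 *: todd_poly n (crd e A i w)).

Section Comparison.
Variables (V : vectType rat) (F : V -> Prop) (U : {vspace V}) (N : V -> Prop).
Variables (T1 T2 : finType) (e1 : T1 -> V) (e2 : T2 -> V).
Variables (K1 : {set {set T1}}) (K2 : {set {set T2}}).
Hypotheses (sd1 : subdivided e1 K1 F U) (sd2 : subdivided e2 K2 F U).
Hypotheses (lat1 : unimodular e1 K1 U N) (lat2 : unimodular e2 K2 U N).
Variables (t1 : {set T1}) (t2 : {set T2}).
Hypotheses (t1K : t1 \in K1) (t2K : t2 \in K2) (sp_eq : sp e1 t1 = sp e2 t2).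

Let card_eq : #|t1| = #|t2|.
Proof.
by rewrite -(dim_sp (sd_free sd1 t1K)) -(dim_sp (sd_free sd2 t2K)) sp_eq.
Qed.

(** The points w1 and w2 may differ, since only values of functionals nonnegative on F and zero on
    t1 enter. This freedom later gives the invariance of star sums under translations. *)
Lemma todd_sum_lattice n w1 w2 : interior F U w1 -> interior F U w2 ->
  generic (walls e1 K1 U) w1 -> generic (walls e2 K2 U) w2 -> N w1 -> N w2 ->
  (forall m : 'Hom(V, rat^o), (forall v, v \in sp e1 t1 -> m v = 0) ->
     (forall x, F x -> 0 <= (m x : rat)) -> m w1 = m w2) ->
  eqmod n (todd_sum e1 K1 U t1 n w1) (todd_sum e2 K2 U t2 n w2).
Proof.
move=> iw1 iw2 gw1 gw2 Nw1 Nw2 m_eq.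
have w1U : w1 \in U by apply: (sd_span sd1); case: iw1.
have w2U : w2 \in U by apply: (sd_span sd2); case: iw2.
(* Both complexes enter one sum, the second with negative sign, to which [todd_sum_eq0] applies;
   indices outside P get coefficient 0 and a dummy list of r ones. *)
pose P (j : {set T1} + {set T2}) := match j with
  | inl A => top K1 U A && (t1 \subset A) | inr A => top K2 U A && (t2 \subset A) end.
pose s j : rat := if P j then (if j is inl _ then 1 else -1) else 0.
pose r := (\dim U - #|t1|)%N.
pose E j : seq int := if P j then match j with
  | inl A => [seq Num.floor (crd e1 A i w1) | i <- enum (A :\: t1)]
  | inr A => [seq Num.floor (crd e2 A i w2) | i <- enum (A :\: t2)] end
  else nseq r 1.
have sumE (H : int -> {poly rat}) : \sum_j s j *: \prod_(a <- E j) H a =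
   \sum_(A : {set T1} | top K1 U A && (t1 \subset A))
      \prod_(i in A :\: t1) H (Num.floor (crd e1 A i w1)) -
   \sum_(A : {set T2} | top K2 U A && (t2 \subset A))
      \prod_(i in A :\: t2) H (Num.floor (crd e2 A i w2)).
  rewrite big_sumType /= -sumrN; congr (_ + _); rewrite [RHS]big_mkcond /=;
  apply: eq_bigr => A _; rewrite /s /E /=; case: ifP => _; rewrite ?scale0r //.
    by rewrite scale1r big_map big_enum.
  by rewrite scaleN1r big_map big_enum.
have int1 A i : top K1 U A -> i \in A -> crd e1 A i w1 \is a Num.int.
  by move=> topA; apply: (lat1 topA w1U).1.
have int2 A i : top K2 U A -> i \in A -> crd e2 A i w2 \is a Num.int.
  by move=> topA; apply: (lat2 topA w2U).1.
have sizeE j : size (E j) = r.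
  rewrite /E; case: ifP => [|_]; last by rewrite size_nseq.
  by case: j => A /= /andP[/andP[_ /eqP cA] tA]; rewrite size_map -cardE cardsD
    (setIidPr tA) cA /r ?card_eq.
have E_neq0 j a : a \in E j -> a != 0.
  rewrite /E; case: ifP => [|_]; last by rewrite mem_nseq => /andP[_ /eqP ->].
  case: j => A /= /andP[topA tA] /mapP[i]; rewrite mem_enum inE => /andP[_ iA] ->.
    rewrite -(intr_eq0 rat) floorK ?int1 //; exact: (generic_crd sd1).
  rewrite -(intr_eq0 rat) floorK ?int2 //; exact: (generic_crd sd2).
have geom0 n0 : eqmod n0.+1 (\sum_j s j *: \prod_(a <- E j) geom n0 a) 0.
  move=> k; rewrite ltnS sumE coefB coef0 => le_k; apply/eqP; rewrite subr_eq0.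
  (* One finite set of functionals serves both sides: the spans of t1 and t2 agree, hence so do the
     two dual lattices. *)
  pose B := undup (boxes e1 K1 U t1 n0 ++ boxes e2 K2 U t2 n0).
  have dB m : m \in B -> dual_lattice U N (sp e1 t1) m.
    rewrite mem_undup mem_cat => /orP[/(boxes_dual sd1 lat1)//|].
    by move/(boxes_dual sd2 lat2); rewrite sp_eq.
  rewrite (geom_sum_coef sd1 lat1 t1K iw1 Nw1 gw1 le_k (undup_uniq _ : uniq B)); first last.
  - exact: dB.
  - by move=> A topA tA m /(sub_boxes topA tA) mA; rewrite mem_undup mem_cat mA.
  rewrite (geom_sum_coef sd2 lat2 t2K iw2 Nw2 gw2 le_k (undup_uniq _ : uniq B)); first last.
  - by rewrite -sp_eq; apply: dB.
  - by move=> A topA tA m /(sub_boxes topA tA) mA; rewrite mem_undup mem_cat mA orbT.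
  apply/eqP; rewrite !big_seq; apply: eq_bigr => m /dB[_ m0 _].
  by case: asboolP => [pos|_]; rewrite ?mulr0 // m_eq.
have := todd_sum_eq0 sizeE E_neq0 geom0 (n := n); rewrite sumE => H i lti.
have := H i lti; rewrite coef0 coefB => /eqP; rewrite subr_eq0 => /eqP.
have -> : \sum_(A : {set T1} | top K1 U A && (t1 \subset A)) \prod_(j in A :\: t1)
    (((Num.floor (crd e1 A j w1))%:~R)^-1 *: todd_poly n (Num.floor (crd e1 A j w1))%:~R)
    = todd_sum e1 K1 U t1 n w1.
  apply: eq_bigr => A /andP[topA tA]; apply: eq_bigr => j.
  by rewrite inE => /andP[_ jA]; rewrite floorK //; apply: int1.
have -> // : \sum_(A : {set T2} | top K2 U A && (t2 \subset A)) \prod_(j in A :\: t2)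
    (((Num.floor (crd e2 A j w2))%:~R)^-1 *: todd_poly n (Num.floor (crd e2 A j w2))%:~R)
    = todd_sum e2 K2 U t2 n w2.
apply: eq_bigr => A /andP[topA tA]; apply: eq_bigr => j.
by rewrite inE => /andP[_ jA]; rewrite floorK //; apply: int2.
Qed.

End Comparison.

(** * Rational sequences tending to 0 *)

Section Vanishing.
Implicit Types f g : nat -> rat.

Definition vanishing f := forall eps : rat, 0 < eps ->
  exists s0, forall s, (s0 <= s)%N -> `|f s| <= eps.

Definition bounded f := exists C : rat,
  exists s0, forall s, (s0 <= s)%N -> `|f s| <= C.

Lemma vanishing_bounded f : vanishing f -> bounded f.
Proof. by move=> /(_ 1 ltr01) fS; exists 1. Qed.

Lemma boundedM f g : bounded f -> bounded g -> bounded (fun s => f s * g s).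
Proof.
move=> [C [s0 fC]] [D [s1 gD]]; exists (C * D), (maxn s0 s1) => s.
by rewrite geq_max => /andP[/fC ? /gD ?]; rewrite normrM ler_pM.
Qed.

Lemma vanishingM f g : vanishing f -> bounded g -> vanishing (fun s => f s * g s).
Proof.
move=> fS [D [s1 gD]] eps eps0.
have D0 : 0 <= D by apply: le_trans (gD _ (leqnn s1)).
have [s0 fe] := fS (eps / (D + 1)) ltac:(by rewrite divr_gt0 //; lra).
exists (maxn s0 s1) => s; rewrite geq_max => /andP[/fe fs /gD gs].
rewrite normrM; apply: le_trans (_ : eps / (D + 1) * D <= _); first exact: ler_pM.
rewrite mulrAC ler_pdivrMr; last lra.
by rewrite ler_pM2l //; lra.
Qed.

Lemma vanishingD f g : vanishing f -> vanishing g -> vanishing (fun s => f s + g s).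
Proof.
move=> fS gS eps eps0; have eps20 : 0 < eps / 2 by lra.
have [s0 fe] := fS _ eps20; have [s1 ge] := gS _ eps20.
exists (maxn s0 s1) => s; rewrite geq_max => /andP[/fe fs /ge gs].
by apply: le_trans (ler_normD _ _) _; lra.
Qed.

Lemma vanishing_const c f s0 : (forall s, (s0 <= s)%N -> f s = c) -> vanishing f -> c = 0.
Proof.
move=> fc fS; apply/eqP; rewrite -normr_eq0 eq_le normr_ge0 andbT.
apply/ler_addgt0Pl => eps eps0; rewrite addr0.
have [s1 fe] := fS _ eps0; rewrite -(fc _ (leq_maxl s0 s1)).
by apply: fe; rewrite leq_maxr.
Qed.

Lemma vanishing_inv (a b : rat) : b != 0 -> vanishing (fun s => (a + b *+ s)^-1).
Proof.
move=> b0 eps eps0.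
have [s0 Hs] := @archi_nat (- `|a| - eps^-1) `|b| ltac:(by rewrite normr_gt0).
exists s0 => s /Hs; rewrite -normrMn => lt0.
have le1 : `|b *+ s| - `|a| <= `|a + b *+ s|.
  by rewrite lerBlDl -{1}(addKr a (b *+ s)) (le_trans (ler_normD _ _)) // normrN.
have lt1 : eps^-1 <= `|a + b *+ s| by lra.
rewrite normfV -[leRHS]invrK lef_pV2 // posrE ?invr_gt0 //.
by apply: lt_le_trans lt1; rewrite invr_gt0.
Qed.

Lemma bounded_inv (a b : rat) : bounded (fun s => (a + b *+ s)^-1).
Proof.
have [->|b0] := eqVneq b 0; last exact/vanishing_bounded/vanishing_inv.
by exists `|a^-1|, 0%N => s _; rewrite mul0rn addr0.
Qed.

End Vanishing.

Lemma coef_comp_scale (p : {poly rat}) c i : (p \Po (c *: 'X))`_i = c ^+ i * p`_i.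
Proof.
rewrite comp_polyE coef_sum.
have [ltip|lepi] := ltnP i (size p); last first.
  rewrite (nth_default _ lepi) mulr0 big1 // => j _.
  rewrite exprZn !coefZ coefXn eq_sym ltn_eqF ?mulr0 //.
  exact: leq_trans lepi.
rewrite (bigD1 (Ordinal ltip)) //= big1 => [|j /eqP ne_j].
  by rewrite exprZn !coefZ coefXn eqxx mulr1 addr0 mulrC.
rewrite exprZn !coefZ coefXn; case: eqP => [ij|_]; last by rewrite !mulr0.
by case: ne_j; apply/val_inj.
Qed.

(** * Star sums *)

Section StarSums.
Variables (V : vectType rat) (F : V -> Prop) (U : {vspace V}) (N : V -> Prop).
Hypothesis N_scale : forall w, exists2 c, (0 < c)%N & forall k, N (w *+ (c * k)).

Lemma todd_sum_scale (T : finType) (e : T -> V) (K : {set {set T}}) t n w c i :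
  c != 0 -> (todd_sum e K U t n (c *: w))`_i =
  c^-1 ^+ (\dim U - #|t|) * c ^+ i * (todd_sum e K U t n w)`_i.
Proof.
move=> c0; have toddE x : todd_poly n (c * x) = todd_poly n x \Po (c *: 'X).
  apply/polyP => j; rewrite coef_comp_scale !coef_poly; case: ifP => _; rewrite ?mulr0 //.
  by rewrite exprMn; ring.
rewrite -mulrA -coef_comp_scale -coefZ; congr ((polyseq _)`_i).
rewrite /todd_sum raddf_sum /= scaler_sumr; apply: eq_bigr => A /andP[/andP[_ /eqP cA] tA].
have -> : (\dim U - #|t| = #|A :\: t|)%N by rewrite cardsD (setIidPr tA) cA.
rewrite rmorph_prod /= -prodr_const -scaler_prod; apply: eq_bigr => j _.
by rewrite linearZ /= toddE comp_polyZ scalerA -invfM.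
Qed.

Section Comparison.
Variables (T1 T2 : finType) (e1 : T1 -> V) (e2 : T2 -> V).
Variables (K1 : {set {set T1}}) (K2 : {set {set T2}}).
Hypotheses (sd1 : subdivided e1 K1 F U) (sd2 : subdivided e2 K2 F U).
Hypotheses (lat1 : unimodular e1 K1 U N) (lat2 : unimodular e2 K2 U N).
Variables (t1 : {set T1}) (t2 : {set T2}).
Hypotheses (t1K : t1 \in K1) (t2K : t2 \in K2) (sp_eq : sp e1 t1 = sp e2 t2).

(** A common denominator c moves w1 and w2 into the lattice; by homogeneity ([todd_sum_scale]) this
    multiplies the coefficients on both sides by the same nonzero number. *)
Lemma todd_sum_eq n w1 w2 : interior F U w1 -> interior F U w2 ->
  generic (walls e1 K1 U) w1 -> generic (walls e2 K2 U) w2 ->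
  (forall m : 'Hom(V, rat^o), (forall v, v \in sp e1 t1 -> m v = 0) ->
     (forall x, F x -> 0 <= (m x : rat)) -> m w1 = m w2) ->
  eqmod n (todd_sum e1 K1 U t1 n w1) (todd_sum e2 K2 U t2 n w2).
Proof.
move=> iw1 iw2 gw1 gw2 m_eq i lti.
have [c1 c1_gt0 N1] := N_scale w1; have [c2 c2_gt0 N2] := N_scale w2.
pose c : rat := (c1 * c2)%:R.
have c_gt0 : 0 < c by rewrite ltr0n muln_gt0 c1_gt0.
have c_neq0 : c != 0 by rewrite gt_eqF.
have : (todd_sum e1 K1 U t1 n (c *: w1))`_i = (todd_sum e2 K2 U t2 n (c *: w2))`_i.
  apply: (todd_sum_lattice sd1 sd2 lat1 lat2 t1K t2K sp_eq) lti.
  - exact: (interiorZ sd1).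
  - exact: (interiorZ sd1).
  - by rewrite genericZ.
  - by rewrite genericZ.
  - by rewrite scaler_nat.
  - by rewrite scaler_nat mulnC.
  - by move=> m m0 mp; rewrite !linearZ /= (m_eq m).
rewrite !todd_sum_scale // -(dim_sp (sd_free sd1 t1K)) -(dim_sp (sd_free sd2 t2K)) sp_eq.
by apply: mulfI; rewrite mulf_neq0 // expf_neq0 // invr_eq0.
Qed.

End Comparison.

Definition star_sum (T : finType) (e : T -> V) (K : {set {set T}}) (t : {set T}) w : rat :=
  \sum_(A : {set T} | top K U A && (t \subset A)) \prod_(i in A :\: t) (crd e A i w)^-1.

(** The Todd series has constant term 1, so star sums are the lowest-order part of Todd sums and
    inherit their invariance. *)
Lemma star_sumE (T : finType) (e : T -> V) (K : {set {set T}}) t w :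
  star_sum e K t w = (todd_sum e K U t 1 w)`_0.
Proof.
rewrite coef_sum; apply: eq_bigr => A _.
have -> : \prod_(i in A :\: t) ((crd e A i w)^-1 *: todd_poly 1 (crd e A i w)) =
    (\prod_(i in A :\: t) (crd e A i w)^-1)%:P.
  rewrite rmorph_prod /=; apply: eq_bigr => i _; apply/polyP => j.
  rewrite coefZ coefC coef_poly; case: j => [|j] /=; last by rewrite mulr0.
  by rewrite expr0 mulr1 /todd_coef /= mulr1.
by rewrite coefC.
Qed.

Lemma star_sum_eq (T1 T2 : finType) (e1 : T1 -> V) (e2 : T2 -> V) K1 K2 t1 t2 w :
  subdivided e1 K1 F U -> subdivided e2 K2 F U ->
  unimodular e1 K1 U N -> unimodular e2 K2 U N ->
  t1 \in K1 -> t2 \in K2 -> sp e1 t1 = sp e2 t2 -> interior F U w ->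
  generic (walls e1 K1 U) w -> generic (walls e2 K2 U) w ->
  star_sum e1 K1 t1 w = star_sum e2 K2 t2 w.
Proof.
move=> sd1 sd2 lat1 lat2 t1K t2K sp_eq iw gw1 gw2; rewrite !star_sumE.
exact: (todd_sum_eq sd1 sd2 lat1 lat2 t1K t2K sp_eq).
Qed.

(* Translation of [w] along [l] does not change the sum, but the summands tend to 0. *)
Lemma star_sum_eq0 (T : finType) (e : T -> V) K t w l :
  subdivided e K F U -> unimodular e K U N -> t \in K -> interior F U w ->
  generic (walls e K U) w -> F l -> l \notin sp e t ->
  (forall m : 'Hom(V, rat^o), (forall v, v \in sp e t -> m v = 0) ->
     (forall x, F x -> 0 <= (m x : rat)) -> m l = 0) ->
  star_sum e K t w = 0.
Proof.
move=> sdK latK tK iw gw Fl lt ml.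
have [s0 Hs0] := generic_near l gw.
apply: (@vanishing_const _ (fun s => star_sum e K t (w + l *+ s)) s0).
  move=> s /Hs0 gs; rewrite !star_sumE.
  apply: (todd_sum_eq sdK sdK latK latK tK tK) => //.
    exact: (interior_near sdK).
  by move=> m m0 mp; rewrite linearD linearMn /= (ml m) // mul0rn addr0.
have van_sum (I : Type) (r : seq I) (P : pred I) (f : I -> nat -> rat) :
    (forall i, P i -> vanishing (f i)) -> vanishing (fun s => \sum_(i <- r | P i) f i s).
  move=> van_f; elim: r => [|i r IHr].
    by move=> eps eps0; exists 0%N => s _; rewrite big_nil normr0 ltW.
  case Pi : (P i).
    by move=> eps /(vanishingD (van_f i Pi) IHr)[s1 H]; exists s1 => s /H; rewrite big_cons Pi.
  by move=> eps /IHr[s1 H]; exists s1 => s /H; rewrite big_cons Pi.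
apply: van_sum => A /andP[topA tA].
have lA : l \in sp e A by rewrite (sp_top sdK topA); apply: (sd_span sdK).
(* Since l is outside the span of t, it has a nonzero coordinate at some i outside t; that factor
   tends to 0 and the others stay bounded. *)
have [i iD ci] : exists2 i, i \in A :\: t & crd e A i l != 0.
  apply/exists_inP; apply: contraNT lt => /exists_inPn c0.
  rewrite (crd_sum lA) (big_setID t) /= (setIidPr tA) [X in _ + X]big1 ?addr0 ?sum_sp //.
  by move=> i /c0 /negPn/eqP ->; rewrite scale0r.
have bnd (r : seq T) (P : pred T) :
    bounded (fun s => \prod_(j <- r | P j) (crd e A j (w + l *+ s))^-1).
  elim: r => [|j r [C [s1 H]]].
    by exists 1, 0%N => s _; rewrite big_nil normr1.
  case Pj : (P j); last by exists C, s1 => s /H; rewrite big_cons Pj.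
  have [|D [s2 H']] := boundedM (bounded_inv (crd e A j w) (crd e A j l)) (g := fun s =>
     \prod_(j <- r | P j) (crd e A j (w + l *+ s))^-1); first by exists C, s1.
  by exists D, s2 => s /H'; rewrite big_cons Pj linearD linearMn.
move=> eps /(vanishingM (vanishing_inv (crd e A i w) ci) 
  (bnd (index_enum T) (fun j => (j \in A :\: t) && (j != i))))[s1 H].
by exists s1 => s /H Hs; rewrite (bigD1 i) //= [crd e A i _]linearD linearMn.
Qed.

End StarSums.

(** * Polyhedral cones and nonsingular fans *)

Section Farkas.
Variable V : vectType rat.
Implicit Types (s : seq V) (u v w x : V).

Lemma exists_hom (f : V -> rat) : scalar f -> exists h : 'Hom(V, rat^o), forall v, h v = f v.
Proof.
move=> lin; pose g := HB.pack_for {linear V -> rat^o} (f : V -> rat^o)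
  (GRing.isLinear.Build rat V rat^o _ (f : V -> rat^o) lin).
by exists (linfun g) => v; apply: (lfunE g).
Qed.

Lemma separating v : v != 0 -> exists h : 'Hom(V, rat^o), h v != 0.
Proof.
move=> v0; apply: contrapT => no; case/eqP: v0.
rewrite (coord_vbasis (memvf v)) big1 // => i _.
have [h hE] := @exists_hom (coord (vbasis fullv) i) (coord_is_scalar _ _).
apply/eqP; rewrite scaler_eq0; apply/orP; left; apply/negPn/negP => ci.
by apply: no; exists h; rewrite hE.
Qed.

Lemma cone_gen_nil v : cone_gen [::] v <-> v = 0.
Proof.
split=> [[c [_ ->]]|->]; first by rewrite big_ord0.
by exists (fun=> 0); rewrite big_ord0.
Qed.

Lemma cone_gen_cons a s v : cone_gen (a :: s) v <->
  exists k x, [/\ 0 <= k, cone_gen s x & v = k *: a + x].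
Proof.
split=> [[c [c0 ->]]|[k [x [k0 [c [c0 ->]] ->]]]].
  exists (c ord0), (\sum_(i < size s) c (lift ord0 i) *: s`_i).
  split=> //; last by rewrite big_ord_recl.
  by exists (fun i => c (lift ord0 i)).
exists (fun i => oapp c k (unlift ord0 i)); split=> [i|].
  by case: unliftP => [j|] _ /=.
rewrite big_ord_recl unlift_none; congr (_ + _).
by apply: eq_bigr => i _; rewrite liftK.
Qed.

Lemma cone_gen0 s : cone_gen s 0.
Proof. by exists (fun=> 0); split=> // ; rewrite big1 // => i _; rewrite scale0r. Qed.

Lemma cone_genD s v w : cone_gen s v -> cone_gen s w -> cone_gen s (v + w).
Proof.
move=> [c [c0 ->]] [d [d0 ->]]; exists (fun i => c i + d i); split=> [i|].
  exact: addr_ge0.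
by rewrite -big_split; apply: eq_bigr => i _; rewrite scalerDl.
Qed.

Lemma cone_genZ s (k : rat) v : 0 <= k -> cone_gen s v -> cone_gen s (k *: v).
Proof.
move=> k0 [c [c0 ->]]; exists (fun i => k * c i); split=> [i|]; first exact: mulr_ge0.
by rewrite scaler_sumr; apply: eq_bigr => i _; rewrite scalerA.
Qed.

Lemma cone_gen_mem s v : v \in s -> cone_gen s v.
Proof.
elim: s => // a s IHs; rewrite inE => /orP[/eqP->|/IHs sv]; apply/cone_gen_cons.
  by exists 1, 0; rewrite ler01 scale1r addr0; split=> //; apply: cone_gen0.
by exists 0, v; rewrite lexx scale0r add0r.
Qed.

Lemma cone_gen_ind s (P : V -> Prop) : P 0 ->
  (forall v w, P v -> P w -> P (v + w)) ->
  (forall (k : rat) v, 0 <= k -> P v -> P (k *: v)) ->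
  (forall v, v \in s -> P v) -> forall v, cone_gen s v -> P v.
Proof.
move=> P0 PD PZ Ps v [c [c0 ->]]; elim/big_ind: _ => // i _.
by apply: PZ => //; apply/Ps/mem_nth.
Qed.

Lemma cone_gen_sub s s' : (forall v, v \in s -> cone_gen s' v) ->
  forall v, cone_gen s v -> cone_gen s' v.
Proof.
move=> ss'; apply: cone_gen_ind => //; first exact: cone_gen0.
  exact: cone_genD.
exact: cone_genZ.
Qed.

(* Bartl's induction: if the new generator [a] is needed, some [u0] with
   [u0 a = -1] is nonnegative on the others, and projecting along [a] onto
   [ker u0] removes [a]. *)
Lemma farkas s b :
  (forall u : 'Hom(V, rat^o), (forall v, v \in s -> 0 <= (u v : rat)) -> 0 <= (u b : rat)) ->
  cone_gen s b.
Proof.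
have [n] := ubnP (size s); elim: n s b => // n IHn [|a s] b /=.
  move=> _ H; apply/cone_gen_nil/eqP/negPn/negP => /separating[h].
  have := H h (fun _ => ltac:(by [])); have := H (- h) (fun _ => ltac:(by [])).
  by rewrite opp_lfunE oppr_ge0 => h1 h2; rewrite eq_le h1 h2.
rewrite ltnS => lt_sn H.
have [Hs|/existsNP[u0 /not_implyP[u0s /negP]]] := pselect (forall u : 'Hom(V, rat^o),
    (forall v, v \in s -> 0 <= (u v : rat)) -> 0 <= (u b : rat)).
  by apply/cone_gen_cons; exists 0, b; rewrite lexx scale0r add0r; split=> //; apply: IHn.
rewrite -ltNge => u0b.
have u0a : (u0 a : rat) < 0.
  rewrite ltNge; apply/negP => u0a; move: u0b; rewrite ltNge H // => v.
  by rewrite inE => /orP[/eqP->|/u0s].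
pose u1 : 'Hom(V, rat^o) := (- (u0 a : rat))^-1 *: u0.
have u1E x : u1 x = (- (u0 a : rat))^-1 * u0 x by rewrite scale_lfunE.
have pos : 0 < (- (u0 a : rat))^-1 by rewrite invr_gt0 oppr_gt0.
have u1a : (u1 a : rat) = -1 by rewrite u1E invrN mulNr mulVf ?lt_eqF.
pose pr x := x + (u1 x : rat) *: a.
have prP : cone_gen (map pr s) (pr b).
  apply: IHn; first by rewrite size_map.
  move=> u us; pose u' := u + (u a : rat) *: u1.
  have u'E x : (u' x : rat) = u (pr x).
    by rewrite add_lfunE scale_lfunE linearD linearZ /= [_ *: _]mulrC.
  rewrite -u'E; apply: H => v; rewrite inE => /orP[/eqP->|vs].
    by rewrite u'E /pr u1a scaleN1r subrr linear0.
  by rewrite u'E us // map_f.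
have [x sx prx] : exists2 x, cone_gen s x & pr b = pr x.
  apply: (cone_gen_ind (P := fun y => exists2 x, cone_gen s x & y = pr x)) prP.
  - by exists 0; [apply: cone_gen0|rewrite /pr linear0 scale0r addr0].
  - move=> _ _ [x sx ->] [y sy ->]; exists (x + y); first exact: cone_genD.
    by rewrite /pr linearD scalerDl addrACA.
  - move=> k _ k0 [x sx ->]; exists (k *: x); first exact: cone_genZ.
    by rewrite /pr linearZ scalerDr scalerA.
  by move=> _ /mapP[x xs ->]; exists x => //; apply: cone_gen_mem.
have u1x : 0 <= (u1 x : rat).
  apply: (cone_gen_ind (P := fun x => 0 <= (u1 x : rat))) sx.
  - by rewrite linear0.
  - by move=> v w v0 w0; rewrite linearD addr_ge0.
  - by move=> k v k0 v0; rewrite linearZ mulr_ge0.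
  by move=> v vs; rewrite u1E mulr_ge0 ?u0s // ltW.
apply/cone_gen_cons; exists (u1 x - (u1 b : rat)), x; split=> //.
  by rewrite subr_ge0 (le_trans _ u1x) // u1E pmulr_rle0 // ltW.
by rewrite -[LHS](addrK ((u1 b : rat) *: a)) -/(pr b) prx /pr scalerBl -addrA addrC.
Qed.

Lemma hom_ge0_cone s (u : 'Hom(V, rat^o)) : (forall v, v \in s -> 0 <= (u v : rat)) ->
  forall x, cone_gen s x -> 0 <= (u x : rat).
Proof.
move=> us; apply: cone_gen_ind => //.
- by rewrite linear0.
- by move=> v w v0 w0; rewrite linearD addr_ge0.
- by move=> k v k0 v0; rewrite linearZ mulr_ge0.
Qed.

Definition irredundant s := forall v, v \in s -> ~ cone_gen (rem v s) v.

Lemma cone_gen_rem s v x : v \in s -> cone_gen s x <->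
  exists k y, [/\ 0 <= k, cone_gen (rem v s) y & x = k *: v + y].
Proof.
move=> vs; rewrite -cone_gen_cons; have /perm_mem E := perm_to_rem vs.
by split; apply: cone_gen_sub => y; [rewrite E|rewrite -E]; apply: cone_gen_mem.
Qed.

Lemma exists_irredundant s :
  exists2 s1, irredundant s1 & forall x, cone_gen s x <-> cone_gen s1 x.
Proof.
have [n] := ubnP (size s); elim: n s => // n IHn s /ltnSE-le_sn.
have [|/existsNP[v /not_implyP[vs /contrapT vr]]] := pselect (irredundant s).
  by exists s.
have [|s1 irr1 E1] := IHn (rem v s).
  by rewrite (leq_trans _ le_sn) // (perm_size (perm_to_rem vs)).
exists s1 => // x; rewrite -E1; split.
  case/(cone_gen_rem x vs)=> k [y [k0 ry ->]].
  by apply: cone_genD => //; apply: cone_genZ.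
by apply: cone_gen_sub => y /mem_rem /cone_gen_mem.
Qed.

(** For every other generator v', [farkas] gives a functional nonnegative on s, zero at v and
    positive at v': otherwise - v' would lie in the cone of - v and s, which makes v redundant or
    puts - v' into the pointed cone. The sum of these functionals cuts out the ray of v. *)
Lemma irredundant_ray s v : irredundant s ->
  (forall x, cone_gen s x -> cone_gen s (- x) -> x = 0) -> v \in s ->
  exists u : 'Hom(V, rat^o), (forall x, cone_gen s x -> 0 <= (u x : rat)) /\
    forall x, cone_gen s x /\ u x = 0 <-> exists2 k, 0 <= k & x = k *: v.
Proof.
move=> irr pointed vs.
have sub x : cone_gen (rem v s) x -> cone_gen s x.
  by apply: cone_gen_sub => y /mem_rem /cone_gen_mem.
have uP v' : v' \in rem v s -> exists u : 'Hom(V, rat^o),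
    [/\ forall x, x \in s -> 0 <= (u x : rat), u v = 0 & 0 < (u v' : rat)].
  move=> v's; apply: contrapT => no.
  have v'0 : v' <> 0.
    move=> v'0; apply: (irr v' (mem_rem v's)); rewrite v'0; exact: cone_gen0.
  have : cone_gen (- v :: s) (- v').
    apply: farkas => u us; rewrite linearN oppr_ge0 leNgt; apply/negP => uv'.
    apply: no; exists u; split=> // [x xs|]; first by rewrite us // inE xs orbT.
    apply/eqP; rewrite eq_le (us v) ?inE ?vs ?orbT // andbT.
    by have := us _ (mem_head _ _); rewrite linearN oppr_ge0.
  case/cone_gen_cons=> k [x [k0 /(cone_gen_rem x vs)[c [y [c0 ry ->]]] E]].
  have E' : (k - c) *: v = v' + y.
    by rewrite -(opprK v') E scalerN opprD opprK scalerBl opprD addrA addrNK.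
  have [lt_ck|le_kc] := ltP c k.
    have vE : v = (k - c)^-1 *: (v' + y).
      by rewrite -E' scalerA mulVf ?scale1r // gt_eqF // subr_gt0.
    apply: (irr v vs); rewrite [X in cone_gen _ X]vE.
    apply: cone_genZ; first by rewrite invr_ge0 subr_ge0 ltW.
    by apply: cone_genD => //; apply: cone_gen_mem.
  apply: v'0; apply: pointed; first by apply/sub/cone_gen_mem.
  have -> : - v' = (c - k) *: v + y.
    by rewrite -[c - k]opprB scaleNr E' opprD addrNK.
  by apply: cone_genD; [apply: cone_genZ; rewrite ?subr_ge0 //; apply: cone_gen_mem|apply: sub].
have [u [us uv uv']] : exists u : 'Hom(V, rat^o),
    [/\ forall x, x \in s -> 0 <= (u x : rat), u v = 0 &
        forall v', v' \in rem v s -> 0 < (u v' : rat)].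
  have : {subset rem v s <= s} by move=> w /mem_rem.
  elim: (rem v s) uP => [|v' r IHr] uP rs.
    by exists 0; split=> // [x _|]; rewrite zero_lfunE.
  have [||u [us uv ur]] := IHr.
  - by move=> w wr; apply: uP; rewrite inE wr orbT.
  - by move=> w wr; apply: rs; rewrite inE wr orbT.
  have [u' [u's u'v u'v']] := uP v' (mem_head _ _).
  exists (u + u'); split=> [x xs||w].
  - by rewrite add_lfunE addr_ge0 ?us ?u's.
  - by rewrite add_lfunE uv u'v addr0.
  rewrite inE add_lfunE => /orP[/eqP->|wr].
    by rewrite ltr_wpDl // us // rs ?mem_head.
  by rewrite ltr_pwDl ?ur // u's // rs // inE wr orbT.
have ucone := hom_ge0_cone us; exists u; split=> // x; split=> [[sx ux]|[k k0 ->]].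
  have [k [y [k0 ry xE]]] := (cone_gen_rem x vs).1 sx.
  exists k => //; suff y0 : y = 0 by rewrite xE y0 addr0.
  have uy : u y = 0 by move: ux; rewrite xE linearD linearZ /= uv scaler0 add0r.
  elim: (rem v s) uv' y ry uy {xE} => [|a r IHr] ur y; first by move/cone_gen_nil.
  case/cone_gen_cons=> l [z [l0 rz ->]].
  have ua : 0 < (u a : rat) by apply: ur; rewrite mem_head.
  have {}ur w : w \in r -> 0 < (u w : rat) by move=> wr; apply: ur; rewrite inE wr orbT.
  have uz : 0 <= (u z : rat) by apply: hom_ge0_cone rz => w /ur/ltW.
  rewrite linearD linearZ => /eqP; rewrite paddr_eq0 ?mulr_ge0 // 1?ltW //.
  rewrite mulf_eq0 (gt_eqF ua) orbF => /andP[/eqP-> /eqP uz0].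
  by rewrite scale0r add0r; apply: IHr.
by split; [apply: cone_genZ => //; apply: cone_gen_mem|rewrite linearZ /= uv scaler0].
Qed.
End Farkas.

Section SeqCones.
Variable V : vectType rat.
Implicit Types (s : seq V) (v w x : V).

Lemma zspanP s v : uniq s ->
  zspan s v <-> exists z : V -> int, v = \sum_(x <- s) x *~ z x.
Proof.
move=> us; split=> [[z ->]|[z ->]].
  exists (fun x => oapp z 0 (insub (index x s))).
  rewrite (big_nth 0) big_mkord; apply: eq_bigr => i _.
  by rewrite index_uniq // valK.
by exists (fun i => z s`_i); rewrite (big_nth 0) big_mkord.
Qed.

Lemma cone_genP s v : uniq s ->
  cone_gen s v <-> exists2 c : V -> rat, (forall x, 0 <= c x) & v = \sum_(x <- s) c x *: x.
Proof.
move=> us; split=> [[c [c0 ->]]|[c c0 ->]].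
  exists (fun x => oapp c 0 (insub (index x s))).
    by move=> x; case: insub => /=.
  rewrite (big_nth 0) big_mkord; apply: eq_bigr => i _.
  by rewrite index_uniq // valK.
by exists (fun i => c s`_i); split=> //; rewrite (big_nth 0) big_mkord.
Qed.

Lemma common_denominator (I : finType) (q : I -> rat) :
  exists2 c : nat, (0 < c)%N & forall i, q i * c%:R \is a Num.int.
Proof.
exists (\prod_i absz (denq (q i)))%N; first by apply: prodn_gt0 => i; rewrite absz_gt0 denq_neq0.
move=> i; rewrite (bigD1 i) //= natrM mulrA rpredM ?rpred_nat //.
by rewrite natr_absz gtr0_norm ?denq_gt0 // -numqE intr_int.
Qed.

Lemma lattice_scale (N : set V) w : is_lattice N ->
  exists2 c, (0 < c)%N & forall k, N (w *+ (c * k)).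
Proof.
move=> [s [[free_s ->] /andP[/eqP full _]]].
have ws : w \in <<in_tuple s>>%VS by rewrite full memvf.
have [c c0 cint] := common_denominator (fun i => coord (in_tuple s) i w).
exists c => // k; exists (fun i => Num.floor (coord (in_tuple s) i w * (c * k)%:R)).
rewrite {1}(coord_span ws) -sumrMnl; apply: eq_bigr => i _.
have qint : coord (in_tuple s) i w * (c * k)%:R \is a Num.int.
  by rewrite natrM mulrA rpredM ?cint ?rpred_nat.
by rewrite -scaler_int floorK // -scaler_nat scalerA mulrC.
Qed.

Lemma first_point0 (N rho : set V) v : first_point N 0 rho v <->
  [/\ N v, rho v & v != 0] /\
  forall w, N w -> rho w -> w != 0 -> exists2 c : rat, 1 <= c & w = c *: v.
Proof.
have LE w : (N `&` [set x + u | x in rho & u in [set` (0 : {vspace V})%VS]]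
      `\` [set` (0 : {vspace V})%VS])%classic w <-> [/\ N w, rho w & w != 0].
  split=> [[[Nw [x rx [u /= u0 xuE]]] /= /negP w0]|[Nw rw w0]].
    move: u0 rx xuE w0; rewrite !memv0 => /eqP ->; rewrite addr0 => rx xw w0.
    by subst x; split.
  split; last by apply/negP; rewrite /= memv0.
  by split=> //; exists w => //; exists 0; [exact: mem0v|rewrite addr0].
split=> [[/LE Lv H]|[Lv H]].
  split=> // w Nw rw w0; have [|c c1] := H w; first exact/LE.
  by rewrite memv0 subr_eq0 => /eqP; exists c.
split; first exact/LE.
move=> w /LE[Nw rw w0]; have [c c1 ->] := H w Nw rw w0.
by exists c => //; rewrite subrr mem0v.
Qed.

Lemma first_point_uniq (N rho : set V) v w :
  first_point N 0 rho v -> first_point N 0 rho w -> v = w.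
Proof.
move=> /first_point0[[Nv rv v0] Hv] /first_point0[[Nw rw w0] Hw].
have [c c1 wE] := Hv w Nw rw w0; have [d d1 vE] := Hw v Nv rv v0.
have dc : d * c = 1.
  apply/eqP; rewrite -subr_eq0; have := vE; rewrite wE scalerA => /eqP.
  by rewrite -subr_eq0 -{1}(scale1r v) -scalerBl scaler_eq0 (negPf v0) orbF -oppr_eq0 opprB.
have c_1 : c = 1 by nra.
by rewrite wE c_1 scale1r.
Qed.

(** Let a be the absolute value of a nonzero coordinate of v in a lattice basis. Then k * a is an
    integer for each lattice point k v, so the lattice points of the ray are discrete and a least
    nonzero one exists. *)
Lemma exists_first_point (N : set V) v : is_lattice N -> v != 0 ->
  exists2 t : rat, 0 < t &
    first_point N 0 [set x | exists2 k : rat, 0 <= k & x = k *: v]%classic (t *: v).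
Proof.
move=> latN v0; have [s [[free_s NE] /andP[/eqP full _]]] := latN.
have vs : v \in <<in_tuple s>>%VS by rewrite full memvf.
have [i ci] : exists i, coord (in_tuple s) i v != 0.
  apply/existsP; apply: contraNT v0; rewrite negb_exists => /forallP c0.
  by rewrite (coord_span vs) big1 // => i _; have /negPn/eqP-> := c0 i; rewrite scale0r.
set a : rat := `|coord (in_tuple s) i v|.
have a0 : 0 < a by rewrite normr_gt0.
have N_int k : N (k *: v) -> k * a \is a Num.int.
  rewrite NE => -[z zE]; have := congr1 (coord (in_tuple s) i) zE.
  rewrite linearZ /= => E; have : k * coord (in_tuple s) i v \is a Num.int.
    rewrite E; under eq_bigr => j _ do rewrite -scaler_int.
    by rewrite (coord_sum_free (X := in_tuple s)) // intr_int.
  rewrite /a; case: ger0P => _ //; by rewrite mulrN rpredN.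
pose P (j : nat) := (0 < j)%N && `[< N ((j%:R / a) *: v) >].
have exP : exists j, P j.
  have [c c0 Nc] := lattice_scale (a^-1 *: v) latN.
  exists c; rewrite /P c0; apply/asboolP; have := Nc 1%N.
  by rewrite muln1 -scaler_nat scalerA.
case: (ex_minnP exP) => j /andP[j0 /asboolP Nj] jmin.
have t0 : 0 < j%:R / a by rewrite divr_gt0 // ltr0n.
exists (j%:R / a) => //; apply/first_point0; split.
  split=> //=; last by rewrite scaler_eq0 gt_eqF.
  by exists (j%:R / a) => //; apply: ltW.
move=> w Nw /= [k k0 wE] w0.
have k_gt0 : 0 < k.
  by rewrite lt_neqAle k0 andbT eq_sym; apply: contraNneq w0 => k_0; rewrite wE k_0 scale0r.
have /intrP[z zE] : k * a \is a Num.int by apply: N_int; rewrite -wE.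
have z0 : 0 < z by rewrite -(ltr_int rat) -zE mulr_gt0.
have zE' : k * a = (absz z)%:R by rewrite zE natr_absz gtr0_norm.
have le_jz : (j <= absz z)%N.
  apply: jmin; rewrite /P absz_gt0 gt_eqF //=; apply/asboolP.
  by rewrite -zE' mulfK ?gt_eqF // -wE.
exists (k / (j%:R / a)); last by rewrite scalerA divfK // gt_eqF.
rewrite ler_pdivlMr // mul1r ler_pdivrMr // zE'.
by rewrite ler_nat.
Qed.

End SeqCones.

Section FreeCones.
Variables (V : vectType rat) (T : finType) (e : T -> V).
Implicit Types (A B : {set T}) (s : seq V) (v w x : V).

Lemma free_pts_inj A i j : free (pts e A) -> i \in A -> j \in A -> e i = e j -> i = j.
Proof.
move=> fA iA jA eij; apply/eqP; have := crd_pt i fA jA; rewrite -eij crd_pt // eqxx.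
by case: eqP => // _ /esym/eqP; rewrite oner_eq0.
Qed.

Lemma sum_pts A s (f : V -> V) : perm_eq s (pts e A) ->
  \sum_(x <- s) f x = \sum_(i in A) f (e i).
Proof. by move=> sA; rewrite (perm_big _ sA) big_map big_enum. Qed.

(** Passes from functions of indices to functions of vectors; the second clause transfers properties
    such as nonnegativity, provided that the default r0 has them. *)
Lemma fun_on_pts (R : Type) (r0 : R) A (c : T -> R) : free (pts e A) ->
  exists2 d : V -> R, forall i, i \in A -> d (e i) = c i &
    forall P : R -> Prop, P r0 -> (forall i, i \in A -> P (c i)) -> forall x, P (d x).
Proof.
move=> fA; exists (fun x => if [pick i in A | e i == x] is Some i then c i else r0).
  move=> i iA; case: pickP => [j /andP[jA /eqP eji]|/(_ i)]; last by rewrite iA eqxx.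
  by rewrite (free_pts_inj fA jA iA eji).
by move=> P P0 Pc x; case: pickP => // i /andP[/Pc].
Qed.

Lemma cone_gen_pts A s v : free (pts e A) -> perm_eq s (pts e A) ->
  cone_gen s v <-> in_cone e A v.
Proof.
move=> fA sA; have us : uniq s by rewrite (perm_uniq sA) free_uniq.
split=> [/(cone_genP v us)[c c0 ->]|/in_coneP[vA v0]].
  rewrite (sum_pts (fun x => c x *: x) sA); apply/in_coneP.
  by split=> [|i iA]; rewrite ?sum_sp // (crd_uniq (fun i => c (e i))).
have [d dE d0] := fun_on_pts 0 (fun i => crd e A i v) fA.
apply/(cone_genP v us); exists d; first exact: (d0 (fun k => 0 <= k)).
rewrite (sum_pts (fun x => d x *: x) sA) {1}(crd_sum vA).
by apply: eq_bigr => i iA; rewrite dE.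
Qed.

Lemma zspan_pts A s v : free (pts e A) -> perm_eq s (pts e A) ->
  zspan s v <-> v \in sp e A /\ forall i, i \in A -> crd e A i v \is a Num.int.
Proof.
move=> fA sA; have us : uniq s by rewrite (perm_uniq sA) free_uniq.
split=> [/(zspanP v us)[z ->]|[vA vint]].
  rewrite (sum_pts (fun x => x *~ z x) sA).
  have -> : \sum_(i in A) e i *~ z (e i) = \sum_(i in A) (z (e i))%:~R *: e i.
    by apply: eq_bigr => i _; rewrite scaler_int.
  by split=> [|i iA]; rewrite ?sum_sp // (crd_uniq (fun i => (z (e i))%:~R)) // intr_int.
have [z zE _] := fun_on_pts 0 (fun i => Num.floor (crd e A i v)) fA.
apply/(zspanP v us); exists z; rewrite (sum_pts (fun x => x *~ z x) sA) {1}(crd_sum vA).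
by apply: eq_bigr => i iA; rewrite zE // -scaler_int floorK ?vint.
Qed.

Lemma in_cone_widen A B v : free (pts e A) -> B \subset A -> in_cone e B v -> in_cone e A v.
Proof.
move=> fA BA /in_coneP[vB v0]; apply/in_coneP; split=> [|i iA].
  by apply: subvP vB; apply: sp_sub.
rewrite (crd_sub i fA BA vB); have [/v0 //|iB] := boolP (i \in B).
by rewrite crd_out.
Qed.

Lemma in_cone_narrow A B v : free (pts e A) -> B \subset A -> in_cone e A v ->
  (forall i, i \in A -> i \notin B -> crd e A i v = 0) -> in_cone e B v.
Proof.
move=> fA BA /in_coneP[vA v0] c0.
have vB : v \in sp e B.
  rewrite (crd_sum vA) (big_setID B) /= (setIidPr BA) [X in _ + X]big1 ?addr0 ?sum_sp //.
  by move=> i; rewrite inE => /andP[iB iA]; rewrite c0 // scale0r.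
apply/in_coneP; split=> // i iB; rewrite -(crd_sub i fA BA vB).
by apply/v0/(subsetP BA).
Qed.

Definition coneset A : set V := [set v | in_cone e A v]%classic.

Lemma in_cone_pt A i : free (pts e A) -> i \in A -> in_cone e A (e i).
Proof.
by move=> fA iA; apply/in_coneP; split=> [|j _]; [apply: pts_sp|rewrite crd_pt // ler0n].
Qed.

Lemma is_span_uniq (sigma : set V) U : is_span sigma U -> cspan sigma = U.
Proof.
move=> [U1 U2]; have [C1 C2] := cspanP sigma; apply/eqP; rewrite eqEsubv.
by rewrite C2 // U2.
Qed.

Lemma cspan_coneset A : free (pts e A) -> cspan (coneset A) = sp e A.
Proof.
move=> fA; apply: is_span_uniq; split=> [v /in_coneP[]//|W HW].
by apply/sp_subP => i iA; apply: HW; apply: in_cone_pt.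
Qed.

(** The sum of the coordinates outside B is nonnegative on the cone A and vanishes there exactly on
    the cone B. *)
Lemma face_coneset A B : free (pts e A) -> B \subset A -> face (coneset B) (coneset A).
Proof.
move=> fA BA; have [k c v|u uE] := @exists_hom V (fun v => \sum_(i in A :\: B) crd e A i v).
  by move=> /=; rewrite mulr_sumr -big_split; apply: eq_bigr => i _; rewrite linearP.
exists u; split=> [v /in_coneP[_ v0]|].
  by rewrite uE sumr_ge0 // => i; rewrite inE => /andP[_ /v0].
apply/seteqP; split=> v /=; rewrite uE.
  move=> vB; split; first exact: in_cone_widen vB.
  apply: big1 => i; rewrite inE => /andP[iB iA].
  by have [vB' _] := in_coneP _ _ _ vB; rewrite (crd_sub i fA BA vB') crd_out.
move=> [vA /eqP]; have [_ v0] := in_coneP _ _ _ vA.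
rewrite psumr_eq0 => [/allP c0|i]; last by rewrite inE => /andP[_ /v0].
apply: in_cone_narrow vA _ => // i iA iB; apply/eqP.
by have := c0 i (mem_index_enum i); rewrite inE iA iB.
Qed.

Lemma coneset_face A tau : free (pts e A) -> face tau (coneset A) ->
  exists2 B : {set T}, B \subset A & tau = coneset B.
Proof.
move=> fA [u [u0 ->]]; exists [set i in A | u (e i) == 0].
  by apply/subsetP => i; rewrite inE => /andP[].
have BA : [set i in A | u (e i) == 0] \subset A.
  by apply/subsetP => i; rewrite inE => /andP[].
apply/seteqP; split=> v /= [].
  move=> vA uv; have [vA' v0] := in_coneP _ _ _ vA.
  apply: in_cone_narrow vA _ => // i iA; rewrite inE iA /= => ui.
  move/eqP: uv; rewrite {1}(crd_sum vA') linear_sum psumr_eq0 => [/allP c0|j jA]; last first.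
    by rewrite linearZ mulr_ge0 ?v0 //; apply: u0; apply: in_cone_pt.
  have := c0 i (mem_index_enum i); rewrite iA linearZ /= mulf_eq0 (negPf ui) orbF.
  by move/eqP.
move=> vB; split; first exact: in_cone_widen vB.
have [vB' _] := in_coneP _ _ _ vB; rewrite (crd_sum vB') linear_sum big1 // => i.
by rewrite inE => /andP[_ /eqP ui]; rewrite linearZ /= ui scaler0.
Qed.

End FreeCones.

Section Nonsingular.
Variables (V : vectType rat) (N : set V).
Hypothesis latN : is_lattice N.

Definition generators (gamma : set V) (s : seq V) : Prop :=
  forall v, v \in s <->
    exists rho, [/\ face rho gamma, cdim rho = 1%N & first_point N 0 rho v].

(* By [irredundant_ray], an irredundant generating set consists of ray generators. *)
Lemma generators_cone gamma s : is_cone gamma -> generators gamma s ->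
  forall x, gamma x <-> cone_gen s x.
Proof.
move=> [[s0 ->] pointed] sP x.
have [s1 irr1 E1] := exists_irredundant s0.
have pointed1 y : cone_gen s1 y -> cone_gen s1 (- y) -> y = 0.
  by move=> /E1 y1 /E1 y2; apply: pointed.
split; last first.
  apply: cone_gen_sub => v /sP[rho [[u [_ ->]] _ /first_point0[[_ [] //]]]].
move/E1; apply: cone_gen_sub => v vs.
have v0 : v != 0.
  apply/eqP => v0; apply: (irr1 v vs); rewrite [X in cone_gen _ X]v0; exact: cone_gen0.
have [u [u0 uE]] := irredundant_ray irr1 pointed1 vs.
have [t t0 fp] := exists_first_point latN v0.
set rho := (X in first_point _ _ X _) in fp.
have : t *: v \in s.
  apply/sP; exists rho; split=> //.
    exists u; split=> [y /E1 /u0 //|]; apply/seteqP; split=> y /=.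
      by move=> /uE[/E1].
    by move=> [/E1 y1 uy]; apply/uE.
  rewrite /cdim (@is_span_uniq _ _ <[v]>%VS) ?dim_vline ?v0 //; split=> [_ [k _ ->]|W HW].
    by rewrite memvZ // memv_line.
  by rewrite -memvE HW //; exists 1; rewrite ?ler01 ?scale1r.
move=> /cone_gen_mem /(cone_genZ (k := t^-1)); rewrite scalerA mulVf ?gt_eqF // scale1r.
by apply; rewrite invr_ge0 ltW.
Qed.

End Nonsingular.

Lemma free_pts_sub (V : vectType rat) (T : finType) (e : T -> V) (A B : {set T}) :
  free (pts e A) -> B \subset A -> free (pts e B).
Proof.
move=> fA BA; have : perm_eq (pts e A)
    ([seq e i | i <- enum A & i \in B] ++ [seq e i | i <- enum A & i \notin B]).
  by rewrite -map_cat perm_map // perm_sym (perm_filterC (mem B)).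
move=> /perm_free; rewrite fA => /esym/catl_free.
suff E : enum B = [seq i <- enum A | i \in B] by rewrite /pts E.
rewrite /enum_mem -filter_predI; apply: eq_filter => i /=.
by have [/(subsetP BA) ->|] := boolP (i \in B); rewrite ?andbT.
Qed.

(** * A nonsingular fan as a simplicial complex on its rays *)

Section NonsingularFan.
Variables (V : vectType rat) (N : set V) (S : {fset (set V)}).
Hypotheses (latN : is_lattice N) (fanS : is_fan S) (nsS : nonsingular_fan N S).
Implicit Types (gamma tau sigma : set V) (v w : V).

Definition gens gamma : seq V :=
  xget [::] [set s | generators N gamma s /\ zbasis (N `&` [set` cspan gamma]) s]%classic.

Definition fan_rays : seq V := flatten [seq gens gamma | gamma <- enum_fset S].

(* A ray is represented by its first lattice point. *)
Definition ray : finType := seq_sub fan_rays.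

Definition ray_pt (i : ray) : V := ssval i.

Definition verts gamma : {set ray} := [set i | ray_pt i \in gens gamma].

Lemma gensP gamma : gamma \in S -> generators N gamma (gens gamma) /\
  zbasis (N `&` [set` cspan gamma])%classic (gens gamma).
Proof.
move=> /nsS[s [s1 s2]]; rewrite /gens.
set P := (X in xget _ X); suff : P (xget [::] P) by [].
by apply: (@xgetI _ _ P s).
Qed.

Lemma perm_gens gamma : gamma \in S -> perm_eq (gens gamma) (pts ray_pt (verts gamma)).
Proof.
move=> gS; have [_ [free_g _]] := gensP gS.
apply: uniq_perm; first exact: free_uniq.
  by rewrite map_inj_uniq ?enum_uniq //; apply: val_inj.
move=> v; apply/idP/mapP => [vg|[i]]; last by rewrite mem_enum inE => ? ->.
have vr : v \in fan_rays by apply/flattenP; exists (gens gamma) => //; apply: map_f.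
by exists (SeqSub vr) => //; rewrite mem_enum inE.
Qed.

Lemma free_verts gamma : gamma \in S -> free (pts ray_pt (verts gamma)).
Proof. by move=> gS; rewrite -(perm_free (perm_gens gS)); case: (gensP gS) => _ []. Qed.

Lemma coneE gamma : gamma \in S -> gamma = coneset ray_pt (verts gamma).
Proof.
move=> gS; have [_ cS _ _] := fanS; have [gg _] := gensP gS.
apply/seteqP; split=> v /=.
  by move/(generators_cone latN (cS _ gS) gg)/(cone_gen_pts v (free_verts gS) (perm_gens gS)).
by move/(cone_gen_pts v (free_verts gS) (perm_gens gS))/(generators_cone latN (cS _ gS) gg).
Qed.

Lemma cspanE gamma : gamma \in S -> cspan gamma = sp ray_pt (verts gamma).
Proof. by move=> gS; rewrite {1}(coneE gS) cspan_coneset // free_verts. Qed.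

Lemma cdimE gamma : gamma \in S -> cdim gamma = #|verts gamma|.
Proof. by move=> gS; rewrite /cdim cspanE // dim_sp // free_verts. Qed.

Lemma verts_inj gamma tau : gamma \in S -> tau \in S -> verts gamma = verts tau -> gamma = tau.
Proof. by move=> gS tS E; rewrite (coneE gS) (coneE tS) E. Qed.

Implicit Types (A B : {set ray}) (i j : ray).

Lemma ray_first_point gamma i : gamma \in S -> i \in verts gamma ->
  first_point N 0 (coneset ray_pt [set i]) (ray_pt i).
Proof.
move=> gS ig; have [gg _] := gensP gS; have fg := free_verts gS.
have := ig; rewrite inE => /gg[rho [frho dimrho fp]].
rewrite {1}(coneE gS) in frho.
have [B BA rhoE] := coneset_face fg frho.
have fB := free_pts_sub fg BA.
have /eqP/cards1P[j BE] : #|B| = 1%N.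
  by rewrite -dimrho rhoE /cdim cspan_coneset // dim_sp.
have jB : j \in B by rewrite BE set11.
suff ij : i = j by rewrite {1}ij -BE -rhoE.
have [[_ ri _] _] := (first_point0 _ _ _).1 fp.
move: ri; rewrite rhoE BE => /in_coneP[ij _].
apply/eqP; have := crd_pt i fg ig; rewrite eqxx (crd_sub i fg _ ij) ?sub1set ?(subsetP BA) //.
by apply: contra_eqT => ne_ij; rewrite crd_out ?inE // eq_sym oner_neq0.
Qed.

(** The first lattice point of a ray does not depend on the cone of which the ray is a face. Hence a
    face of gamma has as vertices exactly the vertices of gamma that span it. *)
Lemma verts_coneset gamma A : gamma \in S -> A \subset verts gamma ->
  coneset ray_pt A \in S /\ verts (coneset ray_pt A) = A.
Proof.
move=> gS Ag; have fg := free_verts gS; have fA := free_pts_sub fg Ag.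
have AS : coneset ray_pt A \in S.
  case: fanS => _ _ clo _; apply: (clo gamma) => //.
  by rewrite [X in face _ X](coneE gS); apply: face_coneset.
split=> //; have [gA _] := gensP AS.
have point1 i : i \in A -> first_point N 0 (coneset ray_pt [set i]) (ray_pt i).
  by move=> iA; apply: ray_first_point gS _; apply: (subsetP Ag).
apply/setP => i; rewrite inE; apply/idP/idP => [/gA[rho [frho dimrho fp]]|iA].
  have [B BA rhoE] := coneset_face fA frho.
  have fB := free_pts_sub fA BA.
  have /eqP/cards1P[j BE] : #|B| = 1%N.
    by rewrite -dimrho rhoE /cdim cspan_coneset // dim_sp.
  have jA : j \in A by apply: (subsetP BA); rewrite BE set11.
  suff -> : i = j by [].
  apply: val_inj; apply: first_point_uniq (point1 j jA).
  by rewrite -BE -rhoE.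
apply/gA; exists (coneset ray_pt [set i]); have iA1 : [set i] \subset A by rewrite sub1set.
split; [exact: face_coneset| |exact: point1].
by rewrite /cdim cspan_coneset ?dim_sp ?cards1 // (free_pts_sub fA).
Qed.

Definition fan_complex : {set {set ray}} := [set verts (val gamma) | gamma : S].

Lemma fan_complexP A : reflect (exists2 gamma, gamma \in S & A = verts gamma)
  (A \in fan_complex).
Proof.
apply: (iffP imsetP) => [[gamma _ ->]|[gamma gS ->]]; first by exists (val gamma) => //; apply: valP.
by exists [` gS]%fset.
Qed.

Lemma verts_complex gamma : gamma \in S -> verts gamma \in fan_complex.
Proof. by move=> gS; apply/fan_complexP; exists gamma. Qed.

Lemma complex_coneset A : A \in fan_complex ->
  coneset ray_pt A \in S /\ verts (coneset ray_pt A) = A.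
Proof. by case/fan_complexP => gamma gS ->; apply: verts_coneset gS _. Qed.

Lemma complex_free A : A \in fan_complex -> free (pts ray_pt A).
Proof. by case/fan_complexP => gamma gS ->; apply: free_verts. Qed.

Lemma complex_sub (A B : {set ray}) : A \in fan_complex -> B \subset A -> B \in fan_complex.
Proof.
case/fan_complexP => gamma gS -> Bg; have [BS <-] := verts_coneset gS Bg.
exact: verts_complex.
Qed.

(** In a fan the intersection is a face of both cones, hence spanned by a subset of A and by one of
    B; the two subsets agree because a cone determines its vertices. *)
Lemma complex_cap A B v : A \in fan_complex -> B \in fan_complex ->
  in_cone ray_pt A v -> in_cone ray_pt B v -> in_cone ray_pt (A :&: B) v.
Proof.
move=> AK BK vA vB; have fA := complex_free AK; have fB := complex_free BK.
have [AS AE] := complex_coneset AK; have [BS BE] := complex_coneset BK.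
have [_ _ _ capS] := fanS; have [f1 f2] := capS _ _ AS BS.
have [C1 C1A E1] := coneset_face fA f1; have [C2 C2B E2] := coneset_face fB f2.
have [_ V1] := complex_coneset (complex_sub AK C1A).
have [_ V2] := complex_coneset (complex_sub BK C2B).
have C12 : C1 = C2 by rewrite -V1 -V2 -E1 -E2.
have vC : in_cone ray_pt C1 v.
  by have : (coneset ray_pt A `&` coneset ray_pt B)%classic v by []; rewrite E1.
apply: in_cone_widen vC; first exact: free_pts_sub fA (subsetIl _ _).
by rewrite subsetI C1A C12.
Qed.

Lemma face_verts tau gamma : tau \in S -> gamma \in S ->
  face tau gamma <-> verts tau \subset verts gamma.
Proof.
move=> tS gS; split=> [|tg].
  rewrite {1}(coneE gS) => /(coneset_face (free_verts gS))[B Bg tE].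
  by have [_] := verts_coneset gS Bg; rewrite -tE => ->.
by rewrite (coneE tS) (coneE gS); apply: face_coneset tg; apply: free_verts.
Qed.

Lemma lattice_crd gamma v : gamma \in S -> v \in sp ray_pt (verts gamma) ->
  N v <-> forall i, i \in verts gamma -> crd ray_pt (verts gamma) i v \is a Num.int.
Proof.
move=> gS vg; have [_ [_ NE]] := gensP gS.
have NEv : N v <-> zspan (gens gamma) v.
  by rewrite -NE; split=> [Nv|[]//]; split=> //=; rewrite cspanE.
rewrite NEv; split=> [/(zspan_pts v (free_verts gS) (perm_gens gS))[]//|H].
by apply/(zspan_pts v (free_verts gS) (perm_gens gS)).
Qed.

End NonsingularFan.

(** The projection pi_tau is dual to the projection of V along the span of tau: with q the
    projection onto that span, m is the sum of [m \o (\1 - q)], which annihilates the span, and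
    [m \o q], which annihilates [Psi tau]. *)
Lemma perp_projE (V : vectType rat) (Psi : complement_map V) tau (m : 'Hom(V, rat^o)) v :
  (cspan tau + Psi tau = fullv)%VS -> (cspan tau :&: Psi tau = 0)%VS ->
  perp_proj Psi tau m v = m (v - daddv_pi (cspan tau) (Psi tau) v).
Proof.
move=> full dir; set U := cspan tau; set W := Psi tau; pose q := daddv_pi U W.
have qW x : x \in W -> q x = 0.
  move=> xW; have := daddv_pi_add (w := x) dir; rewrite full memvf => /(_ isT).
  by rewrite (@daddv_pi_id _ _ W U) // 1?capvC // => /(canRL (addrK _)); rewrite subrr.
have qU x : x \in U -> q x = x by apply: daddv_pi_id.
have dir' : (annihilator U :&: annihilator W = 0)%VS.
  apply/eqP; rewrite -subv0; apply/subvP => h; rewrite memv_cap memv0.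
  case/andP=> /annihilatorP hU /annihilatorP hW; apply/eqP/lfunP => x; rewrite zero_lfunE.
  have : x \in (U + W)%VS by rewrite full memvf.
  by case/memv_addP => y yU [z zW ->]; rewrite linearD /= hU // hW // addr0.
pose m1 : 'Hom(V, rat^o) := (m \o (\1 - q))%VF; pose m2 : 'Hom(V, rat^o) := (m \o q)%VF.
have mE : m = m1 + m2.
  apply/lfunP => x; rewrite add_lfunE !comp_lfunE add_lfunE opp_lfunE id_lfunE.
  by rewrite -linearD subrK.
have m1U : m1 \in annihilator U.
  apply/annihilatorP => x xU; rewrite comp_lfunE add_lfunE opp_lfunE id_lfunE qU //.
  by rewrite subrr linear0.
have m2W : m2 \in annihilator W.
  by apply/annihilatorP => x xW; rewrite comp_lfunE qW // linear0.
have pm2 : perp_proj Psi tau m2 = 0.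
  have := daddv_pi_add (w := m2) dir'.
  have -> : m2 \in (annihilator U + annihilator W)%VS.
    by rewrite -[m2]add0r memv_add ?mem0v.
  have id2 : daddv_pi (annihilator W) (annihilator U) m2 = m2.
    by apply: daddv_pi_id => //; rewrite capvC.
  by move=> /(_ isT); rewrite id2 => /(canRL (addrK _)); rewrite subrr.
have pm1 : perp_proj Psi tau m1 = m1 by apply: daddv_pi_id.
rewrite {1}mE linearD /= pm2 addr0 pm1.
by rewrite comp_lfunE add_lfunE opp_lfunE id_lfunE.
Qed.

(** * Products of cycles *)

Section CycleRing.
Variables (V : vectType rat) (N : set V) (S : {fset (set V)}).
Hypotheses (latN : is_lattice N) (fanS : is_fan S) (nsS : nonsingular_fan N S).
Variables (Psi : complement_map V) (complS : complement_for Psi S).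
Variable R : cycle_ring N S Psi.

Local Notation e := (@ray_pt V N S).
Local Notation K := (fan_complex N S).
Local Notation ray := (ray N S).
Implicit Types (A B : {set ray}) (i l : ray) (v w : V) (x y : cycles S).

Definition cycle_coef x A : rat :=
  if insub (coneset e A) is Some gamma then x gamma else 0.

Definition cone_proj A : 'End(V) := daddv_pi (sp e A) (Psi (coneset e A)).

Let KS A : A \in K -> coneset e A \in S.
Proof. by move=> AK; case: (complex_coneset latN fanS nsS AK). Qed.

Let KV A : A \in K -> verts N S (coneset e A) = A.
Proof. by move=> AK; case: (complex_coneset latN fanS nsS AK). Qed.

Let Kfree A (AK : A \in K) : free (pts e A) := complex_free nsS AK.
Let Ksub A B (AK : A \in K) (BA : B \subset A) : B \in K :=
  complex_sub latN fanS nsS AK BA.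

Lemma cycle_coefE x A (AK : A \in K) : cycle_coef x A = x [` KS AK]%fset.
Proof.
rewrite /cycle_coef; case: insubP => [gamma _ E|]; last by rewrite KS.
by congr (x _); apply: val_inj.
Qed.

Lemma cone_proj_compl A : A \in K ->
  (sp e A + Psi (coneset e A) = fullv)%VS /\ (sp e A :&: Psi (coneset e A) = 0)%VS.
Proof.
by move=> AK; rewrite -(cspan_coneset (Kfree AK)); apply: cm_compl; apply/complS/KS.
Qed.

Lemma cone_proj_id A v : A \in K -> v \in sp e A -> cone_proj A v = v.
Proof. by move=> AK; apply: daddv_pi_id; case: (cone_proj_compl AK). Qed.

Lemma cone_proj_sp A v : cone_proj A v \in sp e A.
Proof. exact: memv_pi. Qed.

Lemma cone_proj0 A v : A \in K -> v \in Psi (coneset e A) -> cone_proj A v = 0.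
Proof.
move=> AK vP; have [full dir] := cone_proj_compl AK.
have := daddv_pi_add (w := v) dir; rewrite full memvf => /(_ isT).
rewrite (@daddv_pi_id _ _ (Psi (coneset e A)) _) // 1?capvC //.
by move=> /(canRL (addrK _)); rewrite subrr.
Qed.

Lemma cone_projB A v : A \in K -> v - cone_proj A v \in Psi (coneset e A).
Proof.
move=> AK; have [full dir] := cone_proj_compl AK.
have := daddv_pi_add (w := v) dir; rewrite full memvf => /(_ isT) {1}<-.
by rewrite /cone_proj addrAC subrr add0r memv_pi.
Qed.

(** The difference v - q_B v lies in Psi(B), which is contained in Psi(A) because A is a face of B,
    and q_A kills Psi(A). *)
Lemma cone_proj_comp A B v : B \in K -> A \subset B ->
  cone_proj A (cone_proj B v) = cone_proj A v.
Proof.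
move=> BK AB; have AK := Ksub BK AB.
apply/eqP; rewrite -subr_eq0 -linearB -oppr_eq0 -linearN opprB /=; apply/eqP.
apply: cone_proj0 => //; apply: subvP (cone_projB v BK).
have [] // := cm_face (complS (KS BK)) (face_coneset (Kfree BK) AB).
Qed.

Lemma exists_maximal gamma : gamma \in S ->
  exists sigma, maximal S sigma /\ face gamma sigma.
Proof.
move=> gS.
pose P (k : nat) := `[< exists sigma, [/\ sigma \in S, face gamma sigma &
   #|verts N S sigma| = k] >].
have exP : exists k, P k.
  exists #|verts N S gamma|; apply/asboolP; exists gamma; split=> //.
  by apply/(face_verts latN fanS nsS).
have ubP k : P k -> (k <= #|ray|)%N.
  by move=> /asboolP[sigma [_ _ <-]]; apply: max_card.
case: (ex_maxnP exP ubP) => k /asboolP[sigma [sS fs <-]] kmax.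
exists sigma; split=> //; split=> // tau tS st.
have [_ _ _ cap] := fanS; have [_] := cap _ _ sS tS.
have -> : (sigma `&` tau)%classic = sigma by apply/classical_sets.setIidPl.
move=> /(face_verts latN fanS nsS sS tS) sub.
apply/esym; apply: (verts_inj latN fanS nsS) => //.
apply/eqP; rewrite eqEcard sub; apply: kmax; apply/asboolP; exists tau; split=> //.
apply/(face_verts latN fanS nsS) => //; apply: subset_trans sub.
exact/(face_verts latN fanS nsS).
Qed.

Definition orbit A : cycles S := orbit_closure S (coneset e A).

Lemma coneset_inj A B : A \in K -> B \in K -> coneset e A = coneset e B -> A = B.
Proof. by move=> AK BK E; rewrite -(KV AK) E KV. Qed.

Lemma cycle_coef_orbit A B : A \in K -> B \in K -> cycle_coef (orbit A) B = (A == B)%:R.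
Proof.
move=> AK BK; rewrite cycle_coefE ffunE /=; congr (nat_of_bool _)%:R.
apply/eqP/eqP => [/coneset_inj->//|-> //].
Qed.

Lemma cycle_orbits x : x = \sum_(A in K) cycle_coef x A *: orbit A.
Proof.
apply/ffunP => gamma; pose B := verts N S (val gamma).
have gS := valP gamma; have BK : B \in K by apply: verts_complex.
have BE : coneset e B = val gamma by rewrite -(coneE latN fanS nsS gS).
rewrite sum_ffunE (bigD1 B) //= big1 ?addr0 => [|A /andP[AK ne_AB]].
  rewrite !ffunE BE eqxx cycle_coefE [_ *: _]mulr1; congr (x _); apply: val_inj.
  by rewrite /= BE.
rewrite !ffunE (_ : _ == _ = false) ?scaler0 //; apply: contraNF ne_AB => /eqP E.
by rewrite -(KV AK) -E.
Qed.

Lemma cmul0 y : cmul R 0 y = 0.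
Proof.
have := cmul_linear R 1 0 0 y; rewrite !scale1r addr0 => /eqP.
by rewrite -subr_eq0 opprD addNKr oppr_eq0 => /eqP.
Qed.

Lemma cmulDl x y z : cmul R (x + y) z = cmul R x z + cmul R y z.
Proof. by have := cmul_linear R 1 x y z; rewrite !scale1r. Qed.

Lemma cmulZl a x z : cmul R (a *: x) z = a *: cmul R x z.
Proof. by have := cmul_linear R a x 0 z; rewrite !addr0 cmul0 addr0. Qed.

Lemma cmul_suml (I : Type) (r : seq I) (P : pred I) (f : I -> cycles S) z :
  cmul R (\sum_(i <- r | P i) f i) z = \sum_(i <- r | P i) cmul R (f i) z.
Proof.
apply: (big_morph (fun x => cmul R x z)); last exact: cmul0.
by move=> x y; apply: cmulDl.
Qed.

Lemma cycle_coef_sum (I : Type) (r : seq I) (P : pred I) (f : I -> cycles S) A : A \in K ->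
  cycle_coef (\sum_(i <- r | P i) f i) A = \sum_(i <- r | P i) cycle_coef (f i) A.
Proof. by move=> AK; rewrite cycle_coefE sum_ffunE; apply: eq_bigr => i _; rewrite cycle_coefE. Qed.

Lemma cycle_coefZ a x A : A \in K -> cycle_coef (a *: x) A = a * cycle_coef x A.
Proof. by move=> AK; rewrite !cycle_coefE ffunE. Qed.

Definition co_proj A v := v - cone_proj A v.

(** Modulo the span of A, a point of the span of B is its coordinate at l times [e l]. For a lattice
    point this coordinate is an integer, because the vertices of B form a lattice basis; if
    positive, it is at least 1. *)
Lemma ray_first_point_mod A B l : B \in K -> l \in B -> A = B :\ l ->
  first_point N (sp e A) (coneset e B) (e l).
Proof.
move=> BK lB AE; have fB := Kfree BK.
have AB : A \subset B by rewrite AE subsetDl.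
have lA : l \notin A by rewrite AE !inE eqxx.
have crdA v : v \in sp e A -> crd e B l v = 0.
  by move=> vA; rewrite (crd_sub l fB AB vA) crd_out.
have BS := KS BK.
have Nint v : v \in sp e B -> N v <-> forall i, i \in B -> crd e B i v \is a Num.int.
  by move=> vB; have := lattice_crd latN fanS nsS BS; rewrite KV // => /(_ v vB).
have mem_out v : v \in sp e B -> v - crd e B l v *: e l \in sp e A.
  move=> vB; rewrite {1}(crd_sum vB) (bigD1 l) //= addrAC subrr add0r.
  apply: memv_suml => i /andP[iB ne_il]; apply: memvZ; apply: pts_sp.
  by rewrite AE !inE ne_il.
split.
  split; last first.
    by move=> /= /crdA /eqP; rewrite crd_pt // eqxx oner_eq0.
  split; last first.
    by exists (e l); [exact: in_cone_pt|exists 0; rewrite ?addr0 //= mem0v].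
  by apply/(Nint _ (pts_sp e lB)) => i iB; rewrite crd_pt // rpred_nat.
move=> w [[Nw [x /in_coneP[xB x0] [u /= uA wE]]] /= /negP wA].
have uB : u \in sp e B by apply: subvP uA; apply: sp_sub.
have wB : w \in sp e B by rewrite -wE; apply: rpredD.
exists (crd e B l w); last exact: mem_out.
have c0 : 0 <= crd e B l w by rewrite -wE linearD /= (crdA u) // addr0 x0.
have c_neq0 : crd e B l w != 0.
  apply: contraNneq wA => c; have := mem_out w wB.
  by rewrite c scale0r subr0.
by rewrite -(ger0_norm c0) norm_intr_ge1 // (Nint w wB).1.
Qed.

(** The divisor has the coordinate i0 as local equation on each cone, and by [perp_projE] its
    restriction to V(A) is evaluated at [co_proj A (e l)]. The sum has at most one term, and none if
    A is not a facet of B. *)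
Lemma cycle_coef_divisorM i0 A B : [set i0] \in K -> A \in K -> B \in K ->
  cycle_coef (cmul R (orbit [set i0]) (orbit A)) B =
  \sum_(l in B | A == B :\ l) crd e B i0 (co_proj A (e l)).
Proof.
move=> i0K AK BK.
have /choice[m mE] : forall sigma, exists h : 'Hom(V, rat^o),
    forall v, h v = crd e (verts N S sigma) i0 v.
  by move=> sigma; apply: exists_hom => k u v; rewrite linearP.
have isdiv : is_divisor (orbit [set i0]).
  move=> sigma dimsigma; rewrite ffunE; case: eqP => // E; case: dimsigma.
  by rewrite E /cdim (cspan_coneset (Kfree i0K)) (dim_sp (Kfree i0K)) cards1.
have loceq : local_equations N (orbit [set i0]) m.
  move=> sigma rho v [sS _] frho dimrho fp; rewrite mE ffunE.
  rewrite {1}(coneE latN fanS nsS sS) in frho.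
  have [C Cs rhoE] := coneset_face (free_verts nsS sS) frho.
  have CK : C \in K by apply: Ksub Cs; apply: verts_complex.
  have /eqP/cards1P[j CE] : #|C| = 1%N.
    by rewrite -dimrho rhoE /cdim (cspan_coneset (Kfree CK)) (dim_sp (Kfree CK)).
  have js : j \in verts N S sigma by apply: (subsetP Cs); rewrite CE set11.
  have -> : v = e j.
    apply: first_point_uniq fp _; rewrite rhoE CE.
    exact: (ray_first_point latN fanS nsS sS).
  rewrite crd_pt ?(free_verts nsS) //; congr (nat_of_bool _)%:R.
  rewrite rhoE; apply/eqP/eqP => [->|/(coneset_inj CK i0K)]; first by rewrite CE.
  by rewrite CE => /set1_inj.
have := @cmul_divisor _ _ _ _ R (orbit [set i0]) m [` KS AK]%fset isdiv loceq [` KS BK]%fset.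
rewrite /= -/(orbit A) -(cycle_coefE _ BK) => -[is_ray not_ray].
have fAB : face (coneset e A) (coneset e B) <-> A \subset B.
  have := face_verts latN fanS nsS (KS AK) (KS BK); rewrite !KV //.
have dimAB : cdim (coneset e B) = (cdim (coneset e A)).+1 <-> #|B| = #|A|.+1.
  by rewrite !(cdimE latN fanS nsS) ?KS // !KV.
have [[l lB AE]|no] := pselect (exists2 l, l \in B & A = B :\ l); last first.
  rewrite not_ray => [|[/fAB AB /dimAB cAB]].
    by rewrite big_pred0 // => l; apply/negP => /andP[lB /eqP AE]; apply: no; exists l.
  have /eqP/cards1P[l lE] : #|B :\: A| = 1%N by rewrite cardsD (setIidPr AB) cAB subSnn.
  apply: no; exists l; first by have := set11 l; rewrite -lE inE => /andP[].
  by rewrite -lE setDDr setDv set0U (setIidPr AB).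
have AB : A \subset B by rewrite AE subsetDl.
have lA : l \notin A by rewrite AE !inE eqxx.
rewrite (bigD1 l) /=; last by rewrite lB AE eqxx.
rewrite big1 ?addr0 => [|j /andP[/andP[jB /eqP AE'] ne_jl]]; last first.
  by move: lA; rewrite AE' !inE lB andbT negbK eq_sym (negPf ne_jl).
(* The ring axiom reads its values off maximal cones; on the span of B the coordinate of sigma
   restricts to that of B. *)
have [sigma [maxs fBs]] := exists_maximal (KS BK).
have sS : sigma \in S by case: maxs.
have Bs : B \subset verts N S sigma.
  by have /(face_verts latN fanS nsS (KS BK) sS) := fBs; rewrite KV.
rewrite (is_ray _ sigma (e l)) //; last 2 first.
- by split; [apply/fAB|apply/dimAB; rewrite (cardsD1 l B) lB AE].
- by rewrite (cspan_coneset (Kfree AK)); apply: ray_first_point_mod AE.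
have [full dir] := cone_proj_compl AK.
rewrite perp_projE ?(cspan_coneset (Kfree AK)) // mE.
rewrite (crd_sub i0 (free_verts nsS sS) Bs) // rpredB ?pts_sp //.
by apply: subvP (memv_pi _ _ _); apply: sp_sub.
Qed.

End CycleRing.

(** * Functions that are polynomial along lines *)

Section LinePolynomial.
Variable V : vectType rat.
Implicit Types (g h : V -> {poly rat}).

(** A substitute for polynomial maps on V: stable under sums, products and composition with linear
    maps, and strong enough for [line_poly_far]. *)
Definition line_poly g := forall a b : V, exists G : {poly {poly rat}},
  forall s : rat, g (a + s *: b) = G.[s%:P].

Lemma line_poly_cst p : line_poly (fun _ => p).
Proof. by move=> a b; exists p%:P => s; rewrite hornerC. Qed.

Lemma line_polyD g h : line_poly g -> line_poly h -> line_poly (fun v => g v + h v).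
Proof.
move=> Hg Hh a b; have [G GE] := Hg a b; have [H HE] := Hh a b.
by exists (G + H) => s; rewrite hornerD GE HE.
Qed.

Lemma line_polyM g h : line_poly g -> line_poly h -> line_poly (fun v => g v * h v).
Proof.
move=> Hg Hh a b; have [G GE] := Hg a b; have [H HE] := Hh a b.
by exists (G * H) => s; rewrite hornerM GE HE.
Qed.

Lemma line_poly_sum (I : Type) (r : seq I) (P : pred I) (f : I -> V -> {poly rat}) :
  (forall i, P i -> line_poly (f i)) -> line_poly (fun v => \sum_(i <- r | P i) f i v).
Proof.
move=> Hf; elim: r => [|i r IHr] a b.
  by have [G GE] := line_poly_cst 0 a b; exists G => s; rewrite -GE big_nil.
case Pi : (P i); last first.
  by have [G GE] := IHr a b; exists G => s; rewrite -GE big_cons Pi.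
have [G GE] := line_polyD (Hf i Pi) IHr a b.
by exists G => s; rewrite -GE big_cons Pi.
Qed.

Lemma line_poly_scalar (f : {scalar V}) : line_poly (fun v => (f v)%:P).
Proof.
move=> a b; exists ((f a)%:P%:P + (f b)%:P *: 'X) => s.
by rewrite hornerD hornerC hornerZ hornerX linearD linearZ /= polyCD polyCM mulrC.
Qed.

Lemma line_poly_comp g (q : 'End(V)) : line_poly g -> line_poly (fun v => g (q v)).
Proof.
move=> Hg a b; have [G GE] := Hg (q a) (q b).
by exists G => s; rewrite -GE linearD linearZ.
Qed.

(** Along the line the coefficient of degree d is a polynomial in s with infinitely many zeros, so
    it also vanishes at s = 0. *)
Lemma line_poly_far g d w b s0 : line_poly g ->
  (forall s : nat, (s0 <= s)%N -> (g (w + b *+ s))`_d = 0) -> (g w)`_d = 0.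
Proof.
move=> Hg far; have [G GE] := Hg w b.
pose P : {poly rat} := map_poly (coefp d) G.
have PE s : (g (w + s *: b))`_d = P.[s].
  rewrite GE horner_coef coef_sum (horner_coef_wide (n := size G)) ?size_poly //.
  by apply: eq_bigr => i _; rewrite -rmorphXn /= coefMC coef_map.
have P0 : P = 0.
  apply/eqP/negPn/negP => Pn0.
  pose rs := [seq (s0 + j)%:R : rat | j <- iota 0 (size P)].
  have : (size rs < size P)%N.
    apply: max_poly_roots => //; last first.
      by rewrite map_inj_uniq ?iota_uniq // => i j /eqP; rewrite eqr_nat eqn_add2l => /eqP.
    by apply/allP => _ /mapP[j _ ->]; rewrite /root -PE scaler_nat far ?leq_addr ?eqxx.
  by rewrite /rs size_map size_iota ltnn.
by have := PE 0; rewrite scale0r addr0 P0 horner0.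
Qed.

End LinePolynomial.

(** * Lifting cycles to piecewise polynomials *)

Section Decomposition.
Variables (V : vectType rat) (N : set V) (S : {fset (set V)}).
Hypotheses (latN : is_lattice N) (fanS : is_fan S) (nsS : nonsingular_fan N S).
Variables (Psi : complement_map V) (complS : complement_for Psi S).
Variable R : cycle_ring N S Psi.

Local Notation e := (@ray_pt V N S).
Local Notation K := (fan_complex N S).
Local Notation ray := (ray N S).
Local Notation one := (orbit_closure S [set (0 : V)]%classic).
Local Notation coef := (@cycle_coef V N S).
Local Notation orbit := (@orbit V N S).
Local Notation cone_proj := (@cone_proj V N S Psi).
Local Notation co_proj := (@co_proj V N S Psi).
Implicit Types (A B : {set ray}) (l : ray) (v w : V) (x y : cycles S).
Implicit Types (f g : {set ray} -> V -> {poly rat}).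

Let Kfree A (AK : A \in K) : free (pts e A) := complex_free nsS AK.
Let Ksub A B (AK : A \in K) (BA : B \subset A) : B \in K :=
  complex_sub latN fanS nsS AK BA.

(* [f A w] is the value on the cone A, in the direction w, of a piecewise
   polynomial graded by the powers of 'X; [x] is its class in the cycle ring. *)
Definition represents x f := exists h : {set ray} -> V -> {poly rat},
  [/\ forall A w, A \in K -> (h A w)`_0 = coef x A,
      forall A, line_poly (h A)
    & forall B w, B \in K -> w \in sp e B -> f B w =
        \sum_(A : {set ray} | A \subset B) 'X^#|A| * (\prod_(i in A) crd e B i w)%:P *
          h A (cone_proj A w)].

Lemma represents_ext x f g : (forall B w, B \in K -> w \in sp e B -> f B w = g B w) ->
  represents x f -> represents x g.
Proof.
by move=> fg [h [h0 hl hf]]; exists h; split=> // B w BK wB; rewrite -fg // hf.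
Qed.

Lemma representsZ a x f : represents x f -> represents (a *: x) (fun B w => a *: f B w).
Proof.
move=> [h [h0 hl hf]]; exists (fun A w => a%:P * h A w); split.
- by move=> A w AK; rewrite mul_polyC coefZ h0 // (cycle_coefZ latN fanS nsS).
- by move=> A; apply: line_polyM => //; apply: line_poly_cst.
move=> B w BK wB; rewrite hf // scaler_sumr; apply: eq_bigr => A _.
by rewrite mul_polyC scalerAr.
Qed.

Lemma representsD x y f g : represents x f -> represents y g ->
  represents (x + y) (fun B w => f B w + g B w).
Proof.
move=> [h [h0 hl hf]] [k [k0 kl kg]]; exists (fun A w => h A w + k A w); split.
- move=> A w AK; rewrite coefD h0 // k0 // !(cycle_coefE latN fanS nsS _ AK).
  by rewrite ffunE.
- by move=> A; apply: line_polyD.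
move=> B w BK wB; rewrite hf // kg // -big_split; apply: eq_bigr => A _ /=.
by rewrite mulrDr.
Qed.

Lemma represents0 : represents 0 (fun _ _ => 0).
Proof.
exists (fun _ _ => 0); split=> [A w AK|A|B w _ _]; last by rewrite big1 // => A; rewrite mulr0.
  by rewrite coef0 (cycle_coefE latN fanS nsS _ AK) ffunE.
exact: line_poly_cst.
Qed.

Lemma represents_sum (I : Type) (r : seq I) (x : I -> cycles S)
    (f : I -> {set ray} -> V -> {poly rat}) :
  (forall i, represents (x i) (f i)) ->
  represents (\sum_(i <- r) x i) (fun B w => \sum_(i <- r) f i B w).
Proof.
move=> Hf; elim: r => [|i r IHr].
  rewrite big_nil; apply: represents_ext represents0 => B w _ _.
  by rewrite big_nil.
rewrite big_cons; apply: represents_ext (representsD (Hf i) IHr) => B w _ _.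
by rewrite big_cons.
Qed.

Lemma sum_subset_pairs (W : zmodType) B (G : {set ray} -> ray -> W) :
  \sum_(A : {set ray} | A \subset B) \sum_(l in A) G A l =
  \sum_(A : {set ray} | A \subset B) \sum_(l in B :\: A) G (l |: A) l.
Proof.
rewrite (exchange_big_dep (mem B)) /=; last by move=> A l /subsetP AB /AB.
rewrite [RHS](exchange_big_dep (mem B)) /=; last first.
  by move=> A l _; rewrite inE => /andP[].
apply: eq_bigr => l lB.
rewrite (reindex_onto (fun A => l |: A) (fun A => A :\ l)) /=; last first.
  by move=> A /andP[_ lA]; rewrite setD1K.
apply: eq_bigl => A; rewrite setU11 andbT !inE lB andbT.
have [lA|lA] := boolP (l \in A); last by rewrite setU1K // eqxx subUset sub1set lB.
rewrite andbF; apply/negP => /andP[_ /eqP E].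
by move: lA; rewrite -E !inE eqxx.
Qed.

Lemma co_proj0 A v : A \in K -> v \in sp e A -> co_proj A v = 0.
Proof.
by move=> AK vA; rewrite /co_proj (cone_proj_id latN fanS nsS complS) // subrr.
Qed.

(** The coordinate i0 of w splits into its values at q_A w and at [co_proj A w]. The first
    multiplies h_A. The second is linear in the coordinates x_l of w with l outside A, and x_l turns
    the monomial of A into that of [l |: A]; its coefficients are those of [cycle_coef_divisorM]. *)
Lemma represents_divisorM i0 x f : [set i0] \in K -> represents x f ->
  represents (cmul R (orbit [set i0]) x) (fun B w => (crd e B i0 w)%:P * 'X * f B w).
Proof.
move=> i0K [h [h0 hl hf]].
pose h' B u := (crd e B i0 u)%:P * 'X * h B u +
   \sum_(l in B) (crd e B i0 (co_proj (B :\ l) (e l)))%:P * h (B :\ l) (cone_proj (B :\ l) u).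
exists h'; split.
(* The first summand of h' is divisible by 'X, so the constant coefficient comes from the second
   alone. *)
- move=> B w BK; rewrite /h' coefD mulrAC coefMX add0r coef_sum.
  rewrite [in RHS](cycle_orbits latN fanS nsS x) cmulC cmul_suml.
  rewrite (cycle_coef_sum latN fanS nsS) //.
  under [RHS]eq_bigr => A AK do rewrite cmulZl (cycle_coefZ latN fanS nsS) // cmulC
     (cycle_coef_divisorM latN fanS nsS complS R i0K AK BK) mulr_sumr.
  rewrite (exchange_big_dep (mem B)) /=; last by move=> A l _ /andP[].
  apply: eq_bigr => l lB; have BlK : B :\ l \in K by apply: Ksub BK (subD1set _ _).
  rewrite (bigD1 (B :\ l)) /=; last by rewrite BlK lB eqxx.
  rewrite big1 ?addr0 => [|A /andP[/and3P[_ _ /eqP ->]]]; last by rewrite eqxx.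
  by rewrite coefCM h0 // mulrC.
- move=> B; apply: line_polyD.
    apply: line_polyM => //; apply: line_polyM; last exact: line_poly_cst.
    exact: (line_poly_scalar (crd e B i0)).
  apply: line_poly_sum => l _; apply: line_polyM; first exact: line_poly_cst.
  exact: line_poly_comp.
move=> B w BK wB; rewrite hf // mulr_sumr.
under [RHS]eq_bigr => A AB do rewrite /h' mulrDr mulr_sumr.
(* The second part of [h' A] consists of contributions of the faces [A :\ l]; the sum is rearranged
   by these faces. *)
rewrite big_split /= (sum_subset_pairs B (fun A l =>
   'X^#|A| * (\prod_(i in A) crd e B i w)%:P *
   ((crd e A i0 (co_proj (A :\ l) (e l)))%:P *
     h (A :\ l) (cone_proj (A :\ l) (cone_proj A w))))).
rewrite -big_split; apply: eq_bigr => A AB /=.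
have AK := Ksub BK AB.
have termE l : l \in B :\: A ->
   'X^#|l |: A| * (\prod_(i in l |: A) crd e B i w)%:P *
   ((crd e (l |: A) i0 (co_proj ((l |: A) :\ l) (e l)))%:P *
     h ((l |: A) :\ l) (cone_proj ((l |: A) :\ l) (cone_proj (l |: A) w))) =
   'X^#|A| * (\prod_(i in A) crd e B i w)%:P * h A (cone_proj A w) * 'X *
    (crd e B l w * crd e B i0 (co_proj A (e l)))%:P.
  rewrite inE => /andP[lA lB].
  have lAB : l |: A \subset B by rewrite subUset sub1set lB.
  have lAK := Ksub BK lAB.
  rewrite setU1K // (cone_proj_comp latN fanS nsS complS w lAK (subsetUr _ _)).
  rewrite cardsU1 lA add1n exprS big_setU1 //= !polyCM.
  have -> : crd e (l |: A) i0 (co_proj A (e l)) = crd e B i0 (co_proj A (e l)).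
    apply/esym/(crd_sub i0 (Kfree BK) lAB); apply: rpredB.
      exact: pts_sp (setU11 _ _).
    by apply: subvP (cone_proj_sp Psi A _); apply: sp_sub; apply: subsetUr.
  have alg (X Xn P H a b : {poly rat}) :
    X * Xn * (a * P) * (b * H) = Xn * P * H * X * (a * b) by ring.
  exact: alg.
rewrite (eq_bigr _ termE) -mulr_sumr -[X in _ + _ * X]rmorph_sum /=.
(* [co_proj A] kills the span of A, so only the coordinates of w outside A contribute. *)
have -> : \sum_(l in B :\: A) crd e B l w * crd e B i0 (co_proj A (e l)) =
    crd e B i0 (co_proj A w).
  have coE v : co_proj A v = (\1 - cone_proj A)%VF v.
    by rewrite add_lfunE opp_lfunE id_lfunE.
  have -> : co_proj A w = co_proj A (\sum_(i in B :\: A) crd e B i w *: e i).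
    rewrite [in LHS](crd_sum wB) [X in co_proj A X = _](big_setID A) /= (setIidPr AB).
    by rewrite !coE linearD /= -[X in X + _]coE (co_proj0 AK (sum_sp _ _ _)) add0r.
  rewrite coE !linear_sum; apply: eq_bigr => l _.
  by rewrite !linearZ /= -coE.
have -> : crd e A i0 (cone_proj A w) = crd e B i0 (cone_proj A w).
  by rewrite (crd_sub i0 (Kfree BK) AB) // cone_proj_sp.
have -> : crd e B i0 w = crd e B i0 (cone_proj A w) + crd e B i0 (co_proj A w).
  by rewrite -linearD /co_proj addrC subrK.
have alg (X Xn P H a b : {poly rat}) :
  (a + b) * X * (Xn * P * H) = Xn * P * (a * X * H) + Xn * P * H * X * b by ring.
by rewrite polyCD; apply: alg.
Qed.

Lemma complex_set0 : set0 \in K.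
Proof.
have [/fset0Pn[gamma gS] _ _ _] := fanS.
by apply: Ksub (verts_complex N gS) (sub0set _).
Qed.

Lemma coneset0 : coneset e set0 = [set (0 : V)]%classic.
Proof.
have sp0 : sp e set0 = 0%VS.
  by apply/eqP; rewrite -subv0; apply/sp_subP => i; rewrite inE.
apply/seteqP; split=> v /=; rewrite /coneset /= /in_cone sp0 memv0.
  by move=> /andP[/eqP].
by move=> ->; rewrite eqxx; apply/forall_inP => j; rewrite inE.
Qed.

Lemma represents1 : represents one (fun _ _ => 1).
Proof.
exists (fun A _ => (A == set0)%:R); split=> [A w AK|A|B w BK wB].
- have oneE : one = orbit set0 by rewrite /orbit coneset0.
  rewrite oneE (cycle_coef_orbit latN fanS nsS complex_set0 AK) eq_sym.
  by case: eqP => _; rewrite ?coef1 ?coef0.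
- exact: line_poly_cst.
rewrite (bigD1 set0) ?sub0set //= cards0 big_set0 eqxx !mulr1 big1 ?addr0 // => A.
by case/andP=> _ /negPf ->; rewrite mulr0.
Qed.

Local Notation n := (\dim (@fullv _ V)).

(** The factor y is present because what has been lifted is multiplication by a divisor, not the
    product of two arbitrary cycles; powers of D act on y one factor at a time. *)
Lemma represents_todd_series l y f : [set l] \in K -> represents y f ->
  represents (cmul R (todd_series R (orbit [set l])) y)
    (fun B w => todd_poly n.+1 (crd e B l w) * f B w).
Proof.
move=> lK yf; set D := orbit [set l].
have iterE k : cmul R (iter k (cmul R D) one) y = iter k (cmul R D) y.
  by elim: k => [|k IHk] /=; rewrite ?cmul1 // -IHk cmulA.
have iter_rep k : represents (iter k (cmul R D) y)
    (fun B w => ((crd e B l w)%:P * 'X) ^+ k * f B w).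
  elim: k => [|k IHk].
    by apply: represents_ext yf => B w _ _; rewrite expr0 mul1r.
  apply: represents_ext (represents_divisorM lK IHk) => B w _ _.
  by rewrite exprS mulrA.
rewrite /todd_series cmul_suml.
have E k : cmul R (todd_coef k *: iter k (cmul R D) one) y =
    todd_coef k *: iter k (cmul R D) y by rewrite cmulZl iterE.
under eq_bigr => k _ do rewrite E.
apply: represents_ext (represents_sum _ (fun k : 'I_n.+1 =>
  representsZ (todd_coef k) (iter_rep k))) => B w _ _.
rewrite /todd_poly poly_def mulr_suml; apply: eq_bigr => k _.
by rewrite scalerAl exprMn -rmorphXn /= mul_polyC scalerA.
Qed.

(** Rays outside B have coordinate 0 on B, where the Todd series is 1, so the product over all rays
    of the fan reduces to one over B. *)
Lemma represents_todd_class : represents (todd_class R)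
  (fun B w => \prod_(i in B) todd_poly n.+1 (crd e B i w)).
Proof.
pose g (rho : S) B w := \prod_(i in B | [set i] == verts N S (val rho))
   todd_poly n.+1 (crd e B i w).
have todd0 : todd_poly n.+1 0 = 1.
  apply/polyP => j; rewrite coef_poly coef1; case: j => [|j] /=.
    by rewrite expr0 mulr1.
  by rewrite expr0n /= mulr0 if_same.
suff : represents (todd_class R)
    (fun B w => \prod_(rho : S | cdim (val rho) == 1%N) g rho B w).
  apply: represents_ext => B w BK wB.
  rewrite /g (exchange_big_dep (mem B)) /=; last by move=> rho i _ /andP[].
  apply: eq_bigr => i iB; have iK : [set i] \in K by apply: Ksub BK _; rewrite sub1set.
  have [iS iV] := complex_coneset latN fanS nsS iK.
  rewrite (big_pred1 [` iS]%fset) // => rho /=; rewrite iB /=.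
  apply/andP/eqP => [[_ /eqP E]|->]; last first.
    by rewrite /= iV eqxx (cdimE latN fanS nsS) // iV cards1.
  apply/val_inj; rewrite /= E; exact: (coneE latN fanS nsS (valP rho)).
rewrite /todd_class.
have big_rep (r : seq S) : represents
    (\big[cmul R/one]_(rho <- r | cdim (val rho) == 1%N)
       todd_series R (orbit_closure S (val rho)))
    (fun B w => \prod_(rho <- r | cdim (val rho) == 1%N) g rho B w).
  elim: r => [|rho r IHr].
    rewrite big_nil; apply: represents_ext represents1 => B w _ _.
    by rewrite big_nil.
  rewrite big_cons; case: ifP => dimrho; last first.
    by apply: represents_ext IHr => B w _ _; rewrite big_cons dimrho.
  have rS := valP rho; have := dimrho; rewrite (cdimE latN fanS nsS rS) => /cards1P[l lE].
  have rhoE : val rho = coneset e [set l] by rewrite -lE -(coneE latN fanS nsS rS).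
  have lK : [set l] \in K by rewrite -lE; apply: verts_complex.
  rewrite rhoE; apply: represents_ext (represents_todd_series lK IHr) => B w BK wB.
  rewrite big_cons dimrho; congr (_ * _); rewrite /g lE.
  have [lB|lB] := boolP (l \in B).
    rewrite (big_pred1 l) // => i /=; rewrite (inj_eq set1_inj).
    by case: eqP => [->|]; rewrite ?lB ?andbF.
  rewrite crd_out // todd0 big_pred0 // => i; rewrite (inj_eq set1_inj).
  by case: eqP => [->|]; rewrite ?(negPf lB) ?andbF.
exact: big_rep.
Qed.

End Decomposition.

(** * Independence of the subdivision *)

Section FanFaces.
Variables (V : vectType rat) (Sigma : {fset (set V)}).
Hypothesis fanSigma : is_fan Sigma.
Implicit Types (F G sigma : set V) (v w : V).

Lemma fan_cone F : F \in Sigma -> exists s, F = cone_gen s.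
Proof. by move=> FS; case: fanSigma => _ /(_ F FS)[[s ->] _] _ _; exists s. Qed.

Lemma fan_add F v w : F \in Sigma -> F v -> F w -> F (v + w).
Proof. by move=> /fan_cone[s ->]; apply: cone_genD. Qed.

Lemma fan_scale F (c : rat) v : F \in Sigma -> 0 <= c -> F v -> F (c *: v).
Proof. by move=> /fan_cone[s ->]; apply: cone_genZ. Qed.

Lemma face_full F G : face G F -> (cdim F <= cdim G)%N -> G = F.
Proof.
move=> [u [u0 GE]] dimFG; have [F1 F2] := cspanP F; have [G1 G2] := cspanP G.
have GF : (cspan G <= cspan F)%VS.
  by apply: G2 => v; rewrite GE => -[Fv _]; apply: F1.
have /eqP spE : cspan G == cspan F by rewrite eqEdim GF.
have uG : (cspan G <= lker u)%VS.
  by apply: G2 => v; rewrite GE => -[_ uv]; rewrite memv_ker uv.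
apply/seteqP; split=> v; first by rewrite GE => -[].
move=> Fv; rewrite GE; split=> //; apply/eqP; rewrite -memv_ker.
by apply: (subvP uG); rewrite spE; apply: F1.
Qed.

(** The sum of the generators is interior: enough copies of it make every coefficient of x
    positive. *)
Lemma interior_point F : F \in Sigma -> exists b, interior F (cspan F) b.
Proof.
move=> FS; have [s FE] := fan_cone FS; exists (\sum_(v <- s) v).
have Fsum (r : seq V) : {subset r <= s} -> F (\sum_(v <- r) v).
  elim: r => [|a r IHr] rs; first by rewrite big_nil FE; apply: cone_gen0.
  rewrite big_cons; apply: fan_add => //.
    by rewrite FE; apply/cone_gen_mem/rs/mem_head.
  by apply: IHr => v vr; apply: rs; rewrite inE vr orbT.
split=> [|x]; first exact: Fsum.
have -> : cspan F = <<in_tuple s>>%VS.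
  apply: is_span_uniq; split=> [v|W HW]; last first.
    by apply/span_subvP => v vs; apply: HW; rewrite FE; apply: cone_gen_mem.
  rewrite FE; apply: (cone_gen_ind (P := fun v => v \in <<in_tuple s>>%VS)).
  - exact: mem0v.
  - by move=> ? ? ? ?; apply: rpredD.
  - by move=> ? ? _ ?; apply: rpredZ.
  by move=> ? ?; apply: memv_span.
move=> xs; have /eventually_forall[n0 Hn0] : forall i : 'I_(size s), exists n0 : nat,
    forall n, (n0 <= n)%N -> 0 < coord (in_tuple s) i x + 1 *+ n.
  by move=> i; apply: archi_nat.
exists n0; rewrite FE; exists (fun i => coord (in_tuple s) i x + 1 *+ n0); split=> [i|].
  by apply/ltW/Hn0.
rewrite {1}(coord_span xs) (big_nth 0) big_mkord -sumrMnl -big_split.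
by apply: eq_bigr => i _ /=; rewrite scalerDl scaler_nat.
Qed.

End FanFaces.

Section Subdivision.
Variables (V : vectType rat) (N : set V) (Sigma S : {fset (set V)}).
Hypotheses (fanSigma : is_fan Sigma) (subS : subdivision S Sigma).
Hypotheses (latN : is_lattice N) (fanS : is_fan S) (nsS : nonsingular_fan N S).

Local Notation e := (@ray_pt V N S).
Local Notation K := (fan_complex N S).
Local Notation ray := (ray N S).
Implicit Types (A B : {set ray}) (l : ray) (F G sigma : set V) (v w : V).

Definition complex_in F : {set {set ray}} :=
  [set A in K | [forall i in A, `[< F (e i) >]]].

Lemma complex_inP F A :
  reflect (A \in K /\ forall i, i \in A -> F (e i)) (A \in complex_in F).
Proof.
rewrite inE; apply: (iffP andP) => -[AK AF]; split=> //.
  by move=> i iA; apply/asboolP; apply: (forall_inP AF).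
by apply/forall_inP => i /AF/asboolP.
Qed.

Lemma complex_in_subdivided F : F \in Sigma ->
  subdivided e (complex_in F) F (cspan F).
Proof.
move=> FS; have [F1 F2] := cspanP F; split.
- by move=> A /complex_inP[AK _]; apply: complex_free nsS _ AK.
- move=> A B /complex_inP[AK AF] BA; apply/complex_inP; split.
    exact: (complex_sub latN fanS nsS AK).
  by move=> i /(subsetP BA)/AF.
- by move=> A B w /complex_inP[AK _] /complex_inP[BK _]; apply: (complex_cap latN fanS nsS).
- by move=> A i /complex_inP[_ AF] /AF.
(* The point w lies in some gamma inside a cone sigma. A functional cutting the intersection of F
   and sigma out of sigma also cuts a face out of gamma; this face contains w and lies in F. *)
- move=> w Fw; have [sub supp] := subS.
  have : fan_support S w by rewrite supp; exists F.
  case=> gamma gS gw; have [sigma sS gsigma] := sub _ gS.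
  have [_ _ _ capS] := fanSigma; have [_ [u [u0 uE]]] := capS _ _ FS sS.
  have uF v : sigma v -> u v = 0 -> F v.
    by move=> sv uv; have : [set v | sigma v /\ u v = 0]%classic v by []; rewrite -uE => -[].
  have uw : u w = 0.
    have : (F `&` sigma)%classic w by split=> //; apply: gsigma.
    by rewrite uE => -[].
  have fg := free_verts nsS gS.
  have [|B Bg BE] := @coneset_face _ _ e (verts N S gamma) [set v | gamma v /\ u v = 0]%classic fg.
    rewrite -(coneE latN fanS nsS gS); exists u; split=> // v gv.
    by apply: u0; apply: gsigma.
  have BK : B \in K := complex_sub latN fanS nsS (verts_complex N gS) Bg.
  have inB v : in_cone e B v -> gamma v /\ u v = 0.
    by move=> vB; have : coneset e B v by []; rewrite -BE.
  exists B; last by have : [set v | gamma v /\ u v = 0]%classic w by []; rewrite BE.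
  apply/complex_inP; split=> // i iB.
  have [|gi ui] := inB (e i); first by apply: in_cone_pt => //; apply: complex_free nsS _ BK.
  by apply: uF => //; apply: gsigma.
- by move=> u v; apply: (fan_add fanSigma).
- by move=> c v; apply: (fan_scale fanSigma).
- exact: F1.
exact: F2.
Qed.

Lemma complex_in_unimodular F : F \in Sigma ->
  unimodular e (complex_in F) (cspan F) N.
Proof.
move=> FS A v topA vF; have sdF := complex_in_subdivided FS.
have [/complex_inP[AK _] _] := andP topA.
have [AS AV] := complex_coneset latN fanS nsS AK.
have := lattice_crd latN fanS nsS AS; rewrite AV; apply.
by rewrite (sp_top sdF topA).
Qed.

Lemma complex_in_set0 F : set0 \in complex_in F.
Proof.
apply/complex_inP; split; first exact: (complex_set0 latN fanS nsS).
by move=> i; rewrite inE.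
Qed.

Lemma exists_top F : F \in Sigma -> exists A, top (complex_in F) (cspan F) A.
Proof.
move=> FS; have sdF := complex_in_subdivided FS.
have [b0 ib0] := interior_point fanSigma FS.
have [b ib gb] := exists_generic sdF ib0 (walls_proper sdF).
have bU : b \in cspan F by apply: (sd_span sdF); case: ib.
have F0 : F (b + pt_sum e set0 *+ 0) by rewrite mulr0n addr0; case: ib.
have [A /and3P[topA _ _]] := good_exists sdF (complex_in_set0 F) bU gb F0.
by exists A.
Qed.

(* Let G be the smallest cone of Sigma containing B. If B is not full-dimensional in
   G, then [star_sum_eq0] applies to any l in G outside the span of B, because B
   meets the relative interior of G. *)
Lemma star_sum_dichotomy F B w : F \in Sigma -> B \in complex_in F ->
  interior F (cspan F) w -> generic (walls e (complex_in F) (cspan F)) w ->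
  (exists2 G, G \in Sigma & (G `<=` F)%classic /\ top (complex_in G) (cspan G) B) \/
  star_sum (cspan F) e (complex_in F) B w = 0.
Proof.
move=> FS BF iw gw; have [BK BinF] := complex_inP _ _ BF.
have fB := complex_free nsS BK.
pose P (k : nat) := `[< exists G, [/\ G \in Sigma, forall i, i \in B -> G (e i) & cdim G = k] >].
have exP : exists k, P k by exists (cdim F); apply/asboolP; exists F.
case: (ex_minnP exP) => _ /asboolP[G [GS BG <-]] kmin.
have minG G' : face G' G -> (forall i, i \in B -> G' (e i)) -> G' = G.
  move=> fG BG'; apply: (face_full fG); apply: kmin; apply/asboolP; exists G'; split=> //.
  by case: fanSigma => _ _ clo _; apply: clo fG.
have GF : (G `<=` F)%classic.
  have [_ _ _ capS] := fanSigma; have [fGF _] := capS _ _ GS FS.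
  have <- := minG _ fGF; first by move=> v [].
  by move=> i iB; split; [apply: BG|apply: BinF].
have [G1 G2] := cspanP G.
have spB : (sp e B <= cspan G)%VS by apply/sp_subP => i /BG /G1.
have [dimB|dimB] := eqVneq #|B| (cdim G).
  left; exists G => //; split=> //; rewrite /top dimB eqxx andbT.
  by apply/complex_inP.
right; have [l Gl lB] : exists2 l, G l & l \notin sp e B.
  apply: contrapT => no; case/eqP: dimB; apply/eqP.
  rewrite -(dim_sp fB) eqn_leq !dimvS //; apply: G2 => v Gv.
  by apply/negPn/negP => vB; apply: no; exists v.
apply: (star_sum_eq0 (fun v => lattice_scale v latN) (complex_in_subdivided FS)
  (complex_in_unimodular FS) BF iw gw (GF _ Gl) lB) => m m0 mF.
have [s GE] := fan_cone fanSigma GS.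
have Gp : G (pt_sum e B).
  rewrite /pt_sum; elim/big_ind: _ => [|u v|i]; last exact: BG.
    by rewrite GE; apply: cone_gen0.
  exact: (fan_add fanSigma).
(* A functional nonnegative on G and zero at [pt_sum e B] cuts out a face containing B, which is G
   itself, so it vanishes at l. By [farkas] some [k *: pt_sum e B - l] lies in G, and this forces m
   l <= 0. *)
have : cone_gen (- pt_sum e B :: s) (- l).
  apply: farkas => u us.
  have uG v : G v -> 0 <= (u v : rat).
    by rewrite GE; apply: hom_ge0_cone => x xs; apply: us; rewrite inE xs orbT.
  have up : u (pt_sum e B) = 0.
    apply/eqP; rewrite eq_le uG // andbT; have := us _ (mem_head _ _).
    by rewrite linearN oppr_ge0.
  have /minG E : face [set v | G v /\ u v = 0]%classic G by exists u.
  have : [set v | G v /\ u v = 0]%classic l.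
    rewrite E // => i iB; split; first exact: BG.
    move/eqP: up; rewrite linear_sum psumr_eq0 => [/allP/(_ i (mem_index_enum i))|j jB].
      by rewrite iB => /eqP.
    by apply: uG; apply: BG.
  by case=> _ ul; rewrite linearN /= ul oppr0.
case/cone_gen_cons=> k [x [k0 sx E]].
apply/eqP; rewrite eq_le (mF l (GF _ Gl)) andbT -oppr_ge0.
have mp : m (pt_sum e B) = 0 by apply: m0; apply: pt_sum_sp.
have xE : x = k *: pt_sum e B - l by rewrite E scalerN addNKr.
have Gx : G x by rewrite GE.
by have := mF x (GF _ Gx); rewrite xE linearB linearZ /= mp scaler0 sub0r.
Qed.

(** B spans G, so the intersection of G and F, a face of G, has the dimension of G. Used in both
    directions, this makes the cone in which B is full-dimensional unique. *)
Lemma top_uniq F G B : F \in Sigma -> G \in Sigma -> B \in complex_in F ->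
  top (complex_in G) (cspan G) B -> (G `<=` F)%classic.
Proof.
move=> FS GS /complex_inP[BK BF] /andP[/complex_inP[_ BG] /eqP cB].
have [_ _ _ capS] := fanSigma; have [f1 _] := capS _ _ GS FS.
have <- : (G `&` F)%classic = G; last by move=> v [].
apply: (face_full f1); rewrite [in leqLHS]/cdim -cB -(dim_sp (complex_free nsS BK)).
apply: dimvS; apply/sp_subP => i iB; have [C1 _] := cspanP (G `&` F)%classic.
by apply: C1; split; [apply: BG|apply: BF].
Qed.

End Subdivision.

(** * Todd sums sorted by the cones of Sigma *)

Section ToddSplit.
Variables (V : vectType rat) (N : set V) (Sigma S : {fset (set V)}).
Hypotheses (fanSigma : is_fan Sigma) (subS : subdivision S Sigma).
Hypotheses (latN : is_lattice N) (fanS : is_fan S) (nsS : nonsingular_fan N S).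
Variables (Psi : complement_map V).

Local Notation e := (@ray_pt V N S).
Local Notation K := (fan_complex N S).
Local Notation ray := (ray N S).
Local Notation n := (\dim (@fullv _ V)).
Local Notation cin := (complex_in N S).
Implicit Types (A B : {set ray}) (F G : set V) (w : V).

Variable h : {set ray} -> V -> {poly rat}.
Hypothesis hE : forall B w, B \in K -> w \in sp e B ->
  \prod_(i in B) todd_poly n.+1 (crd e B i w) =
  \sum_(A : {set ray} | A \subset B) 'X^#|A| * (\prod_(i in A) crd e B i w)%:P *
    h A (cone_proj Psi A w).

Definition face_term F w B := star_sum (cspan F) e (cin F) B w *: ('X^#|B| * h B (cone_proj Psi B w)).

Lemma todd_sum_expand F w : F \in Sigma -> interior F (cspan F) w ->
  generic (walls e (cin F) (cspan F)) w ->
  todd_sum e (cin F) (cspan F) set0 n.+1 w = \sum_(B in cin F) face_term F w B.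
Proof.
move=> FS iw gw; have sdF := complex_in_subdivided fanSigma subS latN fanS nsS FS.
have wU : w \in cspan F by apply: (sd_span sdF); case: iw.
have topE A : top (cin F) (cspan F) A ->
    \prod_(i in A :\: set0) ((crd e A i w)^-1 *: todd_poly n.+1 (crd e A i w)) =
    \sum_(B : {set ray} | B \subset A) (\prod_(i in A :\: B) (crd e A i w)^-1) *:
       ('X^#|B| * h B (cone_proj Psi B w)).
  move=> topA; have [/complex_inP[AK _] _] := andP topA.
  rewrite setD0 scaler_prod hE //; last by rewrite (sp_top sdF topA).
  rewrite scaler_sumr; apply: eq_bigr => B BA.
  rewrite -mulrA mulrCA mul_polyC scalerA; congr (_ *: _).
  rewrite (big_setID B) /= (setIidPr BA) mulrAC -big_split /= big1 ?mul1r // => i iB.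
  by rewrite mulVf // (generic_crd sdF) // (subsetP BA).
rewrite /todd_sum; under eq_bigr => A /andP[topA _] do rewrite topE //.
rewrite (exchange_big_dep (mem (cin F))) /=; last first.
  by move=> A B /andP[/andP[AK _] _]; apply: (sd_sub sdF).
apply: eq_bigr => B BK; rewrite -scaler_suml; congr (_ *: _).
by apply: eq_bigl => A; rewrite sub0set andbT.
Qed.

(** By [star_sum_dichotomy] a cone B contributes only if it is full-dimensional in some G, and by
    [top_uniq] this G is unique. *)
Lemma todd_sum_split F w : F \in Sigma -> interior F (cspan F) w ->
  generic (walls e (cin F) (cspan F)) w ->
  todd_sum e (cin F) (cspan F) set0 n.+1 w =
  \sum_(G : Sigma | `[< (val G `<=` F)%classic >])
    \sum_(B : {set ray} | top (cin (val G)) (cspan (val G)) B) face_term F w B.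
Proof.
move=> FS iw gw; rewrite todd_sum_expand //.
rewrite [RHS](exchange_big_dep (mem (cin F))) /=; last first.
  move=> G B /asboolP GF /andP[/complex_inP[BK BG] _]; apply/complex_inP; split=> // i iB.
  by apply: GF; apply: BG.
apply: eq_bigr => B BF.
have [[G GS [GF topG]]|z] :=
    star_sum_dichotomy fanSigma subS latN fanS nsS FS BF iw gw; last first.
  by rewrite /face_term z scale0r big1.
rewrite (big_pred1 [` GS]%fset) // => G' /=.
apply/andP/eqP => [[_ topG']|-> /=]; last by split=> //; apply/asboolP.
have [BG BG'] : B \in cin G /\ B \in cin (val G').
  by case/andP: topG => ? _; case/andP: topG' => ? _.
have G'S := valP G'; apply: val_inj; apply/seteqP; split.
  exact: (top_uniq fanSigma nsS GS G'S BG topG').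
exact: (top_uniq fanSigma nsS G'S GS BG' topG).
Qed.

Lemma star_sum_top F B w : F \in Sigma -> top (cin F) (cspan F) B ->
  star_sum (cspan F) e (cin F) B w = 1.
Proof.
move=> FS topB; rewrite /star_sum (big_pred1 B) => [|A /=].
  by rewrite setDv big_set0.
apply/andP/eqP => [[topA BA]|->//]; apply/esym/eqP.
have [_ /eqP cA] := andP topA; have [_ /eqP cB] := andP topB.
by rewrite eqEcard BA cA cB leqnn.
Qed.

Lemma pushforward_top (z : cycles S) (F : Sigma) :
  pushforward Sigma z F =
  \sum_(B : {set ray} | top (cin (val F)) (cspan (val F)) B) cycle_coef z B.
Proof.
have FS := valP F; have sdF := complex_in_subdivided fanSigma subS latN fanS nsS FS.
rewrite /pushforward sum_ffunE.
rewrite [LHS](eq_bigr (fun gamma : S =>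
   if top (cin (val F)) (cspan (val F)) (verts N S (val gamma)) then z gamma else 0)); last first.
  move=> gamma _; rewrite !ffunE.
  have gS := valP gamma.
  have E : `[< smallest_cone Sigma (val gamma) (val F) /\ cdim (val gamma) = cdim (val F) >] =
      top (cin (val F)) (cspan (val F)) (verts N S (val gamma)).
    apply/asboolP/andP => [[[_ gF _] dimg]|[/complex_inP[_ gF] /eqP dimg]].
      rewrite -(cdimE latN fanS nsS gS) dimg; split=> //; apply/complex_inP.
      split; first exact: verts_complex.
      move=> i ig; apply: gF; rewrite (coneE latN fanS nsS gS).
      by apply: in_cone_pt => //; apply: free_verts.
    have topg : top (cin (val F)) (cspan (val F)) (verts N S (val gamma)).
      by rewrite /top dimg eqxx andbT; apply/complex_inP; split=> //; apply: verts_complex.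
    have gsub G : G \in Sigma -> (forall i, i \in verts N S (val gamma) -> G (e i)) ->
        (val gamma `<=` G)%classic.
      move=> GS gG v; rewrite {1}(coneE latN fanS nsS gS) => /in_coneP[vg v0].
      rewrite (crd_sum vg); have [s GE] := fan_cone fanSigma GS.
      elim/big_ind: _ => [|u u'|i ig].
      - by rewrite GE; apply: cone_gen0.
      - exact: (fan_add fanSigma).
      by apply: (fan_scale fanSigma) => //; [apply: v0|apply: gG].
    split; last by rewrite (cdimE latN fanS nsS gS).
    split=> //; first exact: gsub.
    move=> G GS gG; apply: (top_uniq fanSigma nsS GS FS _ topg).
    apply/complex_inP; split; first exact: verts_complex.
    move=> i ig; apply: gG; rewrite (coneE latN fanS nsS gS).
    by apply: in_cone_pt => //; apply: free_verts.
  by rewrite E; case: ifP => _; rewrite [_ *: _]mulr_natr.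
have -> : \sum_(B : {set ray} | top (cin (val F)) (cspan (val F)) B) cycle_coef z B =
    \sum_(B in K) if top (cin (val F)) (cspan (val F)) B then cycle_coef z B else 0.
  rewrite -big_mkcondr; apply: eq_bigl => B; apply/idP/andP => [topB|[]//].
  by split=> //; case/andP: topB => /complex_inP[].
rewrite /fan_complex big_imset /=; last first.
  by move=> g g' _ _ /(verts_inj latN fanS nsS (valP g) (valP g'))/val_inj.
apply: eq_bigr => gamma _; case: ifP => // _; have gS := valP gamma.
rewrite (cycle_coefE latN fanS nsS _ (verts_complex N gS)); congr (z _); apply: val_inj.
by rewrite /= -(coneE latN fanS nsS gS).
Qed.

Definition top_sum F u := \sum_(B : {set ray} | top (cin F) (cspan F) B) h B u.

Lemma face_term_sum F G w c u :
  (forall B, top (cin G) (cspan G) B -> star_sum (cspan F) e (cin F) B w = c) ->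
  (forall B, top (cin G) (cspan G) B -> cone_proj Psi B w = u) ->
  \sum_(B : {set ray} | top (cin G) (cspan G) B) face_term F w B =
    c *: ('X^(cdim G) * top_sum G u).
Proof.
move=> cE uE; rewrite mulr_sumr scaler_sumr; apply: eq_bigr => B topB.
by rewrite /face_term cE // uE //; case/andP: topB => _ /eqP ->.
Qed.

End ToddSplit.

Section Independence.
Variables (V : vectType rat) (N : set V) (hN : is_lattice N).
Variables (Sigma : {fset (set V)}) (hSigma : is_fan Sigma).
Variables (Psi : complement_map V) (hPsi : rigid Psi).
Variables (Sigma1 Sigma2 : {fset (set V)}).
Hypotheses (fan1 : is_fan Sigma1) (fan2 : is_fan Sigma2).
Hypotheses (sub1 : subdivision Sigma1 Sigma) (sub2 : subdivision Sigma2 Sigma).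
Hypotheses (ns1 : nonsingular_fan N Sigma1) (ns2 : nonsingular_fan N Sigma2).
Hypotheses (compl1 : complement_for Psi Sigma1) (compl2 : complement_for Psi Sigma2).

Local Notation n := (\dim (@fullv _ V)).

(** Here rigidity enters: the two cones may come from different fans and share only their span. *)
Lemma cone_proj_rigid (S S' : {fset (set V)}) (A : {set ray N S}) (B : {set ray N S'}) :
  is_fan S -> is_fan S' -> nonsingular_fan N S -> nonsingular_fan N S' ->
  complement_for Psi S -> A \in fan_complex N S -> B \in fan_complex N S' ->
  sp (@ray_pt V N S) A = sp (@ray_pt V N S') B -> cone_proj Psi A = cone_proj Psi B.
Proof.
move=> fanS fanS' nsS nsS' complS AK BK spE.
have [AS _] := complex_coneset hN fanS nsS AK.
have [BS _] := complex_coneset hN fanS' nsS' BK.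
have fA := complex_free nsS AK; have fB := complex_free nsS' BK.
have [_ coneS _ _] := fanS; have [_ coneS' _ _] := fanS'.
rewrite /cone_proj spE; congr (daddv_pi _ _); apply/esym.
have [] // := hPsi (coneS _ AS) (coneS' _ BS) _ (complS _ AS).
by rewrite !cspan_coneset.
Qed.

Variable h1 : {set ray N Sigma1} -> V -> {poly rat}.
Variable h2 : {set ray N Sigma2} -> V -> {poly rat}.
Hypothesis h1E : forall B w, B \in fan_complex N Sigma1 -> w \in sp (@ray_pt V N Sigma1) B ->
  \prod_(i in B) todd_poly n.+1 (crd (@ray_pt V N Sigma1) B i w) =
  \sum_(A : {set ray N Sigma1} | A \subset B) 'X^#|A| *
    (\prod_(i in A) crd (@ray_pt V N Sigma1) B i w)%:P * h1 A (cone_proj Psi A w).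
Hypothesis h2E : forall B w, B \in fan_complex N Sigma2 -> w \in sp (@ray_pt V N Sigma2) B ->
  \prod_(i in B) todd_poly n.+1 (crd (@ray_pt V N Sigma2) B i w) =
  \sum_(A : {set ray N Sigma2} | A \subset B) 'X^#|A| *
    (\prod_(i in A) crd (@ray_pt V N Sigma2) B i w)%:P * h2 A (cone_proj Psi A w).
Hypotheses (h1_line : forall A, line_poly (h1 A)) (h2_line : forall A, line_poly (h2 A)).

Lemma line_poly_top_sum (S : {fset (set V)}) (h : {set ray N S} -> V -> {poly rat}) F :
  (forall A, line_poly (h A)) -> line_poly (top_sum h F).
Proof. by move=> hl; apply: line_poly_sum => B _; apply: hl. Qed.

(** The claim covers the whole span because the induction hypothesis is applied at q_A w, which need
    not be interior to the smaller cone. Keeping the power of 'X makes the bound on d the same for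
    all cones. *)
Lemma top_sum_eq F u d : F \in Sigma -> u \in cspan F -> (d < n.+1)%N ->
  ('X^(cdim F) * top_sum h1 F u)`_d = ('X^(cdim F) * top_sum h2 F u)`_d.
Proof.
have [k] := ubnP (cdim F); elim: k F u => // k IHk F u /ltnSE-le_dim FS uF ltd.
have sd1 := complex_in_subdivided hSigma sub1 hN fan1 ns1 FS.
have sd2 := complex_in_subdivided hSigma sub2 hN fan2 ns2 FS.
have un1 := complex_in_unimodular hSigma sub1 hN fan1 ns1 FS.
have un2 := complex_in_unimodular hSigma sub2 hN fan2 ns2 FS.
have scale v := lattice_scale v hN.
have FF : `[< (F `<=` F)%classic >] by apply/asboolP.
set L1 := walls (@ray_pt V N Sigma1) (complex_in N Sigma1 F) (cspan F).
set L2 := walls (@ray_pt V N Sigma2) (complex_in N Sigma2 F) (cspan F).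
have gen w : interior F (cspan F) w -> generic (L1 ++ L2) w ->
    ('X^(cdim F) * top_sum h1 F w)`_d = ('X^(cdim F) * top_sum h2 F w)`_d.
  rewrite generic_cat => iw /andP[gw1 gw2].
  have wF : w \in cspan F by apply: (sd_span sd1); case: iw.
  have sp0 (T T' : finType) (e : T -> V) (e' : T' -> V) : sp e set0 = sp e' set0.
    by apply/eqP; rewrite eqEsubv; apply/andP; split; apply/sp_subP => i; rewrite inE.
  have := todd_sum_eq scale sd1 sd2 un1 un2 (complex_in_set0 hN fan1 ns1 F)
    (complex_in_set0 hN fan2 ns2 F) (sp0 _ _ _ _) iw iw gw1 gw2 (fun m _ _ => erefl) ltd.
  rewrite (todd_sum_split hSigma sub1 hN fan1 ns1 h1E FS iw gw1).
  rewrite (todd_sum_split hSigma sub2 hN fan2 ns2 h2E FS iw gw2).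
  (* The term G = F is the claim, as its star sums are 1 and its projections fix w; the terms of the
     proper faces agree by induction. *)
  rewrite (bigD1 [` FS]%fset) //= [in RHS](bigD1 [` FS]%fset) //=.
  rewrite (@face_term_sum _ _ _ Psi h1 F F w 1 w); first last.
  - move=> B topB; have [/complex_inP[BK _] _] := andP topB.
    apply: (cone_proj_id hN fan1 ns1 compl1 BK).
    by rewrite (sp_top sd1 topB).
  - by move=> B topB; apply: (star_sum_top w FS topB).
  rewrite (@face_term_sum _ _ _ Psi h2 F F w 1 w); first last.
  - move=> B topB; have [/complex_inP[BK _] _] := andP topB.
    apply: (cone_proj_id hN fan2 ns2 compl2 BK).
    by rewrite (sp_top sd2 topB).
  - by move=> B topB; apply: (star_sum_top w FS topB).
  rewrite !scale1r !coefD; set r1 := (X in _ + X = _); set r2 := (X in _ = _ + X).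
  suff -> : r1 = r2 by move/addIr.
  rewrite /r1 /r2 !coef_sum; apply: eq_bigr => G /andP[/asboolP GF ne_GF].
  have GS := valP G.
  have dimG : (cdim (val G) < cdim F)%N.
    rewrite ltnNge; apply: contraNN ne_GF => le_FG; apply/eqP; apply: val_inj => /=.
    apply: face_full le_FG.
    have [_ _ _ capS] := hSigma; have [_] := capS _ _ GS FS.
    by rewrite ((classical_sets.setIidPl _ _).2 GF).
  have sdG1 := complex_in_subdivided hSigma sub1 hN fan1 ns1 GS.
  have sdG2 := complex_in_subdivided hSigma sub2 hN fan2 ns2 GS.
  have [B0 topB0] := exists_top hSigma sub1 hN fan1 ns1 GS.
  have spB0 := sp_top sdG1 topB0.
  have in1 B : top (complex_in N Sigma1 (val G)) (cspan (val G)) B -> B \in complex_in N Sigma1 F.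
    by case/andP=> /complex_inP[BK BG] _; apply/complex_inP; split=> // i /BG/GF.
  have in2 B : top (complex_in N Sigma2 (val G)) (cspan (val G)) B -> B \in complex_in N Sigma2 F.
    by case/andP=> /complex_inP[BK BG] _; apply/complex_inP; split=> // i /BG/GF.
  have B0K : B0 \in fan_complex N Sigma1 by case/andP: topB0 => /complex_inP[].
  (* Star sum and projection are the same for all B with the span of G, so one cone B0 of the first
     subdivision gives their values for both. *)
  pose c := star_sum (cspan F) (@ray_pt V N Sigma1) (complex_in N Sigma1 F) B0 w.
  rewrite (@face_term_sum _ _ _ Psi h1 F (val G) w c (cone_proj Psi B0 w)); first last.
  - move=> B topB; have BK : B \in fan_complex N Sigma1 by case/andP: topB => /complex_inP[].
    rewrite (cone_proj_rigid fan1 fan1 ns1 ns1 compl1 BK B0K) //.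
    by rewrite spB0 (sp_top sdG1 topB).
  - move=> B topB; apply: (star_sum_eq scale sd1 sd1 un1 un1 (in1 _ topB) (in1 _ topB0)) => //.
    by rewrite spB0 (sp_top sdG1 topB).
  rewrite (@face_term_sum _ _ _ Psi h2 F (val G) w c (cone_proj Psi B0 w)); first last.
  - move=> B topB; have BK : B \in fan_complex N Sigma2 by case/andP: topB => /complex_inP[].
    rewrite (cone_proj_rigid fan2 fan1 ns2 ns1 compl2 BK B0K) //.
    by rewrite spB0 (sp_top sdG2 topB).
  - move=> B topB; apply: (star_sum_eq scale sd2 sd1 un2 un1 (in2 _ topB) (in1 _ topB0)) => //.
    by rewrite spB0 (sp_top sdG2 topB).
  rewrite !coefZ; congr (_ * _); apply: IHk => //.
    exact: leq_trans dimG le_dim.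
  by rewrite -spB0 cone_proj_sp.
(* Far from u in a generic interior direction b, points are generic and interior; [line_poly_far]
   brings the equality back to u. *)
have [b0 ib0] := interior_point hSigma FS.
have [X|b ib gb] := exists_generic sd1 (L := L1 ++ L2) ib0.
  by rewrite mem_cat => /orP[/(walls_proper sd1)|/(walls_proper sd2)].
have [s0 Hs0] := generic_far u gb; have [s1 Hs1] := interior_far sd1 uF ib.
apply/eqP; rewrite -subr_eq0 -coefB; apply/eqP.
apply: (@line_poly_far _ (fun v => 'X^(cdim F) * top_sum h1 F v - 'X^(cdim F) * top_sum h2 F v)
   d u b (maxn s0 s1)).
  apply: line_polyD; first by apply: line_polyM; [apply: line_poly_cst|apply: line_poly_top_sum].
  have neg : line_poly (fun v => (-1) * ('X^(cdim F) * top_sum h2 F v)).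
    apply: line_polyM; first exact: line_poly_cst.
    by apply: line_polyM; [apply: line_poly_cst|apply: line_poly_top_sum].
  by move=> a c; have [P PE] := neg a c; exists P => s; rewrite -PE mulN1r.
move=> s; rewrite geq_max => /andP[/Hs0 gs /Hs1 ins].
by rewrite coefB gen // subrr.
Qed.

End Independence.

Theorem theorem1 (V : vectType rat) (N : set V) (hN : is_lattice N)
  (Sigma : {fset (set V)}) (hSigma : is_fan Sigma)
  (Psi : complement_map V) (hPsi : rigid Psi)
  (Sigma1 Sigma2 : {fset (set V)})
  (fan1 : is_fan Sigma1) (fan2 : is_fan Sigma2)
  (sub1 : subdivision Sigma1 Sigma) (sub2 : subdivision Sigma2 Sigma)
  (ns1 : nonsingular_fan N Sigma1) (ns2 : nonsingular_fan N Sigma2)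
  (compl1 : complement_for Psi Sigma1) (compl2 : complement_for Psi Sigma2)
  (R1 : cycle_ring N Sigma1 Psi) (R2 : cycle_ring N Sigma2 Psi) :
  pushforward Sigma (todd_class R1) = pushforward Sigma (todd_class R2).
Proof.
have [h1 [c1 l1 E1]] := represents_todd_class hN fan1 ns1 compl1 R1.
have [h2 [c2 l2 E2]] := represents_todd_class hN fan2 ns2 compl2 R2.
apply/ffunP => F; have FS := valP F.
(* In degree [cdim (val F)] the power of 'X is absorbed, which leaves the constant coefficients of
   h, that is, the coefficients of the cycle. *)
have topE (S : {fset (set V)}) (h : {set ray N S} -> V -> {poly rat}) (z : cycles S) :
    (forall A w, A \in fan_complex N S -> (h A w)`_0 = cycle_coef z A) ->
    \sum_(B : {set ray N S} | top (complex_in N S (val F)) (cspan (val F)) B) cycle_coef z B =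
    ('X^(cdim (val F)) * top_sum h (val F) 0)`_(cdim (val F)).
  move=> hz; rewrite coefXnM ltnn subnn coef_sum; apply: eq_bigr => B topB.
  by rewrite hz //; case/andP: topB => /complex_inP[].
rewrite (pushforward_top hSigma sub1 hN fan1 ns1) (pushforward_top hSigma sub2 hN fan2 ns2).
rewrite (topE _ h1 _ c1) (topE _ h2 _ c2).
apply: (top_sum_eq hN hSigma hPsi fan1 fan2 sub1 sub2 ns1 ns2 compl1 compl2 E1 E2 l1 l2 FS).
  exact: mem0v.
by rewrite ltnS dimvS ?subvf.
Qed.
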